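(* Suppose conditions (B1)–(B4) hold and let $\phi$ be admissible at infinity. Then there are constants $b_2\ge b_1>0$ such that for all $x,y\in M$, $$\liminf_{t\to\infty}\frac{\sup_{0<s\le t}d(x,X_s)}{\phi^{-1}(t/\log\log t)}\in[b_1,b_2]\qquad\mathbb P^y\text{-a.s.},$$ where $\phi^{-1}(t)=\sup\{r>0:\phi(r)\le t\}$.
   Context: Standing setting: $(M,d,\mu)$ is a locally compact separable metric space with a positive Radon measure $\mu$ of full support; $M_\partial=M\cup\{\partial\}$. $X$ is a Borel standard Markov process on $M_\partial$ with laws $\mathbb P^x$ and a Lévy system $(J(x,dy),ds)$: for $z\in M$, $t>0$, nonnegative Borel $F$ on $M\times M_\partial$ vanishing on the diagonal, $\mathbb E^z[\sum_{s\le t}F(X_{s-},X_s)]=\mathbb E^z[\int_0^t\int_{M_\partial}F(X_s,y)J(X_s,dy)ds]$. $B(x,r)$ is the open ball; $\tau_D=\inf\{t>0:X_t\in M_\partial\setminus D\}$. Fix a base point $o\in M$ and set $\mathsf d(x)=d(x,o)+1$. Conditions (B1)–(B4): there exist constants $R_\infty\ge1$, $\upsilon\in(0,1)$, $\ell>1$, $C_1>1$, $C_2,\dots,C_7>0$ such that for every $x\in M$ and $r>R_\infty\mathsf d(x)^\upsilon$: (B1) $C_1^{-1}\mathbb E^o[\tau_{B(o,r)}]\le\mathbb E^x[\tau_{B(x,r)}]\le C_1\mathbb E^o[\tau_{B(o,r)}]$; (B2) $2\mathbb E^o[\tau_{B(o,s/\ell)}]\le\mathbb E^o[\tau_{B(o,s)}]\le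 C_2\mathbb E^o[\tau_{B(o,s/2)}]$ for all $s>R_\infty$; (B3) $J(x,M_\partial\setminus B(x,r))\le C_3/\mathbb E^x[\tau_{B(x,r)}]$; (B4) $C_4e^{-C_5n}\le\mathbb P^x(\tau_{B(x,r)}\ge n\mathbb E^x[\tau_{B(x,r)}])\le C_6e^{-C_7n}$ for all $n\ge1$. Admissible at infinity: a nondecreasing function $\phi:(0,\infty)\to(0,\infty)$ such that for some $C\ge1$, $C^{-1}\mathbb E^x[\tau_{B(x,r)}]\le\phi(r)\le C\mathbb E^x[\tau_{B(x,r)}]$ for all $x\in M$ and $r>R_\infty\mathsf d(x)^\upsilon$. *)

(* Defs.v *)
From HB Require Import structures.
From mathcomp Require Import all_boot all_order all_algebra.
From mathcomp Require Import all_classical all_reals all_analysis measurable_realfun.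
Import Order.TTheory GRing.Theory Num.Theory.
Import numFieldNormedType.Exports.

Set Implicit Arguments.
Unset Strict Implicit.
Unset Printing Implicit Defensive.

Local Open Scope classical_set_scope.
Local Open Scope ring_scope.
Local Open Scope ereal_scope.

Section Defs.
Context {R : realType}.

Section Metric.
Context {M : Type} (d : M -> M -> R).

Definition is_metric : Prop :=
  [/\ (forall x y, (0 <= d x y)%R), (forall x y, d x y = 0%R <-> x = y),
      (forall x y, d x y = d y x) &
      (forall x y z, (d x z <= d x y + d y z)%R)].

Definition mball (x : M) (r : R) : set M := [set y | (d x y < r)%R].

Definition mopen (A : set M) : Prop :=
  forall x, A x -> exists2 r : R, (0 < r)%R & mball x r `<=` A.

Definition mcompact (K : set M) : Prop :=
  forall (I : Type) (U : I -> set M), (forall i, mopen (U i)) ->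
    K `<=` \bigcup_i U i ->
    exists F : set I, finite_set F /\ K `<=` \bigcup_(i in F) U i.

Definition locally_compact : Prop :=
  forall x, exists2 r : R, (0 < r)%R & mcompact [set y | (d x y <= r)%R].

Definition separable : Prop :=
  exists q : nat -> M, forall x (e : R), (0 < e)%R -> exists n, (d x (q n) < e)%R.

End Metric.

(* The standing setting on (M, d, mu): locally compact separable metric space
   whose measurable sets are the Borel sets, carrying a positive Radon measure
   of full support. *)
Definition standing_space {dM : measure_display} {M : measurableType dM}
    (d : M -> M -> R) : Prop :=
  [/\ is_metric d, locally_compact d, separable d,
      (@measurable _ M = <<s [set A | mopen d A] >>) &
      exists mu : {measure set M -> \bar R},
        (forall x, exists2 r : R, (0 < r)%R & mu (mball d x r) < +oo) /\
        (forall A : set M, mopen d A -> A !=set0 -> 0 < mu A)].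

(* ---------- the cemetery state: M_partial = option M, None = partial ------ *)
Section Process.
Context {dM : measure_display} {M : measurableType dM} (d : M -> M -> R).
Context {dO : measure_display} {Omega : measurableType dO}.
Variables (P : option M -> probability Omega R) (X : R -> Omega -> option M).

Definition mbl_p (B : set (option M)) : Prop := measurable (Some @^-1` B).

Definition left_lim (w : Omega) (s : R) (y : M) : Prop :=
  forall e : R, (0 < e)%R -> exists2 delta : R, (0 < delta)%R &
    forall u : R, (s - delta < u < s)%R ->
      exists2 z, X u w = Some z & (d z y < e)%R.

Definition stopping_time (filt : R -> set (set Omega)) (T : Omega -> \bar R) :=
  (forall w, 0 <= T w) /\
  forall t : R, (0 <= t)%R -> filt t [set w | T w <= t%:E].

Definition sigma_T (filt : R -> set (set Omega)) (T : Omega -> \bar R) :=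
  [set A : set Omega | measurable A /\
     forall t : R, (0 <= t)%R -> filt t (A `&` [set w | T w <= t%:E])].

Definition X_at (T : Omega -> \bar R) (t : R) (w : Omega) : option M :=
  X (fine (T w) + t)%R w.

Definition standard_process : Prop :=
  exists (filt : R -> set (set Omega)) (theta : R -> Omega -> Omega),
  [/\ [/\
   (forall t, sigma_algebra setT (filt t) /\ filt t `<=` measurable),
   (forall s t, (0 <= s <= t)%R -> filt s `<=` filt t),
   (forall t, (0 <= t)%R ->
      filt t = [set A | forall u, (t < u)%R -> filt u A]),
   (forall t (N N' : set Omega), (0 <= t)%R -> measurable N' ->
      (forall x, P x N' = 0) -> N `<=` N' -> filt t N) &
   (forall t B, (0 <= t)%R -> mbl_p B -> filt t (X t @^-1` B))],
   (forall s t w, (0 <= s)%R -> (0 <= t)%R -> X s (theta t w) = X (t + s)%R w),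
   (forall x, P x [set w | X 0%R w = x] = 1),
   (forall w s t, (0 <= s <= t)%R -> X s w = None -> X t w = None) &
   [/\
    (forall t B, (0 <= t)%R -> mbl_p B ->
       measurable_fun setT (fun x : M => P (Some x) (X t @^-1` B))),
    (forall w t x, (0 <= t)%R -> X t w = Some x ->
       forall e : R, (0 < e)%R -> exists2 delta : R, (0 < delta)%R &
         forall u, (t <= u < t + delta)%R ->
           exists2 z, X u w = Some z & (d z x < e)%R),
    (forall w t, (0 < t)%R -> X t w <> None -> exists y, left_lim w t y),
    (forall T, stopping_time filt T ->
       forall A t B x, sigma_T filt T A -> (0 <= t)%R -> mbl_p B ->
       P x (A `&` [set w | T w < +oo] `&` [set w | B (X_at T t w)]) =
       \int[P x]_(w in A `&` [set w | T w < +oo])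
          P (X_at T 0 w) (X t @^-1` B)) &
    (forall (Tn : nat -> Omega -> \bar R) T,
       (forall n, stopping_time filt (Tn n)) -> stopping_time filt T ->
       (forall w n, Tn n w <= Tn n.+1 w) ->
       (forall w, T w = ereal_sup (range (fun n => Tn n w))) ->
       forall x, {ae P x, forall w, T w < +oo -> X_at T 0 w <> None ->
         forall e : R, (0 < e)%R -> exists N, forall n, (N <= n)%N ->
           exists z y, [/\ X_at (Tn n) 0 w = Some z, X_at T 0 w = Some y,
                           Tn n w < +oo & (d z y < e)%R]})]].

(* E^z [ sum_{0 < s <= t} F(X_{s-}, X_s) ]; the sum runs over the times s at
   which X_{s-} exists in M (pairs (s, X_{s-}); left limits are unique). *)
Definition jump_sum (F : M -> option M -> \bar R) (t : R) (w : Omega) : \bar R :=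
  \esum_(p in [set p : R * M | (0 < p.1 <= t)%R /\ left_lim w p.1 p.2])
     F p.2 (X p.1 w).

(* J(x, dy) on M_partial, split as a measure J x on M plus the mass
   kappa x = J(x, {partial}) *)
Definition levy_integrand (J : M -> {measure set M -> \bar R}) (kappa : M -> \bar R)
    (F : M -> option M -> \bar R) (s : R) (w : Omega) : \bar R :=
  match X s w with
  | Some x => (\int[J x]_y F x (Some y)) + F x None * kappa x
  | None => 0
  end.

Definition levy_system (J : M -> {measure set M -> \bar R}) (kappa : M -> \bar R) :=
  [/\ (forall A, measurable A -> measurable_fun setT (fun x => J x A)),
      (forall x, 0 <= kappa x), measurable_fun setT kappa &
      forall (z : M) (t : R) (F : M -> option M -> \bar R),
        (0 < t)%R -> (forall x y, 0 <= F x y) ->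
        measurable_fun setT (fun p : M * M => F p.1 (Some p.2)) ->
        measurable_fun setT (fun x => F x None) ->
        (forall x, F x (Some x) = 0) ->
        \int[P (Some z)]_w jump_sum F t w =
        \int[P (Some z)]_w
          (\int[lebesgue_measure]_(s in [set s : R | (0 <= s <= t)%R])
              levy_integrand J kappa F s w)].

Definition exit_time (D : set M) (w : Omega) : \bar R :=
  ereal_inf [set t%:E | t in [set t : R | (0 < t)%R /\ ~ (Some @` D) (X t w)]].

Definition Etau (x : M) (r : R) : \bar R :=
  \int[P (Some x)]_w exit_time (mball d x r) w.

Definition J_out (J : M -> {measure set M -> \bar R}) (kappa : M -> \bar R)
    (x : M) (r : R) : \bar R := J x (~` mball d x r) + kappa x.

Definition large_r (o : M) (Rinf ups : R) (x : M) (r : R) : Prop :=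
  (Rinf * (d x o + 1) `^ ups < r)%R.

Definition conditions_B (J : M -> {measure set M -> \bar R}) (kappa : M -> \bar R)
    (o : M) (Rinf ups ell C1 C2 C3 C4 C5 C6 C7 : R) : Prop :=
  [/\ [/\ (1 <= Rinf)%R, (0 < ups < 1)%R, (1 < ell)%R & (1 < C1)%R],
      [/\ (0 < C2)%R, (0 < C3)%R, (0 < C4)%R & (0 < C5)%R],
      (0 < C6)%R /\ (0 < C7)%R & [/\
      (forall x r, large_r o Rinf ups x r ->
         (C1^-1)%:E * Etau o r <= Etau x r /\ Etau x r <= C1%:E * Etau o r),
      (forall s, (Rinf < s)%R ->
         2%:E * Etau o (s / ell) <= Etau o s /\ Etau o s <= C2%:E * Etau o (s / 2)),
      (forall x r, large_r o Rinf ups x r -> J_out J kappa x r <= C3%:E / Etau x r) &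
      (forall x r (n : nat), large_r o Rinf ups x r -> (1 <= n)%N ->
         (C4 * expR (- C5 * n%:R))%:E <=
           P (Some x) [set w | n%:R%:E * Etau x r <= exit_time (mball d x r) w] /\
         P (Some x) [set w | n%:R%:E * Etau x r <= exit_time (mball d x r) w] <=
           (C6 * expR (- C7 * n%:R))%:E)]].

Definition admissible (o : M) (Rinf ups : R) (phi : R -> R) : Prop :=
  [/\ (forall r, (0 < r)%R -> (0 < phi r)%R),
      (forall r s, (0 < r <= s)%R -> (phi r <= phi s)%R) &
      exists2 C : R, (1 <= C)%R & forall x r, large_r o Rinf ups x r ->
        (C^-1)%:E * Etau x r <= (phi r)%:E /\ (phi r)%:E <= C%:E * Etau x r].

Definition dist_p (x : M) (v : option M) : \bar R :=
  if v is Some z then (d x z)%:E else +oo.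

Definition sup_dist (x : M) (t : R) (w : Omega) : \bar R :=
  ereal_sup [set dist_p x (X s w) | s in [set s : R | (0 < s <= t)%R]].

End Process.

Definition phi_inv (phi : R -> R) (t : R) : \bar R :=
  ereal_sup [set r%:E | r in [set r : R | (0 < r)%R /\ (phi r <= t)%R]].

Definition liminf_infty (g : R -> \bar R) : \bar R :=
  ereal_sup [set ereal_inf (g @` [set t : R | (T < t)%R]) | T in [set: R]].

End Defs.

(* Main.v *)
Require Import Defs.
From HB Require Import structures.
From mathcomp Require Import all_boot all_order all_algebra.
From mathcomp Require Import all_classical all_reals all_analysis measurable_realfun.
From mathcomp Require Import ring lra.
Import Order.TTheory GRing.Theory Num.Theory.
Import numFieldNormedType.Exports.

(** The lower bound needs no Markov property. Along [t = 2^k], (B4) bounds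
    [P^y (tau_{B(y,r)} >= n E tau)] by [C6 exp (- C7 n)] with [n] of order
    [ln (ln t)], which is summable in [k] when [r] is a small multiple of
    [phi^-1 (t / ln (ln t))]; the first Borel-Cantelli lemma concludes.

    For the upper bound take [t_n = exp (n^3)] and [r_n] a large multiple of
    [phi^-1 (t_n / ln (ln t_n))]. By (B4) and the Markov property at [t_{n-1}],
    given that the path has stayed in [B(y, r_n)] so far, it stays in
    [B(y, 2 r_n)] up to [t_n] with conditional probability at least [c / n]; these
    lower bounds have a divergent sum, so infinitely often it does, provided
    that almost surely the path stays in [B(y, r_n)] up to [t_{n-1}] for all
    large [n]. To leave [B(y, r)] by time [t], a path either makes a jump of size
    [b], which by (B3) and the Levy system has probability [O(t / phi b)], or
    moves [r / 2b] times by at least [b], each time with conditional probability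
    at most [1 - c]. With [b = r_n / 2^n] this is summable.

    Two points are less standard. (B4) speaks of exit times from open balls,
    whose measurability for the given sigma-algebra comes from
    quasi-left-continuity. And the Levy system only sees those deaths that have
    a left limit: a path dying without one either leaves every compact set or
    oscillates, hence its death is announced by events of its past, whereas
    (B4) gives every state a probability at least [c] of living forever. *)

Set Implicit Arguments.
Unset Strict Implicit.
Unset Printing Implicit Defensive.

Local Open Scope classical_set_scope.
Local Open Scope ring_scope.
Local Open Scope ereal_scope.

(** The Markov property in use speaks of the state at one later time, while the argument conditions
    on whole path segments. Such events are therefore tested on dyadic grids, where transition
    kernels can be iterated; a lower bound known for the path holds on every grid, and so in the
    limit. Closed balls make this work: a right-continuous path found outside one stays outside for
    a while.

    A second obstacle is that (B3) and (B4) hold at [x] only for radii above a multiple of the power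
    [ups < 1] of the distance to the base point. The small scale [r_n / 2^n] must qualify at every
    point of [B(y, r_n)], which is why [r_n] has to grow at least like [2^(n^2)].

    The order inserted in (B4) decides on which side of summability one lands: about
    [2 ln (ln t) / C7] along [t = 2^k] gives terms of order [k^-2], about [ln n / C5] along [t_n]
    gives [1/n]. Constants lost in comparing [phi] with mean exit times are absorbed by dilating the
    radius, because (B2) makes these times grow at least like a power. *)

Ltac invlra :=
  repeat match goal with H : context [GRing.inv _] |- _ => revert H end;
  repeat (move: (_^-1)%R => ?); intros; lra.

(** * Process, state space and filtration *)

Section data.
Context {R : realType} {dM : measure_display} {M : measurableType dM}
  (d : M -> M -> R) {dO : measure_display} {Omega : measurableType dO}
  (P : option M -> probability Omega R) (X : R -> Omega -> option M)
  (filt : R -> set (set Omega)).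

(* [standard_process] for a given filtration, without the shift operators: the
   Markov property only enters through marginal laws. *)
Record standard_data : Prop := StandardData {
  filt_sigma : forall t, sigma_algebra setT (filt t);
  filt_measurable : forall t A, filt t A -> measurable A;
  filt_mono : forall s t, (0 <= s <= t)%R -> filt s `<=` filt t;
  filt_right : forall t, (0 <= t)%R ->
    filt t = [set A | forall u, (t < u)%R -> filt u A];
  filt_null : forall t (N N' : set Omega), (0 <= t)%R -> measurable N' ->
    (forall x, P x N' = 0) -> N `<=` N' -> filt t N;
  adapted : forall t B, (0 <= t)%R -> mbl_p B -> filt t (X t @^-1` B);
  start_at : forall x, P x [set w | X 0%R w = x] = 1;
  dead_stays : forall w s t, (0 <= s <= t)%R -> X s w = None -> X t w = None;
  measurable_trans : forall t B, (0 <= t)%R -> mbl_p B ->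
    measurable_fun setT (fun x : M => P (Some x) (X t @^-1` B));
  right_cont : forall w t x, (0 <= t)%R -> X t w = Some x ->
    forall e : R, (0 < e)%R -> exists2 delta : R, (0 < delta)%R &
      forall u, (t <= u < t + delta)%R ->
        exists2 z, X u w = Some z & (d z x < e)%R;
  has_left_lim : forall w t, (0 < t)%R -> X t w <> None ->
    exists y, left_lim d X w t y;
  strong_markov : forall T, stopping_time filt T ->
    forall A t B x, sigma_T filt T A -> (0 <= t)%R -> mbl_p B ->
    P x (A `&` [set w | T w < +oo] `&` [set w | B (X_at X T t w)]) =
    \int[P x]_(w in A `&` [set w | T w < +oo])
       P (X_at X T 0 w) (X t @^-1` B);
  quasi_left_cont : forall (Tn : nat -> Omega -> \bar R) T,
    (forall n, stopping_time filt (Tn n)) -> stopping_time filt T ->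
    (forall w n, Tn n w <= Tn n.+1 w) ->
    (forall w, T w = ereal_sup (range (fun n => Tn n w))) ->
    forall x, {ae P x, forall w, T w < +oo -> X_at X T 0 w <> None ->
      forall e : R, (0 < e)%R -> exists N, forall n, (N <= n)%N ->
        exists z y, [/\ X_at X (Tn n) 0 w = Some z, X_at X T 0 w = Some y,
                        Tn n w < +oo & (d z y < e)%R]} }.

End data.

Lemma standard_processP {R : realType} {dM : measure_display}
  {M : measurableType dM} (d : M -> M -> R) {dO : measure_display}
  {Omega : measurableType dO} (P : option M -> probability Omega R)
  (X : R -> Omega -> option M) :
  standard_process d P X -> exists filt, standard_data d P X filt.
Proof.
move=> [filt [theta [[H1 H2 H3 H4 H5] _ H7 H8 [H9 H10 H11 H12 H13]]]].
exists filt; split => //.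
- by move=> t; case: (H1 t).
- by move=> t; case: (H1 t).
Qed.

(** The cemetery lies outside every ball, so dying counts as leaving. The complement is open in [M]
    and the cemetery absorbing, hence a path that leaves remains outside for a positive time. *)
Definition cball {R : realType} {M : Type} (d : M -> M -> R) (x : M) (r : R) :
  set (option M) := [set v | if v is Some z then (d x z <= r)%R else False].

Section space.
Context {R : realType} {dM : measure_display} {M : measurableType dM}
  {d : M -> M -> R} (Hs : standing_space d).

Lemma d_ge0 x y : (0 <= d x y)%R.
Proof. by case: Hs => -[]. Qed.

Lemma d_sym x y : d x y = d y x.
Proof. by case: Hs => -[]. Qed.

Lemma d_tri x y z : (d x z <= d x y + d y z)%R.
Proof. by case: Hs => -[]. Qed.

Lemma d_refl x : d x x = 0%R.
Proof. by case: Hs => -[_ h _ _] _ _ _ _; apply/h. Qed.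

Lemma d_eq0 x y : d x y = 0%R -> x = y.
Proof. by case: Hs => -[_ h _ _] _ _ _ _ /h. Qed.

Lemma mopen_measurable (A : set M) : mopen d A -> measurable A.
Proof. by case: Hs => _ _ _ -> _ oA; exact: sub_sigma_algebra. Qed.

Lemma mopen_gt x (r : R) : mopen d [set z | (r < d x z)%R].
Proof.
move=> z /= rz; exists (d x z - r)%R; first lra.
move=> y; rewrite /mball/= => zy.
have := d_tri x y z; rewrite (d_sym y z); lra.
Qed.

Lemma mopen_lt x (r : R) : mopen d [set z | (d x z < r)%R].
Proof.
move=> z /= rz; exists (r - d x z)%R; first lra.
move=> y; rewrite /mball/= => zy.
have := d_tri x z y; lra.
Qed.

Lemma cballS (x : M) r r' : (r <= r')%R -> cball d x r `<=` cball d x r'.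
Proof. by move=> rr' [z|]//=; move/le_trans; apply. Qed.

Lemma cball_tri x y r v : cball d y r v -> cball d x (d x y + r) v.
Proof.
case: v => //= z yz; have := d_tri x y z; lra.
Qed.

Lemma mbl_preim (B : set M) (f : option M -> Prop) : measurable B ->
  (forall z, f (Some z) <-> B z) -> mbl_p [set v | f v].
Proof.
move=> mB h; rewrite /mbl_p (_ : _ @^-1` _ = B)//.
by apply/seteqP; split => z /h.
Qed.

Lemma mbl_cball x r : mbl_p (cball d x r).
Proof.
rewrite /mbl_p (_ : _ @^-1` _ = ~` [set z | (r < d x z)%R]); last first.
  by apply/seteqP; split => z /=; rewrite leNgt => /negP.
exact/measurableC/mopen_measurable/mopen_gt.
Qed.

Lemma mbl_alive : mbl_p [set v : option M | v <> None].
Proof. by apply: (@mbl_preim setT). Qed.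

Lemma mbl_some (B : set M) : measurable B -> mbl_p (Some @` B).
Proof.
move=> mB; rewrite /mbl_p (_ : _ @^-1` _ = B)//.
by apply/seteqP; split => z /=; [move=> [y By [<-]]|move=> Bz; exists z].
Qed.

Lemma mblC (B : set (option M)) : mbl_p B -> mbl_p (~` B).
Proof. by move=> mB; rewrite /mbl_p preimage_setC; exact: measurableC. Qed.

Lemma large_rP o Rinf ups x r r' : large_r d o Rinf ups x r -> (r <= r')%R ->
  large_r d o Rinf ups x r'.
Proof. by rewrite /large_r => h; exact: lt_le_trans. Qed.

End space.

Section filtration.
Context {R : realType} {dM : measure_display} {M : measurableType dM}
  {d : M -> M -> R} {dO : measure_display} {Omega : measurableType dO}
  {P : option M -> probability Omega R} {X : R -> Omega -> option M}
  {filt : R -> set (set Omega)} (Hp : standard_data d P X filt).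

Lemma filt0 t : filt t set0.
Proof. by case: (filt_sigma Hp t). Qed.

Lemma filtC t A : filt t A -> filt t (~` A).
Proof. by case: (filt_sigma Hp t) => _ h _ /h; rewrite setTD. Qed.

Lemma filt_bigcup t (F : nat -> set Omega) :
  (forall n, filt t (F n)) -> filt t (\bigcup_n F n).
Proof. by case: (filt_sigma Hp t) => _ _; exact. Qed.

Lemma filt_bigcap t (F : nat -> set Omega) :
  (forall n, filt t (F n)) -> filt t (\bigcap_n F n).
Proof.
move=> h; rewrite -(setCK (\bigcap_n _)) setC_bigcap.
by apply/filtC/filt_bigcup => n; exact/filtC.
Qed.

Lemma filtT t : filt t setT.
Proof. by rewrite -setC0; exact/filtC/filt0. Qed.

Lemma filtU t A B : filt t A -> filt t B -> filt t (A `|` B).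
Proof.
move=> fA fB; rewrite -bigcup2E; apply: filt_bigcup => -[//|[//|n]].
exact: filt0.
Qed.

Lemma filtI t A B : filt t A -> filt t B -> filt t (A `&` B).
Proof.
move=> fA fB; rewrite -(setCK (_ `&` _)) setCI.
by apply/filtC/filtU; exact/filtC.
Qed.

Lemma filtD t A B : filt t A -> filt t B -> filt t (A `\` B).
Proof. by move=> fA fB; rewrite setDE; apply/filtI/filtC. Qed.

Lemma measurable_X t B : (0 <= t)%R -> mbl_p B -> measurable (X t @^-1` B).
Proof. by move=> t0 mB; exact/(filt_measurable Hp)/(adapted Hp). Qed.

Lemma simple_markov s t A B x : (0 <= s)%R -> (0 <= t)%R -> filt s A -> mbl_p B ->
  P x (A `&` X (s + t)%R @^-1` B) = \int[P x]_(w in A) P (X s w) (X t @^-1` B).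
Proof.
move=> s0 t0 fA mB.
have st : stopping_time filt (fun=> s%:E).
  split=> [w|u u0]; first by rewrite lee_fin.
  have [su|us] := leP s u.
    rewrite (_ : [set _ | _] = setT); first exact: filtT.
    by apply/seteqP; split => w //=; rewrite lee_fin.
  rewrite (_ : [set _ | _] = set0); first exact: filt0.
  by apply/seteqP; split => w //=; rewrite lee_fin leNgt us.
have sA : sigma_T filt (fun=> s%:E) A.
  split; first exact: (filt_measurable Hp fA).
  move=> u u0; have [su|us] := leP s u.
    rewrite (_ : [set _ | _] = setT); last first.
      by apply/seteqP; split => w //=; rewrite lee_fin.
    by rewrite setIT; apply: (filt_mono Hp _ fA); rewrite s0.
  rewrite (_ : [set _ | _] = set0); last first.
    by apply/seteqP; split => w //=; rewrite lee_fin leNgt us.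
  by rewrite setI0; exact: filt0.
have := strong_markov Hp st x sA t0 mB.
rewrite (_ : [set w | s%:E < +oo] = setT); last first.
  by apply/seteqP; split => w //=; rewrite ltry.
by rewrite setIT /X_at/= addr0.
Qed.

End filtration.

(** * Sample paths and exit times *)

Section archimedean.
Context {R : realType}.

Lemma natSinv_lt_eps (e : R) : (0 < e)%R -> exists n : nat, (n.+1%:R^-1 < e)%R.
Proof.
move=> e0; exists (Num.truncn e^-1).
rewrite -[ltRHS]invrK ltf_pV2 ?posrE ?invr_gt0//.
by have /Num.Theory.truncn_itv/andP[_] : (0 <= e^-1)%R by rewrite invr_ge0 ltW.
Qed.

Lemma pow2_ge (m : nat) : (m.+1%:R <= 2 ^+ m :> R)%R.
Proof. by rewrite -natrX ler_nat ltn_expl. Qed.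

Lemma pow2V_lt_eps (e : R) : (0 < e)%R ->
  exists m0 : nat, forall m, (m0 <= m)%N -> ((2 ^+ m)^-1 < e)%R.
Proof.
move=> /natSinv_lt_eps[n ne]; exists n => m nm; apply: le_lt_trans ne.
rewrite lef_pV2 ?posrE ?exprn_gt0//.
by apply: le_trans (pow2_ge m); rewrite ler_nat ltnS.
Qed.

Definition dyad (a b : R) (m j : nat) : R := (a + j%:R * ((b - a) / 2 ^+ m))%R.

Lemma dyad0 a b m : dyad a b m 0 = a.
Proof. by rewrite /dyad mul0r addr0. Qed.

Lemma dyad_last a b m : dyad a b m (2 ^ m) = b.
Proof.
have h : (2 ^+ m != 0 :> R)%R by rewrite expf_neq0// pnatr_eq0.
by rewrite /dyad natrX mulrC (divfK h) addrC subrK.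
Qed.

Lemma dyad_le a b m j k : (a <= b)%R -> (j <= k)%N ->
  (dyad a b m j <= dyad a b m k)%R.
Proof.
move=> ab jk; rewrite lerD2l ler_wpM2r ?ler_nat// divr_ge0 ?subr_ge0//.
Qed.

Lemma dyad_lt a b m j k : (a < b)%R -> (j < k)%N ->
  (dyad a b m j < dyad a b m k)%R.
Proof.
move=> ab jk; rewrite ltrD2l ltr_pM2r ?ltr_nat// divr_gt0 ?subr_gt0//.
Qed.

Lemma dyad_itv a b m j : (a <= b)%R -> (j <= 2 ^ m)%N ->
  (a <= dyad a b m j <= b)%R.
Proof.
move=> ab jm; have := dyad_le m ab (leq0n j); have := dyad_le m ab jm.
by rewrite dyad0 dyad_last => -> ->.
Qed.

Lemma dyadS a b m j : dyad a b m.+1 j.*2 = dyad a b m j.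
Proof.
rewrite /dyad exprS -mul2n natrM; congr (_ + _)%R.
have h : (2 ^+ m != 0 :> R)%R by rewrite expf_neq0// pnatr_eq0.
by field.
Qed.

Lemma dyad_next (a b s : R) : (a <= s < b)%R -> forall m, exists j,
  (j <= 2 ^ m)%N /\ (s < dyad a b m j <= s + (b - a) / 2 ^+ m)%R.
Proof.
move=> /andP[as_ sb] m.
set h := ((b - a) / 2 ^+ m)%R.
have h0 : (0 < h)%R by rewrite divr_gt0 ?exprn_gt0//; lra.
have sa0 : (0 <= (s - a) / h)%R by rewrite divr_ge0 ?(ltW h0)//; lra.
have /Num.Theory.truncn_itv/andP[h1 h2] := sa0.
exists (Num.truncn ((s - a) / h)).+1.
move: h1 h2; set j := Num.truncn _; rewrite ler_pdivlMr// ltr_pdivrMr// => h1 h2.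
split.
  rewrite -(@ltr_nat R) natrX -(ltr_pM2r h0).
  rewrite (_ : 2 ^+ m * h = b - a)%R; first lra.
  by rewrite /h mulrC divfK// expf_neq0// pnatr_eq0.
by rewrite /dyad -/h -natr1; apply/andP; split; [|rewrite mulrDl]; rewrite -?natr1 in h2 *; lra.
Qed.

End archimedean.

Definition stay {R : realType} {M Omega : Type} (d : M -> M -> R)
    (X : R -> Omega -> option M) (x : M) (r a b : R) : set Omega :=
  [set w | forall s, (a <= s <= b)%R -> cball d x r (X s w)].

Definition dstay {R : realType} {M Omega : Type} (d : M -> M -> R)
    (X : R -> Omega -> option M) (x : M) (r a b : R) (m : nat) : set Omega :=
  [set w | forall j, (j <= 2 ^ m)%N -> cball d x r (X (dyad a b m j) w)].

Definition hit {R : realType} {M Omega : Type} (d : M -> M -> R)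
    (X : R -> Omega -> option M) (x : M) (r a : R) (w : Omega) : \bar R :=
  ereal_inf [set s%:E | s in [set s | (a <= s)%R /\ ~ cball d x r (X s w)]].

Section paths.
Context {R : realType} {dM : measure_display} {M : measurableType dM}
  {d : M -> M -> R} {dO : measure_display} {Omega : measurableType dO}
  {P : option M -> probability Omega R} {X : R -> Omega -> option M}
  {filt : R -> set (set Omega)}.
Hypotheses (Hs : standing_space d) (Hp : standard_data d P X filt).

Lemma right_cont_out x r s w : (0 <= s)%R -> ~ cball d x r (X s w) ->
  exists2 e : R, (0 < e)%R &
    forall u, (s <= u < s + e)%R -> ~ cball d x r (X u w).
Proof.
move=> s0; case E : (X s w) => [z|] /=; last first.
  move=> _; exists 1%R => // u /andP[su _].
  by rewrite (@dead_stays _ _ _ _ _ _ _ _ _ Hp w s u)// s0.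
move=> /negP; rewrite -ltNge => rz.
have [|e e0 h] := right_cont Hp s0 E (e := d x z - r); first lra.
exists e => // u /h[y -> yz] /=; apply/negP; rewrite -ltNge.
by have := d_tri Hs x y z; lra.
Qed.

Lemma right_cont_in x r s w z : (0 <= s)%R -> X s w = Some z -> (d x z < r)%R ->
  exists2 e : R, (0 < e)%R &
    forall u, (s <= u < s + e)%R -> exists2 y, X u w = Some y & (d x y < r)%R.
Proof.
move=> s0 E zr.
have [|e e0 h] := right_cont Hp s0 E (e := r - d x z); first lra.
exists e => // u /h[y -> yz]; exists y => //.
have := d_tri Hs x z y; rewrite (d_sym Hs z y); lra.
Qed.

Lemma dstay_decr x r a b m : (a <= b)%R ->
  dstay d X x r a b m.+1 `<=` dstay d X x r a b m.
Proof.
move=> ab w h j jm; rewrite -dyadS; apply: h.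
by rewrite -mul2n expnS leq_mul2l jm.
Qed.

(** A path outside at some [s < b] is outside on an interval to the right of [s], which contains
    points of all fine grids; [b] itself belongs to every grid. *)
Lemma stay_dstay x r a b : (0 <= a <= b)%R ->
  stay d X x r a b = \bigcap_m dstay d X x r a b m.
Proof.
move=> /andP[a0 ab]; apply/seteqP; split => w.
  by move=> h m _ j jm; apply: h; exact: dyad_itv.
move=> h s /andP[as_]; rewrite le_eqVlt => /predU1P[->|sb].
  by rewrite -(dyad_last a b 0); exact: h.
apply: contrapT => /right_cont_out[|e e0 out]; first exact: le_trans as_.
have [|m0 /(_ _ (leqnn _)) hm] := @pow2V_lt_eps R (e / (b - a)).
  by rewrite divr_gt0//; lra.
have [|j [jm /andP[sj js]]] := @dyad_next R a b s _ m0; first by rewrite as_.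
apply: (out (dyad a b m0 j)); last exact: (h m0 I).
rewrite (ltW sj)/= (le_lt_trans js)// ltrD2l.
by rewrite mulrC -ltr_pdivlMr//; lra.
Qed.

Lemma filt_dstay x r a b m : (0 <= a <= b)%R -> filt b (dstay d X x r a b m).
Proof.
move=> /andP[a0 ab].
rewrite (_ : dstay _ _ _ _ _ _ _ = \bigcap_j (if (j <= 2 ^ m)%N then
  X (dyad a b m j) @^-1` (cball d x r) else setT)); last first.
  apply/seteqP; split => w h j; first by case: ifPn => // jm _; exact: h.
  by move=> jm; have := h j I; rewrite jm.
apply: (filt_bigcap Hp) => j; case: ifPn => [jm|_]; last exact: (filtT Hp).
have /andP[h1 h2] := dyad_itv ab jm.
apply: (filt_mono Hp) (adapted Hp _ (mbl_cball Hs x r)).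
  by rewrite h2 (le_trans a0).
exact: le_trans h1.
Qed.

Lemma filt_stay x r a b : (0 <= a <= b)%R -> filt b (stay d X x r a b).
Proof.
move=> ab; rewrite stay_dstay//; apply: (filt_bigcap Hp) => m.
exact: filt_dstay.
Qed.

Lemma hit_lt x r a w v :
  hit d X x r a w < v%:E <-> exists s, (a <= s < v)%R /\ ~ cball d x r (X s w).
Proof.
split=> [/ereal_inf_lt[_ [s [as_ ns] <-]]|[s [/andP[as_ sv] ns]]].
  by rewrite lte_fin => sv; exists s; rewrite as_.
apply: (@le_lt_trans _ _ s%:E); last by rewrite lte_fin.
by apply: ereal_inf_lbound; exists s.
Qed.

Lemma hit_ge x r a w : a%:E <= hit d X x r a w.
Proof. by apply: le_ereal_inf_tmp => _ [s [as_ _] <-]; rewrite lee_fin. Qed.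

Lemma hit_ndec x r r' a w : (r <= r')%R -> hit d X x r a w <= hit d X x r' a w.
Proof.
move=> rr'; apply: ereal_inf_le_tmp => _ [s [as_ ns] <-].
by exists s => //; split => // h; apply: ns; exact: (cballS rr').
Qed.

Lemma filt_hit_lt x r a v : (0 <= a)%R -> (0 <= v)%R ->
  filt v [set w | hit d X x r a w < v%:E].
Proof.
move=> a0 v0; have [va|av] := leP v a.
  rewrite (_ : [set _ | _] = set0); first exact: (filt0 Hp).
  apply/seteqP; split => w //= /hit_lt[s [/andP[]]]; lra.
(* The times [b k] increase to [v] without reaching it: being out strictly before [v] means failing
   to stay up to some [b k]. *)
pose b k := (v - (v - a) * k.+1%:R^-1)%R.
have ab k : (a <= b k < v)%R.
  rewrite /b; have k0 : (0 < k.+1%:R^-1 :> R)%R by rewrite invr_gt0.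
  have k1 : (k.+1%:R^-1 <= 1 :> R)%R by rewrite invf_le1// ler1n.
  by move: (_^-1)%R k0 k1 => q q0 q1; apply/andP; split; nra.
rewrite (_ : [set _ | _] = \bigcup_k ~` stay d X x r a (b k)); last first.
  apply/seteqP; split => w /=.
    move=> /hit_lt[s [/andP[as_ sv] ns]].
    have [|k kv] := @natSinv_lt_eps R ((v - s) / (v - a)).
      by rewrite divr_gt0//; lra.
    exists k => //; apply/existsNP; exists s => /(_ _)h; apply: ns; apply: h.
    rewrite as_/= /b; move: kv; rewrite ltr_pdivlMr; [|lra]; move: (_^-1)%R => q; lra.
  move=> [k _] /existsNP[s] /not_implyP[/andP[as_ sb] ns].
  by apply/hit_lt; exists s; rewrite as_/=; have /andP[_] := ab k; split=> //; lra.
apply: (filt_bigcup Hp) => k; apply: (filtC Hp).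
have /andP[h1 h2] := ab k.
apply: (filt_mono Hp) (filt_stay x r _); last by rewrite a0.
by rewrite (ltW h2) (le_trans a0).
Qed.

(** A path may leave immediately after [u], so [hit <= u] is only decided by looking slightly beyond
    [u]; right continuity of the filtration absorbs this. *)
Lemma hit_stopping x r a : (0 <= a)%R -> stopping_time filt (hit d X x r a).
Proof.
move=> a0; split=> [w|u u0].
  by apply: le_trans (hit_ge _ _ _ _); rewrite lee_fin.
rewrite (filt_right Hp u0) => v uv.
pose c k := (u + (v - u) * k.+1%:R^-1)%R.
have uc k : (u < c k <= v)%R.
  rewrite /c; have k0 : (0 < k.+1%:R^-1 :> R)%R by rewrite invr_gt0.
  have k1 : (k.+1%:R^-1 <= 1 :> R)%R by rewrite invf_le1// ler1n.
  by move: (_^-1)%R k0 k1 => q q0 q1; apply/andP; split; nra.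
rewrite (_ : [set _ | _] = \bigcap_k [set w | hit d X x r a w < (c k)%:E]); last first.
  apply/seteqP; split => w /=.
    by move=> h k _ /=; apply: le_lt_trans h _; rewrite lte_fin; case/andP: (uc k).
  move=> h; apply/lee_addgt0Pr => e e0.
  have [|k kv] := @natSinv_lt_eps R (e / (v - u)); first by rewrite divr_gt0//; lra.
  apply: le_trans (ltW (h k I)) _.
  by rewrite -EFinD lee_fin /c; move: kv; rewrite ltr_pdivlMr; [|lra]; move: (_^-1)%R => q; lra.
apply: (filt_bigcap Hp) => k; have /andP[h1 h2] := uc k.
apply: (filt_mono Hp) (filt_hit_lt _ _ a0 _); last by lra.
by rewrite h2 andbT; lra.
Qed.

Lemma at_hit x r a w s : (0 <= a)%R -> hit d X x r a w = s%:E ->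
  forall z, X s w = Some z -> (r <= d x z)%R.
Proof.
move=> a0 hs z Xz; rewrite leNgt; apply/negP => zr.
have as_ : (a <= s)%R by rewrite -lee_fin -hs hit_ge.
have [|e e0 h] := right_cont_in _ Xz zr; first exact: le_trans as_.
have : hit d X x r a w < (s + e)%:E by rewrite hs lte_fin; lra.
move=> /hit_lt[u [/andP[au us] nu]].
have su : (s <= u)%R.
  by rewrite -lee_fin -hs; apply: ereal_inf_lbound; exists u.
have [|y Xy yr] := h u; first by rewrite su.
by apply: nu; rewrite Xy /=; exact: ltW.
Qed.

End paths.

Section exit.
Context {R : realType} {dM : measure_display} {M : measurableType dM}
  {d : M -> M -> R} {dO : measure_display} {Omega : measurableType dO}
  {P : option M -> probability Omega R} {X : R -> Omega -> option M}
  {filt : R -> set (set Omega)}.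
Hypotheses (Hs : standing_space d) (Hp : standard_data d P X filt).

Definition in_ball x r (v : option M) : Prop :=
  if v is Some z then (d x z < r)%R else False.

Lemma in_ballP x r v : (Some @` mball d x r) v <-> in_ball x r v.
Proof. by case: v => [z|]; split => //=; [move=> [y yr [<-]]|move=> zr; exists z|case]. Qed.

Lemma cball_in_ball x r r' v : (r' < r)%R -> cball d x r' v -> in_ball x r v.
Proof. by case: v => //= z rr /le_lt_trans; apply. Qed.

(* [X_T] is evaluated along dyadic times decreasing to [T]. *)
Lemma measurable_stopped_in_ball (T : Omega -> \bar R) x r a b :
  (0 <= a)%R -> stopping_time filt T -> (forall w, a%:E <= T w) ->
  measurable [set w | T w <= b%:E /\ in_ball x r (X (fine (T w)) w)].
Proof.
move=> a0 [T0 Tst] aT.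
have mT (u : R) : measurable [set w | T w <= u%:E].
  have [u0|u0] := leP 0%R u; first exact/(filt_measurable Hp)/Tst.
  rewrite (_ : [set _ | _] = set0)//; apply/seteqP; split => w //= Tu.
  by have := le_trans (T0 w) Tu; rewrite lee_fin leNgt u0.
pose h m : R := (2 ^+ m)^-1%R.
have h0 m : (0 < h m)%R by rewrite invr_gt0 exprn_gt0.
pose p m (j : nat) : R := (a + j%:R * h m)%R.
have p0 m j : (0 <= p m j)%R by rewrite addr_ge0// mulr_ge0// ltW.
have pS m j : p m j.+1 = (p m j + h m)%R by rewrite /p -natr1 mulrDl mul1r addrA.
(* If [T] falls in the cell ending at [p m j], the path is read one cell later, hence strictly after
   [T] and within two mesh sizes. The margin [i.+1%:R^-1] writes the open ball as a union of closed
   ones; holding for all large [m] is then equivalent to [X_T] being inside, by right continuity. *)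
pose G i m := \bigcup_j (([set w | T w <= (p m j)%:E] `\`
   [set w | T w <= (p m j - h m)%:E]) `&`
   (X (p m j.+1) @^-1` cball d x (r - i.+1%:R^-1))).
have GP i m w : G i m w -> exists2 s, (fine (T w) <= s <= fine (T w) + h m + h m)%R &
    cball d x (r - i.+1%:R^-1) (X s w).
  move=> [j _ [[/= Tp /negP]]]; rewrite -ltNge => pT Xp.
  have Tf : T w \is a fin_num.
    by rewrite ge0_fin_numE//; apply: le_lt_trans Tp _; rewrite ltry.
  move: Tp pT; rewrite -(fineK Tf) lee_fin lte_fin => Tp pT.
  by exists (p m j.+1) => //; rewrite pS; have := h0 m; lra.
have GP' i m w : T w <= b%:E -> (forall s,
    (fine (T w) < s <= fine (T w) + h m + h m)%R ->
    cball d x (r - i.+1%:R^-1) (X s w)) -> G i m w.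
  move=> Tb H.
  have Tf : T w \is a fin_num.
    by rewrite ge0_fin_numE//; apply: le_lt_trans Tb _; rewrite ltry.
  have aT' : (a <= fine (T w))%R by rewrite -lee_fin fineK.
  pose j := Num.truncn ((fine (T w) - a) / h m).
  have /Num.Theory.truncn_itv/andP[j1 j2] : (0 <= (fine (T w) - a) / h m)%R.
    by rewrite divr_ge0 ?(ltW (h0 m))//; lra.
  move: j1 j2; rewrite ler_pdivlMr// ltr_pdivrMr// => j1 j2.
  rewrite le_eqVlt in j1; case/predU1P : j1 => [j1|j1].
    exists j => //; split; first split => /=.
    - by rewrite -(fineK Tf) lee_fin /p j1; lra.
    - by rewrite -(fineK Tf) lee_fin /p j1; have := h0 m; lra.
    - by apply: H; rewrite pS /p j1; have := h0 m; lra.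
  exists j.+1 => //; split; first split => /=.
  - by rewrite -(fineK Tf) lee_fin pS /p; move: j2; rewrite -natr1 mulrDl; lra.
  - by rewrite -(fineK Tf) lee_fin pS /p; have := h0 m; lra.
  - by apply: H; rewrite !pS /p; move: j2; rewrite -natr1 mulrDl; have := h0 m; lra.
rewrite (_ : [set w | _] = [set w | T w <= b%:E] `&`
    \bigcup_i \bigcup_m0 \bigcap_(m in [set m | (m0 <= m)%N]) G i m); last first.
  apply/seteqP; split => w /= [Tb].
    have Tf : T w \is a fin_num.
      by rewrite ge0_fin_numE//; apply: le_lt_trans Tb _; rewrite ltry.
    have T0' : (0 <= fine (T w))%R by rewrite fine_ge0.
    case E : (X _ _) => [z|]//= zr.
    have [|i ir] := @natSinv_lt_eps R (r - d x z); first lra.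
    split=> //; exists i => //.
    have [|e e0 He] := right_cont_in Hs Hp T0' E (r := (r - i.+1%:R^-1)%R) (x := x).
      by invlra.
    have [|m0 Hm0] := @pow2V_lt_eps R (e / 2); first lra.
    exists m0 => // m /= m0m; apply: GP' => // s /andP[Ts sT].
    have [|z' -> z'r] := He s; last by rewrite /cball/= ltW.
    by rewrite (ltW Ts)/=; have := Hm0 m m0m; rewrite -/(h m); lra.
  move=> [i _ [m0 _ H]]; split=> //.
  have Tf : T w \is a fin_num.
    by rewrite ge0_fin_numE//; apply: le_lt_trans Tb _; rewrite ltry.
  have T0' : (0 <= fine (T w))%R by rewrite fine_ge0.
  apply: (@cball_in_ball _ _ (r - i.+1%:R^-1)%R).
    by rewrite ltrBlDr ltrDl invr_gt0.
  apply: contrapT => /(right_cont_out Hs Hp T0')[e e0 He].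
  have [|m1 Hm1] := @pow2V_lt_eps R (e / 2); first lra.
  have [s /andP[Ts sT] Xs] := GP _ _ _ (H (maxn m0 m1) (leq_maxl _ _)).
  apply: (He s) => //.
  by have := Hm1 _ (leq_maxr m0 m1); rewrite -/(h _); lra.
apply: measurableI => //; apply: bigcup_measurable => i _.
apply: bigcup_measurable => m0 _; apply: bigcap_measurable.
  by exists m0 => /=.
move=> m _; apply: bigcup_measurable => j _.
apply: measurableI; first exact: measurableD.
exact/(measurable_X Hp)/(mbl_cball Hs).
Qed.

(** A path staying in the open ball but in none of the closed balls of radius [rn n] exits all of
    these by time [b], at times increasing to some [T], with [X_T] still inside.
    Quasi-left-continuity makes this null under every law, and the filtration contains all subsets
    of such null sets. *)
Lemma measurable_stay_in_ball x r a b : (0 <= a <= b)%R ->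
  measurable [set w | forall s, (a <= s <= b)%R -> in_ball x r (X s w)].
Proof.
move=> /andP[a0 ab].
pose rn n : R := (r - n.+1%:R^-1)%R.
have rnr n : (rn n < r)%R by rewrite /rn ltrBlDr ltrDl invr_gt0.
have rnS m n : (m <= n)%N -> (rn m <= rn n)%R.
  by move=> mn; rewrite /rn lerD2l lerN2 lef_pV2 ?posrE// ler_nat ltnS.
pose Tn n := hit d X x (rn n) a.
pose T w := ereal_sup (range (fun n => Tn n w)).
have aT w : a%:E <= T w.
  by apply: le_trans (hit_ge x (rn 0%N) a w) _; apply: ereal_sup_ubound; exists 0%N.
have Tst : stopping_time filt T.
  split=> [w|u u0]; first by apply: le_trans (aT w); rewrite lee_fin.
  rewrite (_ : [set _ | _] = \bigcap_n [set w | Tn n w <= u%:E]).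
    apply: (filt_bigcap Hp) => n.
    by have [_] := hit_stopping Hs Hp x (rn n) a0; exact.
  apply/seteqP; split => w /=.
    by move=> Tu n _ /=; apply: le_trans Tu; apply: ereal_sup_ubound; exists n.
  by move=> H; apply: ge_ereal_sup => _ [n _ <-]; exact: H.
pose N' := [set w | T w <= b%:E /\ in_ball x r (X (fine (T w)) w)].
have mN' : measurable N' by exact: measurable_stopped_in_ball a0 Tst aT.
(* On [N'], quasi-left-continuity would put [X_T] at distance at least [r]. *)
have N'0 v : P v N' = 0.
  apply/eqP; rewrite eq_le measure_ge0 andbT.
  have [A [mA A0 sA]] := quasi_left_cont Hp
    (fun n => hit_stopping Hs Hp x (rn n) a0) Tst
    (fun w n => hit_ndec x a w (rnS n n.+1 (leqnSn n))) (fun w => erefl) v.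
  rewrite -A0; apply: le_measure; rewrite ?inE//.
  apply: subset_trans sA => w [Tb XT] /= good.
  have Ty : T w < +oo by apply: le_lt_trans Tb _; rewrite ltry.
  have Tf : T w \is a fin_num.
    by rewrite ge0_fin_numE//; exact: le_trans (aT w).
  case E : (X (fine (T w)) w) XT => [y|]//= yr.
  have yN : Some y <> None by [].
  have e := good Ty; rewrite /X_at addr0 E in e; have {}e := e yN.
  have e0 : (0 < r - d x y)%R by lra.
  have [|n1 Hn1] := @natSinv_lt_eps R ((r - d x y) / 2); first lra.
  have [|n0 Hn0] := e ((r - d x y) / 2)%R; first lra.
  have [z [y' [Xz [<-] Tnn zy]]] := Hn0 (maxn n0 n1) (leq_maxl _ _).
  have Tnf : Tn (maxn n0 n1) w \is a fin_num.
    by rewrite ge0_fin_numE//; apply: le_trans (hit_ge _ _ _ _); rewrite lee_fin.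
  move: Xz; rewrite /X_at addr0 => Xz.
  have := at_hit Hs Hp a0 (esym (fineK Tnf)) Xz; rewrite /rn.
  have : (((maxn n0 n1).+1%:R)^-1 <= n1.+1%:R^-1 :> R)%R.
    by rewrite lef_pV2 ?posrE// ler_nat ltnS leq_maxr.
  have := d_tri Hs x y z; rewrite (d_sym Hs y z).
  move: Hn1; move: ((maxn n0 n1).+1%:R^-1)%R (n1.+1%:R^-1)%R => q1 q2; lra.
set Z := [set w | _].
have UZ : \bigcup_n stay d X x (rn n) a b `<=` Z.
  by move=> w [n _ H] s /H; exact: cball_in_ball.
rewrite -(setDUK UZ); apply: measurableU.
  apply: bigcup_measurable => n _; apply: (filt_measurable Hp).
  by apply: (filt_stay Hs Hp); rewrite a0.
apply: (filt_measurable Hp (t := 0%R)).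
apply: (filt_null Hp (lexx _) mN' N'0) => w [Zw nU].
have TnB n : Tn n w <= b%:E.
  rewrite leNgt; apply/negP => bT; apply: nU; exists n => // s /andP[as_ sb].
  apply: contrapT => ns.
  have : Tn n w <= s%:E by apply: ereal_inf_lbound; exists s.
  by apply/negP; rewrite -ltNge; apply: le_lt_trans bT; rewrite lee_fin.
have Tb : T w <= b%:E by apply: ge_ereal_sup => _ [n _ <-]; exact: TnB.
have Tf : T w \is a fin_num.
  rewrite ge0_fin_numE; first by apply: le_lt_trans Tb _; rewrite ltry.
  by apply: le_trans (aT w); rewrite lee_fin.
by split=> //; apply: Zw; rewrite -!lee_fin fineK// aT.
Qed.

Lemma exit_geP x r v w : v%:E <= exit_time X (mball d x r) w <->
  forall s, (0 < s < v)%R -> in_ball x r (X s w).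
Proof.
split=> [H s /andP[s0 sv]|H].
  apply: contrapT => /in_ballP ns.
  have : exit_time X (mball d x r) w <= s%:E by apply: ereal_inf_lbound; exists s.
  by move/(le_trans H); rewrite lee_fin leNgt sv.
apply: le_ereal_inf_tmp => _ [s [s0 /in_ballP ns] <-]; rewrite lee_fin leNgt.
by apply/negP => sv; apply: ns; apply: H; rewrite s0.
Qed.

Lemma measurable_exit_ge x r (v : R) :
  measurable [set w | v%:E <= exit_time X (mball d x r) w].
Proof.
have [v0|v0] := leP v 0%R.
  rewrite (_ : [set _ | _] = setT)//; apply/seteqP; split => w //= _.
  by apply/exit_geP => s /andP[s0 sv]; lra.
(* Exit times ignore time [0], so the condition lives on the open interval from [0] to [v],
   exhausted by compact ones. The index [k.+2] keeps these nonempty from [k = 0] on. *)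
pose a k := (v / k.+2%:R)%R.
have a0 k : (0 < a k)%R by rewrite divr_gt0.
have av k : (a k <= v - a k)%R.
  have : (a k <= v / 2)%R by rewrite ler_wpM2l ?(ltW v0)// lef_pV2 ?posrE// ler_nat.
  by lra.
rewrite (_ : [set _ | _] = \bigcap_k [set w | forall s, (a k <= s <= v - a k)%R ->
    in_ball x r (X s w)]); last first.
  apply/seteqP; split => w /=.
    by move/exit_geP => H k _ s /andP[h1 h2]; apply: H; have := a0 k; lra.
  move=> H; apply/exit_geP => s /andP[s0 sv].
  have [|k kv] := @natSinv_lt_eps R (Num.min s (v - s) / v)%R.
    by rewrite divr_gt0// lt_min s0/=; lra.
  apply: (H k I); move: kv; rewrite ltr_pdivlMr// lt_min => /andP[h1 h2].
  have : (a k <= v * k.+1%:R^-1)%R.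
    by rewrite ler_wpM2l ?(ltW v0)// lef_pV2 ?posrE// ler_nat.
  by invlra.
apply: bigcapT_measurable => k; apply: measurable_stay_in_ball.
by rewrite (ltW (a0 k)) av.
Qed.

End exit.

(** * The Markov property for path events *)

Section disintegration.
Context {d1 d2 : measure_display} {T1 : measurableType d1}
  {T2 : measurableType d2} {R : realType}.
Variables (mu : {measure set T1 -> \bar R}) (nu : {measure set T2 -> \bar R})
  (k : T1 -> {measure set T2 -> \bar R}) (D : set T1).
Hypotheses (mD : measurable D)
  (mk : forall U, measurable U -> measurable_fun setT (fun x => k x U))
  (nuE : forall U, measurable U -> nu U = \int[mu]_(x in D) k x U).

Import HBNNSimple.

Let mkD U : measurable U -> measurable_fun D (fun x => k x U).
Proof. by move=> /mk; exact: measurable_funS. Qed.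

Let integral_disintegration_nnsfun (f : {nnsfun T2 >-> R}) :
  \int[nu]_z (f z)%:E = \int[mu]_(x in D) (\int[k x]_z (f z)%:E).
Proof.
rewrite integralT_nnsfun sintegralE.
under [in RHS]eq_integral do rewrite integralT_nnsfun sintegralE.
rewrite ge0_integral_fsum//.
- apply: eq_fsbigr => r /set_mem[z _ fz].
  rewrite nuE// ge0_integralZl//; first exact: mkD.
  by rewrite lee_fin -fz.
- by move=> r; apply: measurable_funeM; exact: mkD.
- move=> r x _; have [r0|r0] := leP 0%R r; first by rewrite mule_ge0.
  by rewrite preimage_nnfun0// measure0 mule0.
Qed.

(** Passes from sets to functions by simple functions and monotone convergence. It serves both for
    transition kernels and, with Dirac kernels, as a change of variables. *)
Lemma integral_disintegration (f : T2 -> \bar R) : (forall z, 0 <= f z) ->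
  measurable_fun setT f ->
  \int[nu]_z f z = \int[mu]_(x in D) (\int[k x]_z f z).
Proof.
move=> f0 mf; pose f_ := nnsfun_approx measurableT mf.
have mc (m : {measure set T2 -> \bar R}) :
    \int[m]_z f z = limn (fun n => \int[m]_z (f_ n z)%:E).
  rewrite -monotone_convergence//.
  - apply: eq_integral => z _; apply/esym/cvg_lim => //.
    exact: cvg_nnsfun_approx.
  - by move=> n; exact/measurable_EFinP.
  - by move=> n z _; rewrite lee_fin.
  - by move=> z _ a b ab; rewrite lee_fin; exact/lefP/nd_nnsfun_approx.
rewrite mc; under eq_fun do rewrite integral_disintegration_nnsfun.
rewrite -monotone_convergence//.
- by apply: eq_integral => x _; rewrite mc.
- move=> n; apply: (@measurable_funS _ _ _ _ setT) => //.
  apply: measurable_fun_integral_kernel => //.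
  + by move=> z; rewrite lee_fin.
  + exact/measurable_EFinP.
- by move=> n x _; apply: integral_ge0 => z _; rewrite lee_fin.
- move=> x _ a b ab; apply: ge0_le_integral => //.
  + by move=> z _; rewrite lee_fin.
  + exact/measurable_EFinP.
  + exact/measurable_EFinP.
  + by move=> z _; rewrite lee_fin; exact/lefP/nd_nnsfun_approx.
Qed.

End disintegration.

Definition alive {R : realType} {M Omega : Type} (X : R -> Omega -> option M)
    (t : R) : set Omega := [set w | X t w <> None].

(* [point] is a dummy value, used after the lifetime *)
Definition pos {R : realType} {M : pointedType} {Omega : Type}
    (X : R -> Omega -> option M) (t : R) (w : Omega) : M := odflt point (X t w).

Section markov.
Context {R : realType} {dM : measure_display} {M : measurableType dM}
  {d : M -> M -> R} {dO : measure_display} {Omega : measurableType dO}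
  {P : option M -> probability Omega R} {X : R -> Omega -> option M}
  {filt : R -> set (set Omega)}.
Hypotheses (Hs : standing_space d) (Hp : standard_data d P X filt).

Lemma filt_alive t : (0 <= t)%R -> filt t (alive X t).
Proof. by move=> t0; apply: (adapted Hp t0 (B := [set v | v <> None])); exact: mbl_alive. Qed.

Lemma measurable_pos t : (0 <= t)%R -> measurable_fun setT (pos X t).
Proof.
move=> t0 _ B mB; rewrite setTI.
apply: (measurable_X Hp t0 (B := [set v | B (odflt point v)])).
exact: mbl_preim mB _.
Qed.

(** The law of [X_t] on [A], restricted to [M]: mass at the cemetery is dropped, so the total mass
    may be smaller than that of [A]. *)
Lemma subprob_measure (mu : {measure set Omega -> \bar R}) A t : (0 <= t)%R ->
  measurable A -> exists nu : {measure set M -> \bar R}, forall B, nu B =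
    mu (A `&` X t @^-1` (Some @` B)).
Proof.
move=> t0 mA; pose nu B := mu (A `&` X t @^-1` (Some @` B)).
have nu0 : nu set0 = 0 by rewrite /nu image_set0 preimage_set0 setI0 measure0.
have nu_ge0 B : 0 <= nu B by exact: measure_ge0.
have nus : semi_sigma_additive nu.
  move=> F mF tF mUF; rewrite /nu image_bigcup preimage_bigcup setI_bigcupr.
  have mAF n : measurable (A `&` X t @^-1` (Some @` F n)).
    by apply: measurableI => //; exact: (measurable_X Hp t0 (mbl_some (mF n))).
  apply: measure_semi_sigma_additive => //.
  - apply/trivIsetP => i j _ _ ij; move/trivIsetP : tF => /(_ i j I I ij) Fij.
    apply/seteqP; split=> // w [[_ [z Fz zX]] [_ [z' Fz' z'X]]] /=.
    have : (F i `&` F j) z by split=> //; move: z'X; rewrite -zX => -[<-].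
    by rewrite Fij.
  - exact: bigcupT_measurable.
pose m : {measure set M -> \bar R} :=
  HB.pack nu (isMeasure.Build _ _ _ nu nu0 nu_ge0 nus).
by exists m.
Qed.

Lemma trans_kernel h : (0 <= h)%R -> exists k : M -> {measure set M -> \bar R},
  forall z B, k z B = P (Some z) (X h @^-1` (Some @` B)).
Proof.
move=> h0; have /choice[k kE] : forall z : M, exists k : {measure set M -> \bar R},
    forall B, k B = P (Some z) (X h @^-1` (Some @` B)).
  move=> z; have [k kE] := subprob_measure (P (Some z)) h0 measurableT.
  by exists k => B; rewrite kE setTI.
by exists k.
Qed.

Section one_step.
Variables (h : R) (k : M -> {measure set M -> \bar R}).
Hypotheses (h0 : (0 <= h)%R)
  (kE : forall z B, k z B = P (Some z) (X h @^-1` (Some @` B))).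

Lemma measurable_trans_kernel U : measurable U ->
  measurable_fun setT (fun z => k z U).
Proof.
by move=> mU; under eq_fun do rewrite kE; exact: (measurable_trans Hp h0 (mbl_some mU)).
Qed.

(** Both sides integrate [f] against the law of [X_(s+h)] on [A] before death: the left one
    disintegrates this law into Dirac masses, the right one into transition kernels. *)
Lemma one_step_markov s A y (f : M -> \bar R) : (0 <= s)%R -> filt s A ->
  A `<=` alive X s -> (forall z, 0 <= f z) -> measurable_fun setT f ->
  \int[P y]_(w in A `&` alive X (s + h)) f (pos X (s + h) w) =
  \int[P y]_(w in A) \int[k (pos X s w)]_z f z.
Proof.
move=> s0 fA As f0 mf.
have sh0 : (0 <= s + h)%R by rewrite addr_ge0.
have mA : measurable A := filt_measurable Hp fA.
have [nu nuE] := subprob_measure (P y) sh0 mA.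
rewrite -(@integral_disintegration _ _ _ _ _ (P y) nu (fun w => k (pos X s w)) A)//.
- rewrite (@integral_disintegration _ _ _ _ _ (P y) nu
    (fun w => \d_(pos X (s + h) w)) (A `&` alive X (s + h)))//.
  + by apply: eq_integral => w _; rewrite integral_dirac// diracT mul1e.
  + by apply: measurableI => //; exact: filt_measurable Hp _ _ (filt_alive sh0).
  + move=> U mU; apply/measurable_EFinP.
    apply: (eq_measurable_fun (fun w => \1_U (pos X (s + h) w) : R)) => [w _|].
      by [].
    exact: measurableT_comp (measurable_indic mU) (measurable_pos sh0).
  + move=> U mU; rewrite nuE.
    rewrite (eq_integral (fun w => (\1_(pos X (s + h) @^-1` U) w)%:E)); last by [].
    rewrite integral_indic; last 2 first.
    * by apply: measurableI => //; exact: filt_measurable Hp _ _ (filt_alive sh0).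
    * by rewrite -[X in measurable X]setTI; exact: (measurable_pos sh0).
    congr (P y _); apply/seteqP; split => w /=.
      by move=> [Aw [z Uz zX]]; rewrite /pos /alive/= -zX.
    move=> []; rewrite /pos /alive /=; case: (X _ w) => [z|] Uz [Aw Xw]//.
    by split=> //; exists z.
- move=> U mU; exact: (measurableT_comp (measurable_trans_kernel mU) (measurable_pos s0)).
- move=> U mU; apply: etrans (nuE U) _.
  apply: etrans (simple_markov Hp y s0 h0 fA (mbl_some mU)) _.
  apply: eq_integral => w /set_mem/As; rewrite /alive /pos/= kE.
  by case: (X s w).
Qed.

(** For the chain with kernel [k] started at [z], the probability of being in the closed ball at the
    times [0] to [N]. Written as iterated integrals, it is visibly measurable in [z]. *)
Fixpoint grid_prob x r (N : nat) (z : M) : \bar R :=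
  (\1_[set z | (d x z <= r)%R] z)%:E *
  (if N is N'.+1 then \int[k z]_z' grid_prob x r N' z' else 1).

Lemma measurable_le_d x r : measurable [set z | (d x z <= r)%R].
Proof. exact: (mbl_cball Hs x r). Qed.

Lemma grid_prob_ge0 x r N z : 0 <= grid_prob x r N z.
Proof.
elim: N z => [|N IH] z /=; first by rewrite mule1 lee_fin.
by rewrite mule_ge0 ?lee_fin//; exact: integral_ge0.
Qed.

Lemma measurable_grid_prob x r N : measurable_fun setT (grid_prob x r N).
Proof.
elim: N => [|N IH] /=.
  under eq_fun do rewrite mule1.
  by apply/measurable_EFinP; apply: measurable_indic; exact: measurable_le_d.
apply: emeasurable_funM.
  by apply/measurable_EFinP; apply: measurable_indic; exact: measurable_le_d.
apply: measurable_fun_integral_kernel => //; first exact: measurable_trans_kernel.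
exact: grid_prob_ge0.
Qed.

Definition gstay x r s (N : nat) : set Omega :=
  [set w | forall j, (j <= N)%N -> cball d x r (X (s + j%:R * h)%R w)].

Lemma gstayS x r s N : gstay x r s N.+1 =
  X s @^-1` cball d x r `&` gstay x r (s + h) N.
Proof.
apply/seteqP; split => w.
  move=> H; split; first by have := H 0%N isT; rewrite mul0r addr0.
  by move=> j jN; have := H j.+1 jN; rewrite -natr1 mulrDl mul1r [(_ + h)%R]addrC addrA.
move=> [H0 H] [_|j jN]; first by rewrite mul0r addr0.
by have := H j jN; rewrite -natr1 mulrDl mul1r [(_ + h)%R in X in _ -> X]addrC addrA.
Qed.

(** Induction on [N], with [A] general: the condition at time [s] joins [A], the induction
    hypothesis handles the times from [s + h] on, and one Markov step brings the integral back to
    time [s]. *)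
Lemma grid_markov x r N s A y : (0 <= s)%R -> filt s A ->
  P y (A `&` gstay x r s N) =
  \int[P y]_(w in A `&` alive X s) grid_prob x r N (pos X s w).
Proof.
elim: N s A => [|N IH] s A s0 fA.
  under eq_integral do rewrite /= mule1.
  rewrite (_ : (fun w => _) = (fun w =>
      (\1_(pos X s @^-1` [set z | (d x z <= r)%R]) w)%:E))//.
  have fAs := filtI Hp fA (filt_alive s0).
  rewrite integral_indic; last 2 first.
  - exact: filt_measurable Hp _ _ fAs.
  - by rewrite -[X in measurable X]setTI; exact: (measurable_pos s0 measurableT (measurable_le_d x r)).
  congr (P y _); apply/seteqP; split => w /=.
    move=> [Aw /(_ 0%N isT)]; rewrite mul0r addr0 /pos /alive/=.
    by case: (X s w).
  move=> [H [Aw Xw]]; split=> // j; rewrite leqn0 => /eqP ->.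
  by rewrite mul0r addr0; move: H Xw; rewrite /pos /alive/=; case: (X s w).
have fA' : filt s (A `&` X s @^-1` cball d x r).
  by apply: (filtI Hp) => //; exact: (adapted Hp s0 (mbl_cball Hs x r)).
have sh : (0 <= s <= s + h)%R by rewrite s0 lerDl.
rewrite gstayS setIA IH; last 2 first.
- by case/andP : sh => /le_trans; apply.
- exact: filt_mono Hp _ _ sh _ fA'.
have A's : A `&` X s @^-1` cball d x r `<=` alive X s.
  by move=> w [_]; rewrite /alive/=; case: (X s w).
rewrite one_step_markov//; [|exact: grid_prob_ge0|exact: measurable_grid_prob].
rewrite (_ : A `&` X s @^-1` cball d x r =
  (A `&` alive X s) `&` (pos X s @^-1` [set z | (d x z <= r)%R])); last first.
  apply/seteqP; split => w; rewrite /alive /pos /=.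
    by move=> [Aw]; case: (X s w).
  by move=> [[Aw]]; case: (X s w).
rewrite integral_mkcondr; apply: eq_integral => w _; rewrite patchE /= indicE.
rewrite -[w \in _]/(pos X s w \in [set z | (d x z <= r)%R]).
by case: ifPn => _; rewrite ?mul1e ?mul0e.
Qed.

End one_step.

Lemma measurable_start z : measurable [set w | X 0%R w = Some z].
Proof.
apply: (measurable_X Hp (lexx _) (B := [set v | v = Some z])).
rewrite /mbl_p (_ : _ @^-1` _ = [set z' | (d z z' <= 0)%R]).
  exact: (mbl_cball Hs z 0).
apply/seteqP; split => z' /=; first by move=> [->]; rewrite (d_refl Hs).
move=> dz; congr Some; apply/esym/(d_eq0 Hs)/eqP.
by rewrite eq_le dz (d_ge0 Hs).
Qed.

Lemma start_null z : P (Some z) (~` [set w | X 0%R w = Some z]) = 0.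
Proof.
have m0 := measurable_start z.
by rewrite probability_setC// (start_at Hp (Some z)) subee.
Qed.

Lemma start_integral z (f : M -> \bar R) : (forall z, 0 <= f z) ->
  measurable_fun setT f ->
  \int[P (Some z)]_(w in alive X 0%R) f (pos X 0%R w) = f z.
Proof.
move=> f0 mf.
have m0 : measurable [set w | X 0%R w = Some z] by exact: measurable_start.
have ma : measurable (alive X 0%R) := filt_measurable Hp (filt_alive (lexx _)).
have mN : measurable (~` [set w | X 0%R w = Some z]) by exact: measurableC.
have N0 : P (Some z) (~` [set w | X 0%R w = Some z]) = 0 := start_null z.
rewrite (@ge0_negligible_integral _ _ _ _ _ _ _ mN)//; last first.
  apply: (measurable_funS measurableT) => //.
  exact: measurableT_comp mf (measurable_pos (lexx _)).
rewrite (_ : _ `\` _ = [set w | X 0%R w = Some z]); last first.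
  apply/seteqP; split => w /=; first by move=> [_ /contrapT].
  by rewrite /alive/= => ->; split.
rewrite (eq_integral (cst (f z))); last first.
  by move=> w /set_mem /=; rewrite /pos => ->.
have h1 : P (Some z) [set w | X 0%R w = Some z] = 1 := start_at Hp (Some z).
by rewrite integral_cst//; apply: etrans (mule1 _); congr (_ * _).
Qed.

(* The lower bound is only required of the whole path; it passes to every
   skeleton because the skeleton event is larger. *)
Lemma dstay_markov x r s T m A y (D' : set M) (p : R) :
  (0 <= s)%R -> (0 <= T)%R -> filt s A -> (0 <= p)%R ->
  (forall w, A w -> (Some @` D') (X s w)) ->
  (forall z, D' z -> p%:E <= P (Some z) (stay d X x r 0 T)) ->
  p%:E * P y A <= P y (A `&` dstay d X x r s (s + T) m).
Proof.
move=> s0 T0 fA p0 AD Dp.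
have h0 : (0 <= T / 2 ^+ m)%R by rewrite divr_ge0 ?exprn_ge0.
have [k kE] := trans_kernel h0.
have E s' : dstay d X x r s' (s' + T) m = gstay (T / 2 ^+ m) x r s' (2 ^ m).
  by rewrite /dstay /gstay /dyad addrAC subrr add0r.
have Aal : A `&` alive X s = A.
  by apply/setIidPl => w /AD[z _ zX]; rewrite /alive/= -zX.
rewrite E (grid_markov h0 kE)// Aal.
have mA := filt_measurable Hp fA.
rewrite -(integral_cst (P y) mA); apply: ge0_le_integral => //.
  apply: (@measurable_funS _ _ _ _ setT) => //.
  exact: measurableT_comp (measurable_grid_prob h0 kE x r _) (measurable_pos s0).
move=> w /AD[z Dz zX]; rewrite /pos -zX /=.
apply: le_trans (Dp z Dz) _.
rewrite -(start_integral z (@grid_prob_ge0 k x r (2 ^ m)) (measurable_grid_prob h0 kE x r _)).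
rewrite -[X in integral _ X]setTI.
rewrite -(grid_markov h0 kE x r _ _ (lexx 0%R) (filtT Hp 0%R)) setTI.
rewrite -E add0r; apply: le_measure; rewrite ?inE.
- by apply: (filt_measurable Hp (t := T)); apply: (filt_stay Hs Hp); rewrite lexx.
- by apply: (filt_measurable Hp (t := T)); apply: (filt_dstay Hs Hp); rewrite lexx.
- by rewrite (stay_dstay Hs Hp) ?lexx//; exact: bigcap_inf.
Qed.

(** The bound of [dstay_markov] does not depend on the grid, and the grid events decrease to the
    path event. *)
Lemma stay_markov x r s T A y (D' : set M) (p : R) :
  (0 <= s)%R -> (0 <= T)%R -> filt s A -> (0 <= p)%R ->
  (forall w, A w -> (Some @` D') (X s w)) ->
  (forall z, D' z -> p%:E <= P (Some z) (stay d X x r 0 T)) ->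
  p%:E * P y A <= P y (A `&` stay d X x r s (s + T)).
Proof.
move=> s0 T0 fA p0 AD Dp.
have sT : (0 <= s <= s + T)%R by rewrite s0 lerDl.
have mA := filt_measurable Hp fA.
rewrite (stay_dstay Hs Hp)// (_ : A `&` _ = \bigcap_m (A `&` dstay d X x r s (s + T) m)); last first.
  apply/seteqP; split => w; first by move=> [Aw H] m _; split=> //; exact: H.
  by move=> H; split=> [|m _]; [case: (H 0%N I)|case: (H m I)].
have mF m : measurable (A `&` dstay d X x r s (s + T) m).
  apply: measurableI => //; apply: (filt_measurable Hp (t := (s + T)%R)).
  exact: (filt_dstay Hs Hp).
have cv : P y (A `&` dstay d X x r s (s + T) m) @[m --> \oo] -->
    P y (\bigcap_m (A `&` dstay d X x r s (s + T) m)).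
  apply: nonincreasing_cvg_mu => //.
  - by rewrite (le_lt_trans (probability_le1 _ _))// ltry.
  - exact: bigcapT_measurable.
  - apply/nonincreasing_seqP => m; apply/subsetPset; apply: setIS; apply: dstay_decr.
    by case/andP : sT.
rewrite -(cvg_lim _ cv)//; apply: lime_ge; first by apply/cvg_ex; eexists; exact: cv.
by apply: nearW => m; exact: dstay_markov AD Dp.
Qed.

End markov.

(** * Deaths without left limit *)

Section integral_misc.
Context {dT : measure_display} {T : measurableType dT} {R : realType}.

(* The integral of a nonnegative function is a supremum over simple functions,
   so it is monotone without any measurability assumption. *)
Lemma le_integral_nomeas (mu : {measure set T -> \bar R}) (D : set T)
    (f g : T -> \bar R) :
  (forall x, D x -> 0 <= f x) -> (forall x, D x -> f x <= g x) ->
  \int[mu]_(x in D) f x <= \int[mu]_(x in D) g x.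
Proof.
move=> f0 fg.
have g0 x : D x -> 0 <= g x by move=> Dx; exact: le_trans (f0 x Dx) (fg x Dx).
rewrite !ge0_integralE//; apply: ge_ereal_sup => _ [h hf <-].
apply: ereal_sup_ubound; exists h => // x; apply: le_trans (hf x) _.
by rewrite !patchE; case: ifPn => // /set_mem; exact: fg.
Qed.

End integral_misc.

Section real_induction.
Context {R : realType}.

(** Compactness of [[0, t]] in the form suited to paths with left limits: near [s] the property is
    known separately on each side of [s], and the pieces are glued by transitivity. The proof takes
    the supremum of the reachable endpoints. *)
Lemma interval_induction (Q : R -> R -> Prop) (t : R) : (0 < t)%R ->
  (forall a b c, (0 <= a <= b)%R -> (b <= c)%R -> Q a b -> Q b c -> Q a c) ->
  (forall s, (0 <= s <= t)%R -> exists2 e : R, (0 < e)%R &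
     (forall v, (0 <= v < s)%R -> (s - e < v)%R -> Q v s) /\
     (forall v, (s < v < s + e)%R -> (v <= t)%R -> Q s v)) ->
  Q 0%R t.
Proof.
move=> t0 Qtr Qloc.
pose S := [set u | (0 < u <= t)%R /\ Q 0%R u].
have [e0 e00 [_ H0]] := Qloc 0%R (introT andP (conj (lexx _) (ltW t0))).
have S0 : S (Num.min (e0 / 2) t)%R.
  have h1 : (0 < Num.min (e0 / 2) t)%R by rewrite lt_min t0 andbT; lra.
  split; first by rewrite h1/= ge_min lexx orbT.
  by apply: H0; rewrite ?h1/= ?add0r ?gt_min ?ge_min ?lexx ?orbT//; lra.
have hS : has_sup S by split; [exists (Num.min (e0 / 2) t)%R|exists t => u [/andP[]]].
set s := sup S.
have st : (s <= t)%R by apply: ge_sup; [exists (Num.min (e0 / 2) t)%R|move=> u [/andP[]]].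
have s0 : (0 < s)%R.
  apply: (@lt_le_trans _ _ (Num.min (e0 / 2) t)%R); first by have [/andP[]] := S0.
  exact: sup_upper_bound hS _ S0.
have [e e_gt0 [Hl Hr]] := Qloc s (introT andP (conj (ltW s0) st)).
have Qs : Q 0%R s.
  have [u [/andP[u0 ut] Qu] su] := sup_adherent e_gt0 hS.
  have : (u <= s)%R by apply: (sup_upper_bound hS); split=> //; rewrite u0.
  rewrite le_eqVlt => /predU1P[<-//|us].
  apply: (Qtr 0%R u s) => //; [by rewrite lexx ltW|exact: ltW|].
  by apply: Hl => //; rewrite us ltW.
move: st; rewrite le_eqVlt => /predU1P[<-//|st].
pose v := (Num.min (s + e / 2) t)%R.
have sv : (s < v)%R by rewrite /v lt_min st andbT; lra.
have vt : (v <= t)%R by rewrite /v ge_min lexx orbT.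
have Qv : Q 0%R v.
  apply: (Qtr 0%R s v) => //; [by rewrite lexx ltW|exact: ltW|].
  apply: Hr => //; rewrite sv/= /v gt_min; apply/orP; left; lra.
have : (v <= s)%R.
  by apply: (sup_upper_bound hS); split=> //; rewrite vt (lt_trans s0).
by rewrite leNgt sv.
Qed.

Lemma finite_set_min (T : choiceType) (F : set T) (e : T -> R) :
  finite_set F -> (forall i, F i -> (0 < e i)%R) ->
  exists2 m : R, (0 < m)%R & forall i, F i -> (m <= e i)%R.
Proof.
move=> /finite_seqP[s ->]; elim: s => [|x s IH] H; first by exists 1%R.
have [|m m0 Hm] := IH; first by move=> i /= si; apply: H; rewrite /= inE si orbT.
exists (Num.min m (e x)).
  by rewrite lt_min m0/=; apply: H; rewrite /= mem_head.
move=> i /=; rewrite inE => /predU1P[->|si]; rewrite ge_min ?lexx ?orbT//.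
by rewrite Hm.
Qed.

End real_induction.

Section announce.
Context {R : realType} {dM : measure_display} {M : measurableType dM}
  {d : M -> M -> R} {dO : measure_display} {Omega : measurableType dO}
  {P : option M -> probability Omega R} {X : R -> Omega -> option M}
  {filt : R -> set (set Omega)}.
Hypotheses (Hs : standing_space d) (Hp : standard_data d P X filt).
Variable (c : R).
Hypotheses (c0 : (0 < c)%R)
  (surv : forall z t, (0 <= t)%R -> c%:E <= P (Some z) (alive X t)).

Lemma surv_step y s t A : (0 <= s <= t)%R -> filt s A -> A `<=` alive X s ->
  c%:E * P y A <= P y (A `&` alive X t).
Proof.
move=> /andP[s0 st] fA As.
have ts : (0 <= t - s)%R by rewrite subr_ge0.
have := simple_markov Hp y s0 ts fA (@mbl_alive _ M).
rewrite (addrC s) subrK => E; rewrite [leRHS]E.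
rewrite -(integral_cst (P y) (filt_measurable Hp fA)).
apply: le_integral_nomeas => w Aw; first by rewrite lee_fin ltW.
by have := As w Aw; rewrite /alive/=; case: (X s w) => // z _; exact: surv.
Qed.

Variables (t : R) (t0 : (0 < t)%R) (D : nat -> nat -> nat -> set Omega).
Hypotheses (fD : forall n m j, (j <= 2 ^ m)%N -> filt (dyad 0%R t m j) (D n m j))
  (aD : forall n m j, D n m j `<=` alive X (dyad 0%R t m j))
  (DS : forall n m j, (j <= 2 ^ m)%N -> D n m j `<=` D n m.+1 j.*2).

Let U n m (J : nat) := \bigcup_(j in [set j | (j < J)%N]) D n m j.
Let A n := \bigcup_m U n m (2 ^ m).+1.

Hypotheses (Adecr : forall n, A n.+1 `<=` A n)
  (Adead : forall w, (forall n, A n w) -> X t w = None).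

Let dt m j : (j <= 2 ^ m)%N -> (0 <= dyad 0%R t m j <= t)%R.
Proof. by move=> jm; apply: dyad_itv => //; exact: ltW. Qed.

Let US n m J : U n m J.+1 = U n m J `|` (D n m J `\` U n m J).
Proof.
apply/seteqP; split => w.
  move=> [j /= jJ Dj]; have [Uw|nU] := pselect (U n m J w); first by left.
  right; split=> //; move: jJ; rewrite ltnS leq_eqVlt => /predU1P[<-//|jJ].
  by case: nU; exists j.
by move=> [[j /= jJ Dj]|[Dj _]]; [exists j => //=; exact: ltnW|exists J => /=].
Qed.

Let fU n m J s : (forall j, (j < J)%N -> (j <= 2 ^ m)%N /\ (dyad 0%R t m j <= s)%R) ->
  filt s (U n m J).
Proof.
move=> H; rewrite /U bigcup_mkcond; apply: (filt_bigcup Hp) => j.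
case: ifPn => [|_]; last exact: (filt0 Hp).
rewrite inE /= => /H[jm js].
apply: (filt_mono Hp) (fD n jm); rewrite js andbT.
by case/andP: (dt jm).
Qed.

Let mU n m J : (J <= (2 ^ m).+1)%N -> measurable (U n m J).
Proof.
move=> Jm; apply: (filt_measurable Hp (t := t)); apply: fU => j jJ.
have jm : (j <= 2 ^ m)%N by rewrite -ltnS (leq_trans jJ).
by split=> //; case/andP: (dt jm).
Qed.

Let malive s : (0 <= s)%R -> measurable (alive X s).
Proof. by move=> s0; exact: filt_measurable Hp _ _ (filt_alive Hp s0). Qed.

(* decompose according to the first grid time at which the event is detected *)
Let first_detection y n m J : (J <= (2 ^ m).+1)%N ->
  c%:E * P y (U n m J) <= P y (U n m J `&` alive X t).
Proof.
elim: J => [|J IH] Jm.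
  rewrite (_ : U n m 0 = set0); last by apply/seteqP; split=> w // [].
  by rewrite set0I measure0 mule0.
have {}IH := IH (ltnW Jm).
have JJ : (J <= 2 ^ m)%N by [].
have fDU : filt (dyad 0%R t m J) (D n m J `\` U n m J).
  apply: (filtD Hp); first exact: fD.
  apply: fU => j jJ; split; first exact: leq_trans (ltnW jJ) _.
  by apply: dyad_le; [exact: ltW|exact: ltnW].
have mDU := filt_measurable Hp fDU.
have mUJ := mU n (ltnW Jm).
have ma := malive (ltW t0).
rewrite US setIUl !measureU//; last 4 first.
- exact: measurableI.
- exact: measurableI.
- by apply/seteqP; split=> // w [[? ?] [[? ?] ?]].
- by apply/seteqP; split=> // w [? [? ?]].
rewrite muleDr ?ge0_adde_def ?inE//; apply: leeD => //.
by apply: surv_step (dt JJ) fDU _ => w [Dw _]; exact: aD Dw.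
Qed.

Let mA n : measurable (A n).
Proof. by apply: bigcupT_measurable => m; exact: mU. Qed.

Let surv_A y n : c%:E * P y (A n) <= P y (A n `&` alive X t).
Proof.
have Um m : U n m (2 ^ m).+1 `<=` U n m.+1 (2 ^ m.+1).+1.
  move=> w [j /= jm Dj]; exists j.*2; last exact: DS Dj.
  by rewrite /= ltnS expnS -mul2n leq_mul2l.
have cv : P y (U n m (2 ^ m).+1) @[m --> \oo] --> P y (A n).
  apply: nondecreasing_cvg_mu => //; first by move=> m; exact: mU.
  exact: mA.
  apply/nondecreasing_seqP => m; apply/subsetPset; exact: Um.
have cv2 : c%:E * P y (U n m (2 ^ m).+1) @[m --> \oo] --> c%:E * P y (A n).
  by apply: cvgeZl.
rewrite -(cvg_lim _ cv2)//; apply: lime_le.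
  by apply/cvg_ex; eexists; exact: cv2.
apply: nearW => m; apply: le_trans (first_detection y n (leqnn _)) _.
have ma := malive (ltW t0).
apply: le_measure; rewrite ?inE; [|exact: measurableI|].
  by apply: measurableI => //; exact: mU.
by apply: setSI; exact: (@bigcup_sup _ _ m).
Qed.

(** [D n m j] is a level-[n] alarm raised at a grid time by a path still alive, and [A n] says that
    such an alarm is raised at all. From the first alarm on, the path survives until [t] with
    conditional probability at least [c], so [c P(A n) <= P(A n, alive at t)]. The events on the
    right decrease to the empty set, since a path raising alarms of all levels is dead at [t]. *)
Lemma announced_death_null y :
  measurable (\bigcap_n A n) /\ P y (\bigcap_n A n) = 0.
Proof.
split; first exact: bigcapT_measurable.
have ma := malive (ltW t0).
have cv : P y (A n `&` alive X t) @[n --> \oo] --> P y (\bigcap_n (A n `&` alive X t)).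
  apply: nonincreasing_cvg_mu => //.
  - by rewrite (le_lt_trans (probability_le1 _ _))// ?ltry//; exact: measurableI.
  - by move=> n; exact: measurableI.
  - by apply: bigcapT_measurable => n; exact: measurableI.
  - by apply/nonincreasing_seqP => n; apply/subsetPset; apply: setSI; exact: Adecr.
have E0 : \bigcap_n (A n `&` alive X t) = set0.
  apply/seteqP; split=> // w H; have [_] := H 0%N I; apply.
  by apply: Adead => n; have [] := H n I.
rewrite E0 measure0 in cv.
have : c%:E * P y (\bigcap_n A n) <= 0.
  rewrite -(cvg_lim _ cv)//; apply: lime_ge; first by apply/cvg_ex; eexists; exact: cv.
  apply: nearW => n; apply: le_trans (surv_A y n).
  apply: lee_pmul => //; first by rewrite lee_fin ltW.
  by apply: le_measure; rewrite ?inE//; [exact: bigcapT_measurable|exact: bigcap_inf].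
rewrite pmule_rle0 ?lte_fin// => h.
by apply/eqP; rewrite eq_le h measure_ge0.
Qed.

End announce.

Definition dies_at {R : realType} {M Omega : Type} (X : R -> Omega -> option M)
    (T : R) : set Omega :=
  [set w | X T w = None /\ forall s, (0 <= s < T)%R -> X s w <> None].

Section death.
Context {R : realType} {dM : measure_display} {M : measurableType dM}
  {d : M -> M -> R} {dO : measure_display} {Omega : measurableType dO}
  {P : option M -> probability Omega R} {X : R -> Omega -> option M}
  {filt : R -> set (set Omega)}.
Hypotheses (Hs : standing_space d) (Hp : standard_data d P X filt).
Variable (c : R).
Hypotheses (c0 : (0 < c)%R)
  (surv : forall z t, (0 <= t)%R -> c%:E <= P (Some z) (alive X t)).

Section detector_out.
Variables (V : nat -> set M).
Hypotheses (Vop : forall n, mopen d (V n)) (VS : forall n, V n `<=` V n.+1)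
  (Vcov : forall x, exists n, V n x).

Let V_mono m n : (m <= n)%N -> V m `<=` V n.
Proof.
move=> /subnK <-; elim: (n - m)%N => [//|k IH].
by apply: subset_trans IH _; rewrite addSn; exact: VS.
Qed.

(** Near each time the path takes values close to its value or to its left limit there, and one
    [V n] is a neighbourhood of both; [interval_induction] makes the index uniform. *)
Lemma path_covered t w : (0 < t)%R -> alive X t w ->
  exists n, forall s, (0 <= s <= t)%R -> exists2 z, X s w = Some z & V n z.
Proof.
move=> t0 wt.
pose Q a b := exists n, forall s, (a <= s <= b)%R -> exists2 z, X s w = Some z & V n z.
apply: (@interval_induction R Q t t0).
  move=> a b e /andP[_ ab] be [n Hn] [m Hm]; exists (maxn n m) => s /andP[as_ se].
  have [sb|bs] := leP s b.
    have [|z Xz Vz] := Hn s; first by rewrite as_.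
    by exists z => //; exact: V_mono (leq_maxl n m) _ Vz.
  have [|z Xz Vz] := Hm s; first by rewrite (ltW bs).
  by exists z => //; exact: V_mono (leq_maxr n m) _ Vz.
move=> s /andP[s0 st].
case E : (X s w) => [x|]; last first.
  by exfalso; apply: wt; apply: dead_stays Hp _ _ _ _ E; rewrite s0.
have [n1 Vx] := Vcov x.
have [e1 e10 H1] := Vop Vx.
have [d1 d10 K1] := right_cont Hp s0 E e10.
have right v : (s <= v < s + d1)%R -> exists2 z, X v w = Some z & V n1 z.
  by move=> /K1[z Xz zx]; exists z => //; apply: H1; rewrite /mball/= (d_sym Hs).
have [s00|s0'] := leP s 0%R.
  exists d1 => //; split=> [v|v /andP[sv vd] vt]; first lra.
  by exists n1 => u /andP[su uv]; apply: right; lra.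
have [y ly] : exists y, left_lim d X w s y by apply: (has_left_lim Hp) => //; rewrite E.
have [n2 Vy] := Vcov y.
have [e2 e20 H2] := Vop Vy.
have [d2 d20 K2] := ly _ e20.
exists (Num.min d1 d2); first by rewrite lt_min d10.
split=> v.
  move=> /andP[v0 vs] sv; exists (maxn n1 n2) => u /andP[vu us].
  have : (s - d2 < u)%R by apply: lt_le_trans vu; apply: le_lt_trans sv; rewrite lerD2l lerN2 ge_min lexx orbT.
  move: us; rewrite le_eqVlt => /predU1P[->|us] d2u.
    have [|z Xz Vz] := right s; first lra.
    by exists z => //; exact: V_mono (leq_maxl n1 n2) _ Vz.
  have [|z Xz zy] := K2 u; first by rewrite d2u.
  exists z => //; apply: (V_mono (leq_maxr n1 n2)); apply: H2.
  by rewrite /mball/= (d_sym Hs).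
move=> /andP[sv vs] vt; exists n1 => u /andP[su uv]; apply: right.
rewrite su/=; apply: le_lt_trans uv _; apply: lt_le_trans vs _.
by rewrite lerD2l ge_min lexx.
Qed.

Lemma detector_out_null t y : (0 < t)%R ->
  let N := [set w | forall n, exists m j, (j <= 2 ^ m)%N /\
    exists2 z, X (dyad 0%R t m j) w = Some z & ~ V n z] in
  measurable N /\ P y N = 0.
Proof.
move=> t0 N.
pose D n m j := X (dyad 0%R t m j) @^-1` [set v | if v is Some z then ~ V n z else False].
have mV n : mbl_p [set v : option M | if v is Some z then ~ V n z else False].
  by apply: (@mbl_preim _ _ (~` V n)) => //; apply/measurableC/(mopen_measurable Hs).
have dt m j : (j <= 2 ^ m)%N -> (0 <= dyad 0%R t m j <= t)%R.
  by move=> jm; apply: dyad_itv => //; exact: ltW.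
have fD n m j : (j <= 2 ^ m)%N -> filt (dyad 0%R t m j) (D n m j).
  by move=> jm; apply: (adapted Hp) => //; case/andP: (dt _ _ jm).
have aD n m j : D n m j `<=` alive X (dyad 0%R t m j).
  by move=> w; rewrite /D /alive/=; case: (X _ w).
have DS n m j : (j <= 2 ^ m)%N -> D n m j `<=` D n m.+1 j.*2.
  by move=> _ w; rewrite /D /= dyadS.
have := announced_death_null Hp c0 surv t0 fD aD DS _ _ y.
rewrite (_ : \bigcap_n _ = N); last first.
  apply/esym/seteqP; split => w /= H n.
    move=> _; have [m [j [jm [z Xz Vz]]]] := H n; exists m => //; exists j => //.
    by rewrite /D /= Xz.
  have [m _ [j jm]] := H n I; rewrite /D /=; case E : (X _ w) => [z|]// Vz.
  by exists m, j; split=> //; exists z.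
apply.
- move=> n w [m _ [j jm Dj]]; exists m => //; exists j => //.
  move: Dj; rewrite /D /=; case: (X _ w) => // z nV Vz; apply: nV.
  exact: VS.
- move=> w H; apply: contrapT => /(path_covered t0)[n Hn].
  have [m _ [j jm]] := H n; have [z Xz Vz] := Hn _ (dt _ _ jm).
  by rewrite /D /= Xz.
Qed.

End detector_out.

Section detector_osc.
Variables (q : M) (h : R).
Hypothesis (h0 : (0 < h)%R).

(** Even steps of an oscillation are farther than [2h] from [q], odd ones closer than [h]. The gap
    [h] forbids consecutive steps within [h / 2] of a common point. *)
Definition side (i : nat) (v : option M) : Prop :=
  if v is Some z then if odd i then (d q z < h)%R else (2 * h < d q z)%R
  else False.

Definition chain (n : nat) (a b : R) (w : Omega) : Prop :=
  exists f : nat -> R, [/\ (forall i, (i < n)%N -> (a <= f i <= b)%R),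
    (forall i j, (i < j < n)%N -> (f i < f j)%R) &
    (forall i, (i < n)%N -> side i (X (f i) w))].

Lemma mbl_side i : mbl_p [set v | side i v].
Proof.
rewrite /side; case: (odd i).
  apply: (@mbl_preim _ _ [set z | (d q z < h)%R]) => //.
  exact/(mopen_measurable Hs)/mopen_lt.
apply: (@mbl_preim _ _ [set z | (2 * h < d q z)%R]) => //.
exact/(mopen_measurable Hs)/mopen_gt.
Qed.

Lemma side_near i x y z : (d x y < h / 2)%R -> (d x z < h / 2)%R ->
  side i (Some y) -> side i.+1 (Some z) -> False.
Proof.
move=> xy xz; have := d_tri Hs q y z; have := d_tri Hs q z y.
have := d_tri Hs y x z; have := d_tri Hs z x y.
rewrite (d_sym Hs z y) (d_sym Hs y x) (d_sym Hs z x) /=.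
by case: (odd i) => /=; lra.
Qed.

(** A chain over two adjacent intervals puts either its initial part in the first or its final part
    in the second, so bounds on chain lengths add up. Lengths are even so that the final part again
    starts with an even side. *)
Lemma no_long_chain t w : (0 < t)%R -> alive X t w ->
  exists n, ~ chain n.*2 0 t w.
Proof.
move=> t0 wt.
pose Q a b := exists n, ~ chain n.*2 a b w.
apply: (@interval_induction R Q t t0).
  move=> a b e /andP[_ ab] be [n Hn] [m Hm]; exists (n + m)%N => -[f [f1 f2 f3]].
  case: n Hn f1 f2 f3 => [|n] Hn f1 f2 f3.
    by apply: Hn; exists (fun=> 0%R); split => // i j; rewrite andbC.
  have nm : (n.*2.+1 < (n.+1 + m).*2)%N by rewrite doubleD doubleS addSn ltnS addSn ltnS leq_addr.
  have [fb|bf] := leP (f n.*2.+1) b.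
    apply: Hn; exists f; rewrite doubleS; split=> [i im|i j /andP[ij jn]|i im].
    - have /f1/andP[-> _] : (i < (n.+1 + m).*2)%N by exact: leq_trans im nm.
      move: im; rewrite ltnS leq_eqVlt => /predU1P[->//|im].
      by apply: le_trans fb; apply/ltW/f2; rewrite im.
    - by apply: f2; rewrite ij (leq_trans jn nm).
    - by apply: f3; exact: leq_trans im nm.
  apply: Hm; exists (fun i => f (n.+1.*2 + i)%N); split=> [i im|i j /andP[ij jm]|i im].
  - have inm : (n.+1.*2 + i < (n.+1 + m).*2)%N by rewrite doubleD ltn_add2l.
    have /andP[_ ->] := f1 _ inm; rewrite andbT; apply: (le_trans (ltW bf)).
    by apply/ltW/f2; rewrite inm andbT doubleS addSn ltnS leq_addr.
  - by apply: f2; rewrite ltn_add2l ij/= doubleD ltn_add2l.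
  - have := f3 (n.+1.*2 + i)%N; rewrite doubleD ltn_add2l => /(_ im).
    by rewrite /side oddD odd_double.
move=> s /andP[s0 st].
have h20 : (0 < h / 2)%R by rewrite divr_gt0.
case E : (X s w) => [x|]; last first.
  by exfalso; apply: wt; apply: dead_stays Hp _ _ _ _ E; rewrite s0.
have [d1 d10 K1] := right_cont Hp s0 E h20.
have right v : (s < v < s + d1)%R -> Q s v.
  move=> /andP[sv vd]; exists 1%N => -[f [f1 f2 f3]].
  have [|z0 X0 Z0] := K1 (f 0%N); first by have /andP[h1 h2] := f1 0%N isT; lra.
  have [|z1 X1 Z1] := K1 (f 1%N); first by have /andP[h1 h2] := f1 1%N isT; lra.
  rewrite (d_sym Hs) in Z0; rewrite (d_sym Hs) in Z1.
  by apply: (side_near Z0 Z1 (i := 0)); [rewrite -X0|rewrite -X1]; exact: f3.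
have [s00|s0'] := leP s 0%R.
  by exists d1 => //; split=> [v|v sv _]; [lra|exact: right].
have [y ly] : exists y, left_lim d X w s y by apply: (has_left_lim Hp) => //; rewrite E.
have [d2 d20 K2] := ly _ h20.
exists (Num.min d1 d2); first by rewrite lt_min d10.
split=> v; last first.
  move=> /andP[sv vs] _; apply: right; rewrite sv; apply: lt_le_trans vs _.
  by rewrite lerD2l ge_min lexx.
(* Four points are needed to the left of [s]: the last may be [s] itself, about which the left limit
   says nothing, while [f 1] and [f 2] lie strictly before [s]. *)
move=> /andP[v0 vs] sv; exists 2%N => -[f [f1 f2 f3]].
have d2v : (s - d2 < v)%R.
  by apply: le_lt_trans sv; rewrite lerD2l lerN2 ge_min lexx orbT.
have f23 : (f 2%N < f 3%N)%R by exact: f2.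
have f12 : (f 1%N < f 2%N)%R by exact: f2.
have /andP[h2 h3] := f1 3%N isT; have /andP[h4 h5] := f1 1%N isT.
have [|z0 X0 Z0] := K2 (f 1%N); first lra.
have [|z1 X1 Z1] := K2 (f 2%N); first lra.
rewrite (d_sym Hs) in Z0; rewrite (d_sym Hs) in Z1.
by apply: (side_near Z0 Z1 (i := 1)); [rewrite -X0|rewrite -X1]; exact: f3.
Qed.

(** A chain of [n.+1] grid times whose last time is the grid time [j] itself, so that the event is
    known, and the path alive, at that time. *)
Fixpoint osc (t : R) (n m j : nat) : set Omega :=
  X (dyad 0%R t m j) @^-1` [set v | side n v] `&`
  (if n is n'.+1 then \bigcup_(i in [set i | (i < j)%N]) osc t n' m i else setT).

Lemma osc_chain t n m j : (0 < t)%R -> (j <= 2 ^ m)%N ->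
  osc t n m j `<=` [set w | chain n.+1 0 (dyad 0%R t m j) w].
Proof.
move=> t0; elim: n j => [|n IH] j jm w /=.
  move=> [sw _]; exists (fun=> dyad 0%R t m j); split=> [i _|i k|i].
  - by have /andP[-> _] := dyad_itv (ltW t0) jm; rewrite lexx.
  - by case: k => // k; rewrite !ltnS leqn0 => /andP[_ /eqP].
  - by rewrite ltnS leqn0 => /eqP ->.
move=> [sw [i /= ij /IH]] /(_ (leq_trans (ltnW ij) jm))[f [f1 f2 f3]].
have ltij := dyad_lt m t0 ij.
exists (fun k => if (k <= n)%N then f k else dyad 0%R t m j); split=> [k kn|k l /andP[kl ln]|k].
- case: ifPn => [kn'|_]; last by have /andP[-> _] := dyad_itv (ltW t0) jm; rewrite lexx.
  by have /andP[-> /le_trans ->//] := f1 k kn'; exact: ltW.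
- rewrite ltnS in ln; have kn : (k <= n)%N by rewrite -ltnS; exact: leq_trans kl ln.
  rewrite kn; case: ifPn => [ln'|_]; first by apply: f2; rewrite kl.
  by have /andP[_ /le_lt_trans ->//] := f1 k kn.
- rewrite ltnS leq_eqVlt => /predU1P[->|kn]; first by rewrite ltnn.
  by rewrite -ltnS kn; exact: f3.
Qed.

Lemma oscS t n m j : osc t n m j `<=` osc t n m.+1 j.*2.
Proof.
elim: n j => [|n IH] j w /=; rewrite dyadS; first by [].
move=> [sw [i /= ij ow]]; split=> //; exists i.*2; last exact: IH.
by rewrite /= ltn_double.
Qed.

Lemma oscSk t n m k j : osc t n m j `<=` osc t n (m + k) (j * 2 ^ k).
Proof.
elim: k => [|k IH]; first by rewrite addn0 muln1.
apply: subset_trans IH _; apply: subset_trans (@oscS _ _ _ _) _.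
by rewrite addnS expnS mulnCA mul2n.
Qed.

Lemma detector_osc_null t y : (0 < t)%R ->
  let N := [set w | forall n, exists m j, (j <= 2 ^ m)%N /\ osc t n m j w] in
  measurable N /\ P y N = 0.
Proof.
move=> t0 N.
have dt m j : (j <= 2 ^ m)%N -> (0 <= dyad 0%R t m j <= t)%R.
  by move=> jm; apply: dyad_itv => //; exact: ltW.
have fD n m j : (j <= 2 ^ m)%N -> filt (dyad 0%R t m j) (osc t n m j).
  elim: n j => [|n IH] j jm /=; apply: (filtI Hp).
  - by apply: (adapted Hp); [case/andP: (dt _ _ jm)|exact: mbl_side].
  - exact: (filtT Hp).
  - by apply: (adapted Hp); [case/andP: (dt _ _ jm)|exact: mbl_side].
  - rewrite bigcup_mkcond; apply: (filt_bigcup Hp) => i.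
    case: ifPn => [|_]; last exact: (filt0 Hp).
    rewrite inE /= => ij; have im := leq_trans (ltnW ij) jm.
    apply: (filt_mono Hp) (IH i im); case/andP: (dt _ _ im) => -> _ /=.
    by apply: dyad_le; [exact: ltW|exact: ltnW].
have aD n m j : osc t n m j `<=` alive X (dyad 0%R t m j).
  by move=> w; case: n => [|n] /= [+ _]; rewrite /alive /=; case: (X _ w).
have DS n m j : (j <= 2 ^ m)%N -> osc t n m j `<=` osc t n m.+1 j.*2.
  by move=> _; exact: oscS.
have := announced_death_null Hp c0 surv t0 fD aD DS _ _ y.
rewrite (_ : \bigcap_n _ = N); last first.
  apply/esym/seteqP; split => w /= H n.
    by move=> _; have [m [j [jm Dj]]] := H n; exists m => //; exists j.
  by have [m _ [j jm Dj]] := H n I; exists m, j.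
apply.
- move=> n w [m _ [j /= jm [_ [i /= ij Di]]]]; exists m => //; exists i => //=.
  by rewrite ltnS in jm *; exact: leq_trans (ltnW ij) jm.
- move=> w H; apply: contrapT => /(no_long_chain t0)[n Hn].
  apply: Hn; have [m _ [j /= jm]] := H n.*2.
  move=> /(osc_chain t0 jm)[f [f1 f2 f3]]; exists f; split=> [i im|i k /andP[ik kn]|i im].
  + have /andP[-> /le_trans ->//] := f1 i (leqW im).
    by have /andP[] := dt _ _ jm.
  + by apply: f2; rewrite ik ltnS ltnW.
  + exact: f3 i (leqW im).
Qed.

End detector_osc.

Lemma dyad_between (t a b : R) m0 : (0 <= a < b)%R -> (b <= t)%R ->
  exists k j, (j <= 2 ^ (m0 + k))%N /\ (a < dyad 0 t (m0 + k) j < b)%R.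
Proof.
move=> /andP[a0 ab] bt.
have t0 : (0 < t)%R by lra.
have [|m1 Hm1] := @pow2V_lt_eps R ((b - a) / t); first by rewrite divr_gt0//; lra.
have [|j [jm /andP[h1 h2]]] := @dyad_next R 0 t a _ (m0 + m1).
  by rewrite a0; lra.
exists m1, j; split=> //; rewrite h1/=.
apply: le_lt_trans h2 _; rewrite subr0.
have := Hm1 _ (leq_addl m0 m1); rewrite ltr_pdivlMr// mulrC; lra.
Qed.

Lemma dyadSk (a b : R) m k j : dyad a b (m + k) (j * 2 ^ k) = dyad a b m j.
Proof.
elim: k => [|k IH]; first by rewrite addn0 muln1.
by rewrite addnS expnS mulnCA mul2n dyadS.
Qed.

Lemma right_cont_open (V : set M) s w z : (0 <= s)%R -> mopen d V ->
  X s w = Some z -> V z -> exists2 e : R, (0 < e)%R &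
    forall u, (s <= u < s + e)%R -> exists2 y, X u w = Some y & V y.
Proof.
move=> s0 oV E /oV[e e0 He]; have [r r0 Hr] := right_cont Hp s0 E e0.
exists r => // u /Hr[y Xy yz]; exists y => //; apply: He.
by rewrite /mball/= (d_sym Hs).
Qed.

(** Each new point of the oscillation is moved to a dyadic time by right continuity, the sides being
    open. This may require a finer grid, to which the chain found so far is transported by
    [oscSk]. *)
Lemma oscillating_path q (h t T : R) w : (0 < T <= t)%R ->
  (forall n a, (0 <= a < T)%R -> exists2 u, (a < u < T)%R & side q h n (X u w)) ->
  forall n, exists m j, (j <= 2 ^ m)%N /\ osc q h t n m j w.
Proof.
move=> /andP[T0 Tt] H n.
have t0 : (0 < t)%R by lra.
have claim k a m0 : (0 <= a < T)%R -> exists l j, [/\ (j <= 2 ^ (m0 + l))%N,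
    (a < dyad 0 t (m0 + l) j < T)%R & side q h k (X (dyad 0 t (m0 + l) j) w)].
  move=> aT; have [u /andP[au uT]] := H k a aT.
  case E : (X u w) => [z|]//.
  have u0 : (0 <= u)%R by lra.
  pose S z : bool := if odd k then (d q z < h)%R else (2 * h < d q z)%R.
  have oS : mopen d [set z | S z].
    by rewrite /S; case: (odd k); [exact: mopen_lt|exact: mopen_gt].
  move=> Sz; have [e e0 He] := right_cont_open u0 oS E Sz.
  have [||l [j [jl /andP[uj je]]]] := @dyad_between t u (Num.min (u + e) T)%R m0.
  - by rewrite u0 lt_min uT andbT; lra.
  - by rewrite ge_min Tt orbT.
  move: je; rewrite lt_min => /andP[je jT].
  exists l, j; split=> //; first by rewrite jT andbT; lra.
  have [|y Xy Sy] := He (dyad 0 t (m0 + l) j); first by rewrite (ltW uj).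
  by rewrite Xy.
suff [m [j [jm _ oj]]] : exists m j, [/\ (j <= 2 ^ m)%N, (dyad 0 t m j < T)%R &
    osc q h t n m j w] by exists m, j.
elim: n => [|n [m [j [jm jT oj]]]].
  have [|l [j [jl /andP[_ jT] sj]]] := claim 0%N 0%R 0%N; first by rewrite lexx.
  by exists (0 + l)%N, j.
have [|l [i [il /andP[ji iT] si]]] := claim n.+1 (dyad 0 t m j) m.
  by rewrite jT andbT; have /andP[] := dyad_itv (ltW t0) jm.
exists (m + l)%N, i; split=> //=; split=> //.
exists (j * 2 ^ l)%N; last exact: oscSk oj.
rewrite /= ltnNge; apply/negP => /(dyad_le (m + l) (ltW t0)).
by rewrite dyadSk leNgt ji.
Qed.

Lemma no_limit_point_leaves_compact w T K : mcompact d K ->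
  (forall x, exists p : R * R, [/\ (0 < p.1)%R, (0 < p.2)%R &
     forall u z, (T - p.2 < u < T)%R -> X u w = Some z -> (p.1 <= d z x)%R]) ->
  exists2 r, (0 < r)%R &
    forall u z, (T - r < u < T)%R -> X u w = Some z -> ~ K z.
Proof.
move=> cK /choice[p Hp'].
have [|x Kx|F [fF KF]] := cK M (fun x => mball d x (p x).1).
- by move=> x; exact: mopen_lt.
- by exists x => //; rewrite /mball/= (d_refl Hs); have [] := Hp' x.
have [|r r0 Hr] := finite_set_min (e := fun x => (p x).2) fF.
  by move=> x _; have [] := Hp' x.
exists r => // u z /andP[ru uT] Xz /KF[x Fx]; rewrite /mball/= => xz.
have [_ _ /(_ u z)] := Hp' x; rewrite uT andbT => /(_ _ Xz).
have := Hr x Fx; rewrite (d_sym Hs z x) => h1 h2.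
have : ((p x).1 <= d x z)%R by apply: h2; lra.
by rewrite leNgt xz.
Qed.

(* If the path leaves every compact set it is announced by the first detector;
   otherwise it has a limit point which is not a limit, and oscillates. *)
Lemma death_left_lim t y : (0 < t)%R ->
  exists N : set Omega, [/\ measurable N, P y N = 0 &
    forall w T, (0 < T <= t)%R -> dies_at X T w -> ~ N w ->
      exists x, left_lim d X w T x].
Proof.
move=> t0; have [_ lc [q qd] _ _] := Hs.
(* Countably many balls around the dense points, each inside a compact closed ball, cover [M]. [V n]
   is a finite union of them: open, and avoided near [T] by a path without limit points. *)
pose good (i k : nat) := exists x r, mcompact d [set z | (d x z <= r)%R] /\
  mball d (q i) k.+1%:R^-1%R `<=` [set z | (d x z <= r)%R].
pose B (i k : nat) := [set z | good i k /\ mball d (q i) k.+1%:R^-1%R z].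
pose V (n : nat) := [set z | exists i k, [/\ (i <= n)%N, (k <= n)%N & B i k z]].
have Vop n : mopen d (V n).
  move=> z [i [k [il kl [g zb]]]].
  have [e e0 He] := mopen_lt Hs zb.
  by exists e => // u /He ub; exists i, k.
have VS n : V n `<=` V n.+1.
  by move=> z [i [k [il kl bz]]]; exists i, k; rewrite !leqW.
have Vcov x : exists n, V n x.
  have [r r0 cr] := lc x.
  have [|k kr] := @natSinv_lt_eps R (r / 2); first lra.
  have k0 : (0 < k.+1%:R^-1 :> R)%R by rewrite invr_gt0.
  have [i qi] := qd x _ k0.
  exists (maxn i k), i, k; rewrite leq_maxl leq_maxr; split=> //; split.
    exists x, r; split=> // z; rewrite /mball/= => zq.
    by have := d_tri Hs x (q i) z; move: kr k0 qi zq; move: (k.+1%:R^-1)%R => q'; lra.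
  by rewrite /mball/= (d_sym Hs).
pose N1 := [set w | forall n, exists m j, (j <= 2 ^ m)%N /\
    exists2 z, X (dyad 0%R t m j) w = Some z & ~ V n z].
(* Countably many centres and scales suffice. If values at distance at least [e] from a limit point
   [x] recur, take [h = k.+1%:R^-1 < e / 3] and [q i] within [h / 2] of [x]: values near [x] are
   within [h] of [q i], the far ones beyond [2h]. *)
pose N2 (i k : nat) := [set w | forall n, exists m j, (j <= 2 ^ m)%N /\
    osc (q i) k.+1%:R^-1%R t n m j w].
have N10 : (P y).-negligible N1.
  have [mN1 N10] := @detector_out_null V Vop VS Vcov t y t0.
  by exists N1; split.
have N20 i k : (P y).-negligible (N2 i k).
  have k0 : (0 < k.+1%:R^-1 :> R)%R by rewrite invr_gt0.
  by have [mN2 N20] := @detector_osc_null (q i) _ k0 t y t0; exists (N2 i k); split.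
have [N [mN NN sN]] : (P y).-negligible (N1 `|` \bigcup_i \bigcup_k N2 i k).
  by apply: negligibleU => //; apply: negligible_bigcup => i; exact: negligible_bigcup.
exists N; split=> // w T Tt [XT alv] nN; have /andP[T0 T_t] := Tt.
have nN12 : ~ (N1 `|` \bigcup_i \bigcup_k N2 i k) w by move=> /sN.
apply: contrapT => nll; apply: nN12.
have alive_before u : (0 <= u < T)%R -> exists z, X u w = Some z.
  by move=> /alv; case: (X u w) => // z _; exists z.
have [[x limx]|nlim] := pselect (exists x, forall e r, (0 < e)%R -> (0 < r)%R ->
    exists u z, [/\ (T - r < u < T)%R, X u w = Some z & (d z x < e)%R]).
  right.
  have [e [e0 far]] : exists e, (0 < e)%R /\ forall a, (0 <= a < T)%R ->
      exists u z, [/\ (a < u < T)%R, X u w = Some z & (e <= d z x)%R].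
    apply: contrapT => nfar; apply: nll; exists x => e e0.
    apply: contrapT => ne; apply: nfar; exists e; split=> // a /andP[a0 aT].
    apply: contrapT => na; apply: ne; exists (T - a)%R; first lra.
    move=> u /andP[au uT]; have [|z Xz] := alive_before u; first lra.
    exists z => //; rewrite ltNge; apply/negP => ez; apply: na; exists u, z.
    by split=> //; rewrite uT andbT; lra.
  have [|k ke] := @natSinv_lt_eps R (e / 3); first lra.
  have k0 : (0 < k.+1%:R^-1 :> R)%R by rewrite invr_gt0.
  have [|i qi] := qd x (k.+1%:R^-1 / 2)%R; first by rewrite divr_gt0.
  exists i => //; exists k => //; apply: oscillating_path Tt _ => n a aT.
  rewrite /side; case on : (odd n).
    have [||u [z [uT Xz zx]]] := limx (k.+1%:R^-1 / 2)%R (T - a)%R.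
    - by rewrite divr_gt0.
    - lra.
    exists u; first by move: uT; lra.
    rewrite Xz; have := d_tri Hs (q i) x z; move: zx qi.
    rewrite (d_sym Hs (q i) x) (d_sym Hs z x); move: (k.+1%:R^-1)%R => q'; lra.
  have [u [z [uT Xz zx]]] := far a aT; exists u => //.
  rewrite Xz; have := d_tri Hs z (q i) x; move: zx qi ke k0.
  rewrite (d_sym Hs (q i) x) (d_sym Hs z (q i)); move: (k.+1%:R^-1)%R => q'; lra.
left => n.
have nlim' x : exists p : R * R, [/\ (0 < p.1)%R, (0 < p.2)%R &
     forall u z, (T - p.2 < u < T)%R -> X u w = Some z -> (p.1 <= d z x)%R].
  apply: contrapT => np; apply: nlim; exists x => e r e0 r0.
  apply: contrapT => nu; apply: np; exists (e, r); split=> // u z uT Xz.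
  by rewrite leNgt; apply/negP => zx; apply: nu; exists u, z.
have /choice[r Hr] : forall p : nat * nat, exists r, (0 < r)%R /\
    forall u z, (T - r < u < T)%R -> X u w = Some z -> ~ B p.1 p.2 z.
  move=> [i k]; have [[x [r [cK bK]]]|ng] := pselect (good i k).
    have [s s0 Hs'] := no_limit_point_leaves_compact cK nlim'.
    by exists s; split=> // u z uT Xz [_ /bK]; exact: Hs' uT Xz.
  by exists 1%R; split=> // u z _ _ [].
have fF : finite_set ([set i | (i <= n)%N] `*` [set i | (i <= n)%N]).
  by apply: finite_setX; apply: (sub_finite_set _ (finite_II n.+1)) => i.
have [|s s0 Hs'] := finite_set_min (e := r) fF; first by move=> p _; case: (Hr p).
have [||k [j [jk /andP[j1 j2]]]] := @dyad_between t (Num.max 0 (T - s))%R T 0.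
- by rewrite le_max lexx/= gt_max T0/=; lra.
- by [].
move: j1; rewrite gt_max => /andP[j0 j1].
have [|z Xz] := alive_before (dyad 0 t (0 + k) j); first by rewrite (ltW j0).
exists (0 + k)%N, j; split=> //; exists z => // -[i [l [il kl Bz]]].
have [_ /(_ _ z)] := Hr (i, l); apply; [|exact: Xz|exact: Bz].
by rewrite j2 andbT; have := Hs' (i, l) (conj il kl); lra.
Qed.

End death.

(** * Exit probabilities and the Levy system *)

Section tail.
Context {R : realType} {dM : measure_display} {M : measurableType dM}
  {d : M -> M -> R} {dO : measure_display} {Omega : measurableType dO}
  {P : option M -> probability Omega R} {X : R -> Omega -> option M}
  {filt : R -> set (set Omega)}
  {J : M -> {measure set M -> \bar R}} {kappa : M -> \bar R}.
Hypotheses (Hs : standing_space d) (Hp : standard_data d P X filt)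
  (Hl : levy_system d P X J kappa).

Section big_jump.
Variables (y : M) (rho b t eta : R).
Hypotheses (rho0 : (0 <= rho)%R) (b0 : (0 < b)%R) (t0 : (0 < t)%R) (eta0 : (0 <= eta)%R)
  (HJ : forall z, (d y z <= rho)%R -> J_out d J kappa z b <= eta%:E).

Let A := [set z | (d y z <= rho)%R].
Let B := [set z | (rho + b <= d y z)%R].

(** Death from the ball counts as a big jump, in accordance with [cball] omitting the cemetery and
    [J_out] including the killing rate. *)
Definition big_jump (x : M) (v : option M) : \bar R :=
  if v is Some z then (\1_A x * \1_B z)%:E else (\1_A x)%:E.

Let mA : measurable A. Proof. exact: measurable_le_d. Qed.

Let mB : measurable B.
Proof.
rewrite (_ : B = ~` [set z | (d y z < rho + b)%R]).
  exact/measurableC/(mopen_measurable Hs)/mopen_lt.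
by apply/seteqP; split => z; rewrite /B /= leNgt => /negP.
Qed.

(** By the triangle inequality a jump from [A] to [B] has size at least [b], so the integrand of the
    Levy system never exceeds [eta]. The comparison of integrals needs no measurability in [w]. *)
Lemma jump_sum_big_jump_le :
  \int[P (Some y)]_w jump_sum d X big_jump t w <= (t * eta)%:E.
Proof.
have [mJ k0 mk ->//] := Hl; last 4 first.
- by move=> x [z|]; rewrite lee_fin ?mulr_ge0.
- apply/measurable_EFinP; apply: measurable_funM.
    exact: measurableT_comp (measurable_indic mA) measurable_fst.
  exact: measurableT_comp (measurable_indic mB) measurable_snd.
- by apply/measurable_EFinP; exact: measurable_indic.
- move=> x /=; rewrite !indicE; have [/set_mem Ax|] := boolP (x \in A); last by rewrite mul0r.
  rewrite memNset ?mulr0// /B /=; apply/negP; rewrite -ltNge.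
  by apply: le_lt_trans Ax _; rewrite ltrDl.
have big0 x v : 0 <= big_jump x v by case: v => [z|]; rewrite lee_fin ?mulr_ge0.
have li0 s w : 0 <= levy_integrand X J kappa big_jump s w.
  rewrite /levy_integrand; case: (X s w) => // x.
  by apply: adde_ge0; [exact: integral_ge0|exact: mule_ge0].
have lieta s w : levy_integrand X J kappa big_jump s w <= eta%:E.
  rewrite /levy_integrand; case: (X s w) => [x|]; last by rewrite lee_fin.
  rewrite /big_jump; have [xA|xA] := boolP (x \in A).
    rewrite indicE xA mul1e; under eq_integral do rewrite mul1r.
    rewrite integral_indic// setIT; apply: le_trans (HJ (set_mem xA)).
    rewrite /J_out leeD2r//; apply: le_measure; rewrite ?inE//.
      exact/measurableC/(mopen_measurable Hs)/mopen_lt.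
    move=> z; rewrite /B /mball /= => yz; apply/negP; rewrite -leNgt.
    by have := d_tri Hs y x z; have := set_mem xA; rewrite /A /=; lra.
  rewrite indicE (negbTE xA) mul0e adde0 integral0_eq ?lee_fin// => z _.
  by rewrite mul0r.
apply: (@le_trans _ _ (\int[P (Some y)]_w (t * eta)%:E)); last first.
  rewrite integral_cst// -[leRHS]mule1; apply: lee_wpmul2l; last exact: probability_le1.
  by rewrite lee_fin mulr_ge0// ltW.
apply: le_integral_nomeas => w _; first by apply: integral_ge0.
apply: (@le_trans _ _ (\int[lebesgue_measure]_(s in [set s : R | (0 <= s <= t)%R]) eta%:E)).
  by apply: le_integral_nomeas => s _.
rewrite (_ : [set s : R | _] = `[0%R, t]%classic); last first.
  by apply/seteqP; split => s /=; rewrite in_itv.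
rewrite integral_cst//= lebesgue_measure_itv/= lte_fin t0 sube0 -EFinM lee_fin.
by rewrite mulrC.
Qed.

Lemma jump_sum_ge1 T x w : (0 < T <= t)%R -> left_lim d X w T x -> A x ->
  (forall z, X T w = Some z -> B z) -> 1 <= jump_sum d X big_jump t w.
Proof.
move=> Tt lx Ax HB; rewrite /jump_sum.
apply: (@le_trans _ _ (\sum_(p \in [set (T, x)]) big_jump p.2 (X p.1 w))).
  rewrite fsbig_set1 /= /big_jump; case E : (X T w) => [z|].
    by rewrite !indicE !mem_set ?mul1r//; exact: HB.
  by rewrite indicE mem_set.
apply: ereal_sup_ubound; exists [set (T, x)] => //; split; first exact: finite_set1.
by move=> _ ->.
Qed.

Let F m j : set Omega := (X (dyad 0%R t m j) @^-1` ~` cball d y rho) `&`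
  \bigcap_(i in [set i | (i < j)%N]) (X (dyad 0%R t m i) @^-1` cball d y rho).

Let dt m j : (j <= 2 ^ m)%N -> (0 <= dyad 0%R t m j <= t)%R.
Proof. by move=> jm; apply: dyad_itv => //; exact: ltW. Qed.

Let fF m j : (j <= 2 ^ m)%N -> filt (dyad 0%R t m j) (F m j).
Proof.
move=> jm; apply: (filtI Hp).
  apply: (adapted Hp); first by case/andP: (dt jm).
  exact/mblC/(mbl_cball Hs).
rewrite bigcap_mkcond; apply: (filt_bigcap Hp) => i.
case: ifPn => [|_]; last exact: (filtT Hp).
rewrite inE /= => ij; have im := leq_trans (ltnW ij) jm.
have /andP[i0 _] := dt im.
apply: (filt_mono Hp) (adapted Hp i0 (mbl_cball Hs y rho)).
by rewrite i0/=; apply: dyad_le; [exact: ltW|exact: ltnW].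
Qed.

Let first_exit m k w : ~ cball d y rho (X (dyad 0%R t m k) w) ->
  exists2 j, (j <= k)%N & F m j w.
Proof.
move=> nk.
pose Q j := `[< ~ cball d y rho (X (dyad 0%R t m j) w) >].
have exQ : exists j, Q j by exists k; apply/asboolP.
have [j /asboolP Qj minj] := ex_minnP exQ.
exists j; first by apply: minj; apply/asboolP.
split=> // i /= ij; apply: contrapT => ni.
by have := minj i (introT (asboolP _) ni); rewrite leqNgt ij.
Qed.

Let O m := \bigcup_(j in [set j | (j <= 2 ^ m)%N])
   (F m j `&` X (dyad 0%R t m j) @^-1` ~` cball d y (rho + b)).

Let mO m : measurable (O m).
Proof.
rewrite /O bigcup_mkcond; apply: bigcupT_measurable => j; case: ifPn => // /set_mem jm.
apply: measurableI; first exact: filt_measurable Hp _ _ (fF jm).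
apply: (measurable_X Hp); first by case/andP: (dt jm).
exact/mblC/(mbl_cball Hs).
Qed.

(* As the grid is refined, the first exit times on the grid decrease to the
   exit time, so overshooting on arbitrarily fine grids means a big jump. *)
Let overshoot_big_jump (N : set Omega) w :
  (forall w T, (0 < T <= t)%R -> dies_at X T w -> ~ N w ->
      exists x, left_lim d X w T x) ->
  ~ N w -> X 0%R w = Some y -> (forall n, exists2 m, (n <= m)%N & O m w) ->
  1 <= jump_sum d X big_jump t w.
Proof.
move=> HN nN X0 HO.
pose S := [set s | (0 <= s <= t)%R /\ ~ cball d y rho (X s w)].
have Sj m j : (j <= 2 ^ m)%N -> F m j w -> S (dyad 0%R t m j).
  by move=> jm [nj _]; split=> //; exact: dt.
have S0 : S !=set0.
  have [m _ [j jm [Fj _]]] := HO 0%N.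
  by exists (dyad 0%R t m j); exact: Sj.
have hS : has_inf S by split=> //; exists 0%R => s [/andP[]].
set T := inf S.
have T0 : (0 <= T)%R by apply: lb_le_inf => // s [/andP[]].
have Tle s : S s -> (T <= s)%R by apply: inf_lbound; exact: hS.2.
have Tt : (T <= t)%R by case: S0 => s [/andP[s0 st] ns]; apply: (le_trans _ st); apply: Tle; split=> //; rewrite s0 st.
have before s : (0 <= s < T)%R -> cball d y rho (X s w).
  move=> /andP[s0 sT]; apply: contrapT => ns.
  by have := Tle s; rewrite leNgt sT => /(_ (conj (introT andP (conj s0 (ltW (lt_le_trans sT Tt)))) ns)).
have after e : (0 < e)%R -> exists m0, forall m, (m0 <= m)%N -> forall j,
    (j <= 2 ^ m)%N -> F m j w -> (dyad 0%R t m j < T + e)%R.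
  move=> e0; have [s [/andP[s0 st] ns] sT] := inf_adherent e0 hS.
  move: st; rewrite le_eqVlt => /predU1P[st|st].
    by exists 0%N => m _ j /dt/andP[_ jt] _; rewrite st in sT; exact: le_lt_trans sT.
  have [e' e'0 He'] := right_cont_out Hs Hp s0 ns.
  have [|m0 Hm0] := @pow2V_lt_eps R (Num.min e' (T + e - s) / t)%R.
    by rewrite divr_gt0// lt_min e'0; lra.
  exists m0 => m m0m j jm [_ Fj].
  have [|k [km /andP[sk ks]]] := @dyad_next R 0 t s _ m; first by rewrite s0.
  have tm : (t / 2 ^+ m < Num.min e' (T + e - s))%R.
    by rewrite mulrC -ltr_pdivlMr//; exact: Hm0.
  move: tm; rewrite lt_min subr0 in ks * => /andP[tm1 tm2].
  have nk : ~ cball d y rho (X (dyad 0%R t m k) w) by apply: He'; lra.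
  apply: (@le_lt_trans _ _ (dyad 0%R t m k)); last lra.
  apply: dyad_le; first exact: ltW.
  by rewrite leqNgt; apply/negP => kj; apply: nk; exact: Fj.
have notin z : X T w = Some z -> B z.
  move=> XT; rewrite /B /= leNgt; apply/negP => zr.
  have [e e0 He] := right_cont_in Hs Hp T0 XT zr.
  have [m0 Hm0] := after e e0.
  have [m m0m [j jm [Fj nj]]] := HO m0.
  have [|z' Xz' z'r] := He (dyad 0%R t m j).
    by rewrite (Hm0 m m0m j jm Fj) andbT; apply: Tle; exact: Sj.
  by apply: nj; rewrite Xz' /=; exact: ltW.
have T_gt0 : (0 < T)%R.
  rewrite lt_neqAle T0 andbT; apply/eqP => T00.
  by have := notin y; rewrite -T00 X0 /B /= (d_refl Hs) => /(_ erefl); rewrite leNgt ltr_wpDl.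
have alv s : (0 <= s < T)%R -> X s w <> None.
  by move=> /before; case: (X s w).
have [x lx] : exists x, left_lim d X w T x.
  case E : (X T w) => [z|]; first by apply: (has_left_lim Hp) => //; rewrite E.
  by apply: HN nN => //; rewrite T_gt0.
apply: (@jump_sum_ge1 T x) => //; first by rewrite T_gt0.
rewrite /A /= leNgt; apply/negP => rx.
have [|e e0 He] := lx (d y x - rho)%R; first lra.
pose u := (Num.max (T - e / 2) (T / 2))%R.
have uT : (u < T)%R by rewrite /u gt_max; apply/andP; split; lra.
have u0 : (0 <= u)%R by rewrite /u le_max; apply/orP; right; lra.
have [|z Xz zx] := He u; first by rewrite uT andbT /u lt_max; apply/orP; left; lra.
have := before u; rewrite u0 uT Xz /= => /(_ isT) yz.
by have := d_tri Hs y z x; lra.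
Qed.

Variable c : R.
Hypotheses (c0 : (0 < c)%R) (c1 : (c <= 1)%R)
  (surv : forall z s, (0 <= s)%R -> c%:E <= P (Some z) (alive X s)).

Let O' := \bigcap_n \bigcup_(m in [set m | (n <= m)%N]) O m.

Let mO' n : measurable (\bigcup_(m in [set m | (n <= m)%N]) O m).
Proof. by rewrite bigcup_mkcond; apply: bigcupT_measurable => m; case: ifPn. Qed.

(** Markov's inequality: outside the null set of deaths without left limit, a path from [y]
    overshooting on infinitely many grids has jump sum at least [1]. *)
Let overshoot_le : P (Some y) O' <= (t * eta)%:E.
Proof.
have [N [mN N0 HN]] := death_left_lim Hs Hp c0 surv (Some y) t0.
have m0 : measurable [set w | X 0%R w = Some y].
  exact: (measurable_start Hs Hp).
have mC : measurable (O' `&` [set w | X 0%R w = Some y] `\` N).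
  by apply: measurableD => //; apply: measurableI => //; exact: bigcapT_measurable.
have nul : (P (Some y)).-negligible (N `|` ~` [set w | X 0%R w = Some y]).
  apply: negligibleU; first by exists N; split.
  exists (~` [set w | X 0%R w = Some y]); split => //; first exact: measurableC.
  exact: (start_null Hs Hp y).
apply: (@le_trans _ _ (P (Some y) (O' `&` [set w | X 0%R w = Some y] `\` N))).
  have [N' [mN' N'0 sN']] := nul.
  apply: (@le_trans _ _ (P (Some y) ((O' `&` [set w | X 0%R w = Some y] `\` N) `|` N'))).
    apply: le_measure; rewrite ?inE.
    - exact: bigcapT_measurable.
    - exact: measurableU.
    move=> w Ow; have [Nw|nNw] := pselect (N w); first by right; apply: sN'; left.
    have [X0|nX0] := pselect (X 0%R w = Some y); last by right; apply: sN'; right.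
    by left.
  by rewrite measureU0.
apply: le_trans jump_sum_big_jump_le.
rewrite -[X in P _ X]setIT -integral_indic//.
apply: le_integral_nomeas => w _; first by rewrite lee_fin.
rewrite indicE; case: (boolP (w \in _)) => [/set_mem[[Ow X0] nN]|_].
  apply: (overshoot_big_jump HN) => // n; have [m nm Om] := Ow n I.
  by exists m.
by apply: esum_ge0 => p _; case: (X _ w) => [z|]; rewrite lee_fin ?mulr_ge0.
Qed.

Hypothesis Hc : forall z, (d y z <= rho + b)%R ->
  c%:E <= P (Some z) (stay d X y (rho + b + b) 0 t).

Let G m j := F m j `&` X (dyad 0%R t m j) @^-1` cball d y (rho + b).

Let fG m j : (j <= 2 ^ m)%N -> filt (dyad 0%R t m j) (G m j).
Proof.
move=> jm; apply: (filtI Hp); first exact: fF.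
by apply: (adapted Hp _ (mbl_cball Hs y _)); case/andP: (dt jm).
Qed.

(** The first exit on the grid is moderate, landing in the ball of radius [rho + b], but the path
    then travels a further [b] within time [t]. Given [G m j], this has probability at most
    [1 - c]. *)
Let W m j := G m j `\`
  dstay d X y (rho + b + b) (dyad 0%R t m j) (dyad 0%R t m j + t) m.

Let P_W m j : (j <= 2 ^ m)%N ->
  P (Some y) (W m j) <= (1 - c)%:E * P (Some y) (G m j).
Proof.
move=> jm; have /andP[j0 _] := dt jm.
have mG := filt_measurable Hp (fG jm).
have mS : measurable (dstay d X y (rho + b + b) (dyad 0%R t m j) (dyad 0%R t m j + t) m).
  apply: (filt_measurable Hp (t := (dyad 0%R t m j + t)%R)).
  by apply: (filt_dstay Hs Hp); rewrite j0 lerDl ltW.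
have := @dstay_markov _ _ _ _ _ _ _ _ _ Hs Hp y (rho + b + b) _ t m _ (Some y)
  [set z | (d y z <= rho + b)%R] c j0 (ltW t0) (fG jm) (ltW c0).
move=> /(_ _ Hc) H.
have {}H : c%:E * P (Some y) (G m j) <= P (Some y) (G m j `&`
    dstay d X y (rho + b + b) (dyad 0%R t m j) (dyad 0%R t m j + t) m).
  apply: H => w [_ /=]; case: (X _ w) => // z yz; exists z => //.
have fin A' : measurable A' -> P (Some y) A' \is a fin_num by move=> ?; exact: fin_num_measure.
rewrite measureD//; last by rewrite -ge0_fin_numE// fin.
rewrite EFinB muleBl// ?fin// mul1e; apply: leeB => //.
Qed.

Let F_disj m i j : (i < j)%N -> F m i `&` F m j = set0.
Proof.
by move=> ij; apply/seteqP; split=> // w [[ni _] [_ Fj]]; exact/ni/Fj.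
Qed.

Let P_bigW m K : (K <= (2 ^ m).+1)%N ->
  P (Some y) (\bigcup_(j in [set j | (j < K)%N]) W m j) <=
  (1 - c)%:E * P (Some y) (\bigcup_(j in [set j | (j < K)%N]) G m j).
Proof.
have US (B' : nat -> set Omega) n : \bigcup_(j in [set j | (j < n.+1)%N]) B' j =
    (\bigcup_(j in [set j | (j < n)%N]) B' j) `|` B' n.
  apply/seteqP; split=> w.
    move=> [j /=]; rewrite ltnS leq_eqVlt => /predU1P[->|jn]; first by right.
    by left; exists j.
  by move=> [[j /= jn Bj]|Bn]; [exists j => //=; exact: ltnW|exists n => /=].
have mW j : (j <= 2 ^ m)%N -> measurable (W m j).
  move=> jm; apply: measurableD; first exact: filt_measurable Hp _ _ (fG jm).
  apply: (filt_measurable Hp (t := (dyad 0%R t m j + t)%R)).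
  by have /andP[j0 _] := dt jm; apply: (filt_dstay Hs Hp); rewrite j0 lerDl ltW.
have mG j : (j <= 2 ^ m)%N -> measurable (G m j).
  by move=> jm; exact: filt_measurable Hp _ _ (fG jm).
have mU (B' : nat -> set Omega) n : (n <= (2 ^ m).+1)%N ->
    (forall j, (j <= 2 ^ m)%N -> measurable (B' j)) ->
    measurable (\bigcup_(j in [set j | (j < n)%N]) B' j).
  move=> nm mB'; rewrite bigcup_mkcond; apply: bigcupT_measurable => j.
  by case: ifPn => // /set_mem /= jn; apply: mB'; rewrite -ltnS (leq_trans jn).
elim: K => [|K IH] Km.
  have E (B' : nat -> set Omega) : \bigcup_(j in [set j | (j < 0)%N]) B' j = set0.
    by apply/seteqP; split=> // w [].
  by rewrite !E !measure0 mule0.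
have {}IH := IH (ltnW Km).
have KK : (K <= 2 ^ m)%N by [].
rewrite !US.
rewrite [X in _ <= _ * X]measureU; [|exact: mU (ltnW Km) mG|exact: mG|]; last first.
  apply/seteqP; split=> // w [[j /= jK [Fj _]] [FK _]].
  by have : (F m j `&` F m K) w by []; rewrite F_disj.
rewrite ge0_muleDr//; apply: le_trans (leeD IH (P_W KK)).
apply: measureU2; [exact: mU (ltnW Km) mW|exact: mW].
Qed.

Let cover m : ~` dstay d X y (rho + b + b) 0 t m `<=`
  O m `|` \bigcup_(j in [set j | (j < (2 ^ m).+1)%N]) W m j.
Proof.
move=> w /existsNP[k] /not_implyP[km nk].
have nk' : ~ cball d y rho (X (dyad 0 t m k) w).
  have rr : (rho <= rho + b + b)%R by rewrite -addrA lerDl addr_ge0// ltW.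
  by move=> h; apply: nk; exact: (cballS rr h).
have [j jk Fj] := first_exit nk'.
have jm := leq_trans jk km.
have [Ij|nI] := pselect (cball d y (rho + b) (X (dyad 0 t m j) w)); last first.
  by left; exists j.
right; exists j => //; split=> // /(_ (k - j)%N (leq_trans (leq_subr _ _) km)).
(* The grid restarted at the exit time also has length [t], hence the same mesh: point [k] of the
   old grid is point [k - j] of the new one. *)
rewrite (_ : dyad _ _ _ _ = dyad 0 t m k)//.
rewrite {1}/dyad (_ : dyad 0 t m j + t - dyad 0 t m j = t - 0)%R; last by ring.
by rewrite /dyad natrB//; move: ((t - 0) / 2 ^+ m)%R => q; ring.
Qed.

(** To leave the ball of radius [rho + 2b] the path must first leave that of radius [rho], and then
    either overshoots by [b] or lands nearby and moves [b] again. The first alternative costs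
    [t * eta], the second a factor [1 - c]. *)
Lemma stay_step : P (Some y) (~` stay d X y (rho + b + b) 0 t) <=
  (1 - c)%:E * P (Some y) (~` stay d X y rho 0 t) + (t * eta)%:E.
Proof.
have mS r : measurable (stay d X y r 0 t).
  by apply: (filt_measurable Hp (t := t)); apply: (filt_stay Hs Hp); rewrite lexx ltW.
have mD r m : measurable (dstay d X y r 0 t m).
  by apply: (filt_measurable Hp (t := t)); apply: (filt_dstay Hs Hp); rewrite lexx ltW.
set r2 := (rho + b + b)%R.
(* The overshoot events [O m] need not be monotone in [m]. Bounding each by the union [U n] over
   [m >= n] yields, in the limit, the limsup event [O'], whose probability is controlled. *)
set U := fun n => \bigcup_(m in [set m | (n <= m)%N]) O m.
have c1' : 0 <= (1 - c)%:E by rewrite lee_fin subr_ge0.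
have step m : P (Some y) (~` dstay d X y r2 0 t m) <=
    (1 - c)%:E * P (Some y) (~` stay d X y rho 0 t) + P (Some y) (O m).
  have mWb : measurable (\bigcup_(j in [set j | (j < (2 ^ m).+1)%N]) W m j).
    rewrite bigcup_mkcond; apply: bigcupT_measurable => j.
    case: ifPn => // /set_mem /= jn.
    apply: measurableD; first exact: filt_measurable Hp _ _ (fG jn).
    apply: (filt_measurable Hp (t := (dyad 0%R t m j + t)%R)).
    by have /andP[j0 _] := dt jn; apply: (filt_dstay Hs Hp); rewrite j0 lerDl ltW.
  apply: (@le_trans _ _ (P (Some y) (O m `|` \bigcup_(j in [set j | (j < (2 ^ m).+1)%N]) W m j))).
    apply: le_measure; rewrite ?inE; [exact: measurableC|exact: measurableU|exact: cover].
  apply: le_trans (measureU2 _ (mO m) mWb) _; rewrite addeC leeD2r//.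
  apply: le_trans (P_bigW (leqnn _)) _; apply: lee_wpmul2l => //.
  apply: le_measure; rewrite ?inE; [|exact: measurableC|].
    rewrite bigcup_mkcond; apply: bigcupT_measurable => j.
    by case: ifPn => // /set_mem /= jn; exact: filt_measurable Hp _ _ (fG jn).
  move=> w [j /= jm [[nj _] _]] st; apply: nj; apply: st; exact: dt.
have cv1 : P (Some y) (~` dstay d X y r2 0 t m) @[m --> \oo] -->
    P (Some y) (~` stay d X y r2 0 t).
  rewrite (stay_dstay Hs Hp) ?lexx ?ltW// setC_bigcap.
  apply: nondecreasing_cvg_mu.
  - by move=> m; exact: measurableC.
  - by apply: bigcupT_measurable => m; exact: measurableC.
  - apply/nondecreasing_seqP => m; apply/subsetPset; apply: subsetC.
    by apply: dstay_decr; exact: ltW.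
have cv2 : P (Some y) (U n) @[n --> \oo] --> P (Some y) O'.
  apply: nonincreasing_cvg_mu.
  - by rewrite (le_lt_trans (probability_le1 _ _))// ?ltry//; exact: mO'.
  - exact: mO'.
  - exact: bigcapT_measurable.
  - move=> n m nm; apply/subsetPset => w [k /= mk Ok]; exists k => //=.
    exact: leq_trans mk.
have le1 n : P (Some y) (~` stay d X y r2 0 t) <=
    (1 - c)%:E * P (Some y) (~` stay d X y rho 0 t) + P (Some y) (U n).
  rewrite -(cvg_lim _ cv1)//; apply: lime_le; first by apply/cvg_ex; eexists; exact: cv1.
  exists n => // m /= nm; apply: le_trans (step m) _; rewrite leeD2l//.
  by apply: le_measure; rewrite ?inE; [exact: mO|exact: mO'|move=> w Om; exists m].
apply: (@le_trans _ _ ((1 - c)%:E * P (Some y) (~` stay d X y rho 0 t) + P (Some y) O')); last first.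
  by rewrite leeD2l.
have cv3 : (1 - c)%:E * P (Some y) (~` stay d X y rho 0 t) + P (Some y) (U n)
   @[n --> \oo] --> (1 - c)%:E * P (Some y) (~` stay d X y rho 0 t) + P (Some y) O'.
  apply: cvgeD => //; last exact: cvg_cst.
  by rewrite ge0_adde_def// inE// mule_ge0.
rewrite -(cvg_lim _ cv3)//; apply: lime_ge; first by apply/cvg_ex; eexists; exact: cv3.
by apply: nearW.
Qed.

End big_jump.

(** Iterates [stay_step] over the radii [2 k b]: the recursion [q' <= (1 - c) q + t eta] starting
    from [1] gives at most [(1 - c)^m] plus [m] jump terms. *)
Lemma stay_tail y b t eta c m : (0 < b)%R -> (0 < t)%R -> (0 <= eta)%R ->
  (0 < c)%R -> (c <= 1)%R ->
  (forall z s, (0 <= s)%R -> c%:E <= P (Some z) (alive X s)) ->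
  (forall z, (d y z <= 2 * m%:R * b)%R -> J_out d J kappa z b <= eta%:E) ->
  (forall z, (d y z <= 2 * m%:R * b)%R -> c%:E <= P (Some z) (stay d X z b 0 t)) ->
  P (Some y) (~` stay d X y (2 * m%:R * b) 0 t) <=
    ((1 - c) ^+ m + m%:R * (t * eta))%:E.
Proof.
move=> b0 t0 eta0 c0 c1 surv HJ Hc.
have mS z r : measurable (stay d X z r 0 t).
  by apply: (filt_measurable Hp (t := t)); apply: (filt_stay Hs Hp); rewrite lexx ltW.
suff : forall k, (k <= m)%N -> P (Some y) (~` stay d X y (2 * k%:R * b) 0 t) <=
    ((1 - c) ^+ k + k%:R * (t * eta))%:E by exact.
elim=> [|k IH] km.
  by rewrite expr0 mul0r addr0; exact: probability_le1 (measurableC _).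
have km' : (k.+1%:R <= m%:R :> R)%R by rewrite ler_nat.
have bk : (2 * k.+1%:R * b = 2 * k%:R * b + b + b)%R by rewrite -natr1; ring.
have bm : (2 * k.+1%:R * b <= 2 * m%:R * b)%R by rewrite ler_pM2r// ler_pM2l.
rewrite bk; apply: le_trans (@stay_step y (2 * k%:R * b)%R b t eta _ b0 t0 eta0 _ c c0 c1 surv _) _.
- by rewrite !mulr_ge0// ltW.
- by move=> z yz; apply: HJ; lra.
- move=> z yz; have zm : (d y z <= 2 * m%:R * b)%R by lra.
  apply: le_trans (Hc z zm) _; apply: le_measure; rewrite ?inE//.
  move=> w H s st; apply: (cballS (r := (d y z + b)%R)); first lra.
  by apply: (cball_tri Hs); exact: H.
apply: (@le_trans _ _ ((1 - c)%:E * ((1 - c) ^+ k + k%:R * (t * eta))%:E + (t * eta)%:E)).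
  by rewrite leeD2r// lee_wpmul2l// ?lee_fin ?subr_ge0// IH// ltnW.
rewrite -EFinM -EFinD lee_fin exprS -natr1.
have te : (0 <= t * eta)%R by rewrite mulr_ge0// ltW.
have : (0 <= c * (k%:R * (t * eta)))%R by rewrite !mulr_ge0// ltW.
by move: ((1 - c) ^+ k)%R => q; lra.
Qed.

End tail.

(** * The law of the iterated logarithm *)

Section asymptotics.
Context {R : realType}.
Local Open Scope ring_scope.

Lemma near_ge_nat (x : R) : \forall n \near \oo, x <= n%:R.
Proof. exact: nbhs_infty_ger. Qed.

Lemma ln2_gt0 : 0 < ln 2 :> R.
Proof. by rewrite ln_gt0// ltr1n. Qed.

Lemma ln_le_self (x : R) : 0 < x -> ln x <= x.
Proof. by move=> /ln_sublinear/ltW. Qed.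

Lemma expR_ge_self (x : R) : x <= expR x.
Proof. by have := expR_ge1Dx x; lra. Qed.

Lemma expR_ge_sqr (x : R) : 0 <= x -> x ^+ 2 / 2 <= expR x.
Proof.
move=> x0; have := @expR_ge1Dxn R x 1 x0; rewrite (_ : 2`! = 2)%N//; lra.
Qed.

Lemma near_loglog_pow2 (V : R) : \forall k \near \oo, V <= ln (ln (2 ^+ k : R)).
Proof.
have l2 := ln2_gt0.
near=> k.
have k2 : expR V <= k%:R * ln 2.
  rewrite -ler_pdivrMr//; near: k; exact: near_ge_nat.
have kV : ln (2 ^+ k : R) = k%:R * ln 2 by rewrite lnXn// mulr_natl.
have k0 : 0 < k%:R * ln 2 :> R by apply: lt_le_trans k2; exact: expR_gt0.
by rewrite kV -[leLHS]expRK ler_ln// posrE ?expR_gt0.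
Unshelve. all: by end_near. Qed.

(** The exponential is [(k ln 2)^-2], and [1/k^2 <= 2 (1/k - 1/(k+1))]. The factor [expR C7] pays
    for rounding the order in (B4) to an integer. *)
Lemma loglog_pow2_telescope (C6 C7 : R) k : 0 <= C6 -> (1 <= k)%N ->
  C6 * (expR C7 * expR (- (2 * ln (ln (2 ^+ k))))) <=
    2 * (C6 * expR C7 / ln 2 ^+ 2) / k%:R - 2 * (C6 * expR C7 / ln 2 ^+ 2) / k.+1%:R.
Proof.
move=> C60 k1; have l2 := ln2_gt0; set cst := 2 * (C6 * expR C7 / ln 2 ^+ 2).
have k0 : 0 < k%:R :> R by rewrite ltr0n.
have cst0 : 0 <= cst.
  by rewrite mulr_ge0// divr_ge0 ?exprn_ge0 ?(ltW l2)// mulr_ge0// expR_ge0.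
have e2 : expR (- (2 * ln (ln (2 ^+ k)))) = ((k%:R * ln 2) ^+ 2)^-1 :> R.
  have lnE : ln (2 ^+ k : R) = k%:R * ln 2 by rewrite lnXn// mulr_natl.
  rewrite lnE expRN (_ : 2 * ln _ = ln (k%:R * ln 2) + ln (k%:R * ln 2)); last by ring.
  by rewrite expRD lnK ?expr2// posrE mulr_gt0.
rewrite e2 (_ : cst / k%:R - _ = cst * (k%:R * k.+1%:R)^-1); last first.
  by rewrite -natr1; field; rewrite (gt_eqF k0) andbT natr1 pnatr_eq0.
rewrite (_ : C6 * _ = cst * (2 * k%:R ^+ 2)^-1); last first.
  by rewrite /cst; field; rewrite (gt_eqF k0) (gt_eqF l2).
rewrite ler_wpM2l// lef_pV2 ?posrE ?mulr_gt0 ?exprn_gt0 ?ltr0n//.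
rewrite expr2 mulrCA ler_pM2l//.
have : 1 <= k%:R :> R by rewrite ler1n.
by rewrite -natr1; lra.
Qed.

Lemma harmonic_lt_eps (c e : R) k0 : 0 <= c -> 0 < e ->
  exists2 n, (k0 <= n)%N & c / n%:R < e.
Proof.
move=> c0 e0.
have [n1 _ Hn] : \forall n \near \oo, c / e + 1 <= n%:R by exact: near_ge_nat.
exists (maxn k0 n1); first exact: leq_maxl.
have := Hn _ (leq_maxr k0 n1); move: (maxn k0 n1) => n /= nn.
have ce : 0 <= c / e by rewrite divr_ge0// ltW.
rewrite ltr_pdivrMr; last by lra.
by rewrite mulrC -ltr_pdivrMr//; lra.
Qed.

Lemma pow2_between (t : R) k0 : 2 ^+ k0 <= t ->
  exists2 k, (k0 <= k)%N & 2 ^+ k <= t < 2 ^+ k.+1.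
Proof.
move=> kt; have t0 : 0 <= t by apply: le_trans kt; rewrite exprn_ge0.
have exN : exists N, t < 2 ^+ N.
  exists (Num.truncn t); have /Num.Theory.truncn_itv/andP[_ h] := t0.
  apply: lt_le_trans h _; rewrite -natrX ler_nat; exact: ltn_expl.
have [N tN minN] := ex_minnP exN.
have k0N : (k0 < N)%N.
  by rewrite -(ltr_eXn2l (_ : 1 < 2 :> R)) ?ltr1n// (le_lt_trans kt).
case: N => [//|N] in tN minN k0N *.
exists N => //; rewrite tN andbT leNgt; apply/negP => /minN.
by rewrite ltnn.
Qed.

Lemma ratio_loglog_ge (t : R) : 0 < t -> 0 < ln (ln t) ->
  ln t / 2 <= t / ln (ln t).
Proof.
move=> t0 ll0.
have lt0 : 0 < ln t.
  rewrite ltNge; apply/negP => lt0.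
  by move: ll0; rewrite (ln0 lt0) ltxx.
have h1 : ln (ln t) <= ln t by exact: ln_le_self.
have h2 : ln t ^+ 2 / 2 <= t.
  by rewrite -[leRHS](@lnK _ t) ?posrE//; apply/expR_ge_sqr/ltW.
rewrite ler_pdivlMr//; apply: le_trans h2.
rewrite (_ : ln t ^+ 2 / 2 = ln t / 2 * ln t); last by field.
by rewrite ler_wpM2l// divr_ge0// ltW.
Qed.

Lemma geometric_lt_eps (q e : R) : 0 <= q < 1 -> 0 < e ->
  exists n1, forall n, (n1 <= n)%N -> q ^+ n < e.
Proof.
move=> /andP[q0 q1] e0.
have : q ^+ n @[n --> \oo] --> (0 : R) by apply: cvg_expr; rewrite ger0_norm.
move=> /cvgrPdist_lt/(_ e e0)[n1 _ Hn1].
by exists n1 => n /Hn1 /=; rewrite sub0r normrN ger0_norm// exprn_ge0.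
Qed.

(** The tail from [n] of the series with terms [(1 - q)^(k+1) + exp (- k)], summed in closed form so
    that its differences are the terms. *)
Definition tele (q : R) (n : nat) : R :=
  (1 - q) ^+ n.+1 / q + expR (- n%:R) / (1 - expR (- 1)).

Lemma expRN1_lt1 : expR (- 1) < 1 :> R.
Proof. by rewrite expR_lt1 oppr_lt0. Qed.

Lemma tele_ge0 q n : 0 < q <= 1 -> 0 <= tele q n.
Proof.
move=> /andP[q0 q1]; have e1 := expRN1_lt1.
apply: addr_ge0; apply: divr_ge0.
- by apply: exprn_ge0; lra.
- exact: ltW.
- exact: expR_ge0.
- by rewrite subr_ge0; exact: ltW.
Qed.

Lemma tele_diff q n : 0 < q ->
  tele q n - tele q n.+1 = (1 - q) ^+ n.+1 + expR (- n%:R).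
Proof.
move=> q0; have e1 := expRN1_lt1.
have eN : expR (- n.+1%:R) = expR (- n%:R) * expR (- 1) :> R.
  by rewrite -natr1 opprD expRD.
rewrite /tele eN [(1 - q) ^+ n.+2]exprSr.
move: (expR (- 1)) e1 (expR _) ((1 - q) ^+ n.+1) => e e1 f h.
by field; rewrite (gt_eqF q0) andbT subr_eq0 gt_eqF.
Qed.

Lemma tele_lt_eps q (e : R) N0 : 0 < q <= 1 -> 0 < e ->
  exists2 n, (N0 <= n)%N & tele q n < e.
Proof.
move=> /andP[q0 q1] e0; have e1 := expRN1_lt1.
have p0 : 0 < 1 - expR (- 1) :> R by rewrite subr_gt0.
have [||n1 Hn1] := @geometric_lt_eps (1 - q) (e * q / 2).
- by apply/andP; split; lra.
- by rewrite divr_gt0// mulr_gt0.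
have [n2 _ Hn2] : \forall n \near \oo, - ln (e * (1 - expR (- 1)) / 4) <= n%:R :> R.
  exact: near_ge_nat.
exists (maxn N0 (maxn n1 n2)); first exact: leq_maxl.
set n := maxn _ _.
have a1 : (n1 <= n.+1)%N by rewrite leqW// /n !leq_max leqnn !orbT.
have a2 : (n2 <= n)%N by rewrite /n !leq_max leqnn !orbT.
have e40 : 0 < e * (1 - expR (- 1)) / 4 by rewrite divr_gt0// mulr_gt0.
have b1 : (1 - q) ^+ n.+1 / q < e / 2.
  by rewrite ltr_pdivrMr// mulrAC; exact: Hn1.
have b2 : expR (- n%:R) / (1 - expR (- 1)) <= e / 4.
  rewrite ler_pdivrMr// mulrAC -[leRHS](@lnK _ _) ?posrE// ler_expR.
  by have := Hn2 n a2; rewrite /=; lra.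
by rewrite /tele; lra.
Qed.

(** With the cube, [tower n / tower n.+1] is below [exp (- 3 n^2)], which beats the factor [D^(n+1)]
    paid for dividing a radius by [2^(n+1)]; a square would beat it only for small [D]. The double
    logarithm is still a multiple of [ln n], so the success probabilities remain harmonic. *)
Definition tower (n : nat) : R := expR (n%:R ^+ 3).

Lemma loglog_tower n : (2 <= n)%N -> ln (ln (tower n)) = 3 * ln n%:R.
Proof. by move=> n2; rewrite expRK lnXn ?ltr0n ?(leq_trans _ n2)// mulr_natl. Qed.

Definition tower_ratio (n : nat) : R := tower n / (3 * ln n%:R).

Lemma ln_nat_gt0 n : (2 <= n)%N -> 0 < ln n%:R :> R.
Proof. by move=> n2; rewrite ln_gt0// ltr1n. Qed.

Lemma ln_nat_le n : ln n%:R <= n%:R :> R.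
Proof.
by case: n => [|n]; [rewrite ln0|rewrite ln_le_self].
Qed.

(** Taking for [D] the doubling constant of [phi] shows that [phi_inv] at [tower_ratio n] is at
    least [2^(n^2)]. *)
Lemma near_tower_ratio_pow (D F : R) : 0 < D -> 0 <= F ->
  \forall n \near \oo, D ^+ (n ^ 2) * F <= tower_ratio n.
Proof.
move=> D0 F0; near=> n.
have n2 : (2 <= n)%N by near: n; exact: nbhs_infty_ge.
have nD : ln D + 1 <= n%:R by near: n; exact: near_ge_nat.
have nF : 3 * F <= n%:R by near: n; exact: near_ge_nat.
have ln0 := ln_nat_gt0 n2.
have n0 : 0 <= n%:R :> R by [].
have lnn : ln n%:R <= n%:R := ln_nat_le n.
rewrite /tower_ratio ler_pdivlMr; last lra.
have -> : D ^+ (n ^ 2) = expR (n%:R ^+ 2 * ln D).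
  by rewrite -natrX expRM_natl lnK.
have h1 : F * (3 * ln n%:R) <= n%:R ^+ 2.
  rewrite expr2 mulrA; apply: ler_pM => //; last by rewrite mulrC.
    by rewrite mulr_ge0.
  exact: ltW.
rewrite -mulrA; apply: (@le_trans _ _ (expR (n%:R ^+ 2 * ln D) * expR (n%:R ^+ 2))).
  by rewrite ler_pM2l ?expR_gt0//; apply: le_trans h1 (expR_ge_self _).
rewrite -expRD ler_expR (_ : _ + _ = n%:R ^+ 2 * (ln D + 1)); last by ring.
by rewrite [leRHS]exprSr ler_wpM2l// exprn_ge0.
Unshelve. all: by end_near. Qed.

Lemma near_tower_ratio_ge (V : R) : \forall n \near \oo, V <= tower_ratio n.
Proof.
have := @near_tower_ratio_pow 1 `|V| ltr01 (normr_ge0 _).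
apply: filterS => n; rewrite expr1n mul1r; apply: le_trans; exact: ler_norm.
Qed.

(** The polynomial factor and [D^(n+1)] are each at most [exp (n^2)] for large [n], whereas the
    exponent of [tower] grows by [3 n^2 + 3 n + 1]; what is left exceeds [n]. *)
Lemma near_tower_step (D B : R) : 0 < D -> 0 <= B -> \forall n \near \oo,
  n.+1%:R * (tower n * (B * (D ^+ n.+1 * (3 * ln n.+1%:R) / tower n.+1))) <=
  expR (- n%:R).
Proof.
move=> D0 B0; near=> n.
have n1 : 1 <= n%:R :> R by near: n; exact: near_ge_nat.
have nD : 2 * ln D <= n%:R by near: n; exact: near_ge_nat.
have nB : 24 * B <= n%:R by near: n; exact: near_ge_nat.
have lnn := ln_nat_le n.+1.
rewrite -(ler_pM2r (expR_gt0 (n.+1%:R ^+ 3))).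
rewrite (_ : _ * expR (n.+1%:R ^+ 3) = n.+1%:R * B * (3 * ln n.+1%:R) *
   (tower n * D ^+ n.+1)); last first.
  by rewrite /tower; field; rewrite gt_eqF// expR_gt0.
have -> : D ^+ n.+1 = expR (n.+1%:R * ln D) by rewrite expRM_natl lnK.
have n1n : n.+1%:R <= 2 * n%:R :> R by rewrite -natr1; lra.
have n10 : 0 <= n.+1%:R :> R by [].
have h1 : n.+1%:R * B * (3 * ln n.+1%:R) <= expR (n%:R ^+ 2).
  apply: (@le_trans _ _ (12 * B * n%:R ^+ 2)).
    apply: (@le_trans _ _ (n.+1%:R * B * (3 * n.+1%:R))).
      by rewrite ler_wpM2l ?mulr_ge0// ler_pM2l.
    rewrite (_ : _ * _ = 3 * B * (n.+1%:R * n.+1%:R)); last by ring.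
    rewrite (_ : 12 * B * _ = 3 * B * (2 * n%:R * (2 * n%:R))); last by ring.
    by rewrite ler_wpM2l ?mulr_ge0// ler_pM.
  have h := @expR_ge_sqr (n%:R ^+ 2) (sqr_ge0 _).
  apply: le_trans h; rewrite (_ : _ / 2 = n%:R ^+ 2 / 2 * n%:R ^+ 2); last by field.
  rewrite ler_wpM2r ?exprn_ge0//.
  have : n%:R <= n%:R ^+ 2 :> R by rewrite expr2 ler_peMl.
  lra.
have h2 : n.+1%:R * ln D <= n%:R ^+ 2.
  have [lD|lD] := leP (ln D) 0.
    by apply: (@le_trans _ _ 0); [rewrite mulr_ge0_le0|exact: sqr_ge0].
  apply: (@le_trans _ _ (2 * n%:R * ln D)); first by rewrite ler_wpM2r// ltW.
  by rewrite mulrAC expr2 ler_wpM2r.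
apply: (@le_trans _ _ (expR (n%:R ^+ 2) * (tower n * expR (n%:R ^+ 2)))).
  apply: ler_pM => //.
  - by rewrite !mulr_ge0// ln_ge0// ler1n.
  - by rewrite mulr_ge0// expR_ge0.
  - by rewrite ler_pM2l ?expR_gt0// ler_expR.
rewrite /tower -!expRD ler_expR -natr1.
move: (n%:R : R) n1 => x x1.
have x2 : 0 <= x ^+ 2 by exact: sqr_ge0.
rewrite (_ : (x + 1) ^+ 3 = x ^+ 3 + 3 * x ^+ 2 + 3 * x + 1); last by ring.
lra.
Unshelve. all: by end_near. Qed.

(** For [r >= 2^(n^2)] the factor [r^(1 - ups)] outgrows [2^n] and all constants. Thus (B3) and (B4)
    apply at scale [r / 2^n] throughout a ball of radius [r]. *)
Lemma near_large_radius (a Rinf ups : R) : 1 <= Rinf -> 0 < ups < 1 ->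
  \forall n \near \oo, forall r, 2 ^+ (n ^ 2) <= r ->
    Rinf * (a + r + 1) `^ ups < r / 2 ^+ n.
Proof.
move=> R1 /andP[u0 u1]; have l2 := ln2_gt0.
have lR : 0 <= ln Rinf by rewrite ln_ge0.
near=> n => r nr.
have n1 : 1 <= n%:R :> R by near: n; exact: near_ge_nat.
have na : `|a| + 1 <= n%:R by near: n; exact: near_ge_nat.
have nu : (3 + ln Rinf / ln 2) / (1 - ups) <= n%:R by near: n; exact: near_ge_nat.
have r0 : 0 < r by apply: lt_le_trans nr; rewrite exprn_gt0.
have nn : n%:R <= r.
  apply: le_trans nr; rewrite -natrX ler_nat; apply: leq_trans (ltnW (@ltn_expl 2 n isT)) _.
  by rewrite leq_exp2l// -mulnn; case: (n) => // m; rewrite leq_pmulr.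
have aR : a + r + 1 <= 2 * r by have := ler_norm a; lra.
rewrite ltr_pdivlMr ?exprn_gt0//.
have [ar|ar] := leP (a + r + 1) 0.
  have [->|ne] := eqVneq (a + r + 1) 0; first by rewrite powR0 ?gt_eqF// mulr0 mul0r.
  by have := ler_norm (- a); rewrite normrN; lra.
have lr : n%:R ^+ 2 * ln 2 <= ln r.
  by rewrite -natrX mulr_natl -lnXn// ler_ln// posrE// exprn_gt0.
apply: (@le_lt_trans _ _ (expR (ln Rinf) * expR (ups * (ln 2 + ln r)) * expR (n%:R * ln 2))).
  rewrite (@lnK _ Rinf) ?posrE ?(lt_le_trans _ R1)// expRM_natl lnK ?posrE//.
  rewrite ler_wpM2r ?exprn_ge0// ler_wpM2l ?(le_trans _ R1)//.
  rewrite -(lnM _ _) ?posrE// -ln_powR lnK ?posrE ?powR_gt0 ?mulr_gt0//.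
  by apply: ge0_ler_powR; rewrite ?nnegrE ?(ltW u0) ?(ltW ar)// ltW// mulr_gt0.
rewrite -!expRD -[ltRHS](@lnK _ r) ?posrE// ltr_expR.
move: nu; rewrite ler_pdivrMr; last lra.
rewrite -(ler_pM2r l2) mulrDl divfK ?gt_eqF// => nu.
have h1 : n%:R * (3 * ln 2 + ln Rinf) <= n%:R * (n%:R * (1 - ups) * ln 2).
  by rewrite ler_wpM2l.
have h2 : (1 - ups) * (n%:R ^+ 2 * ln 2) <= (1 - ups) * ln r.
  by rewrite ler_wpM2l//; lra.
have h3 : ln Rinf <= n%:R * ln Rinf by rewrite ler_peMl.
have h4 : ln 2 <= n%:R * ln 2 :> R by rewrite ler_peMl// ltW.
have h5 : ups * ln 2 < ln 2 :> R by rewrite -[ltRHS]mul1r ltr_pM2r.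
move: h2; rewrite (_ : (1 - ups) * (n%:R ^+ 2 * ln 2) = n%:R * (n%:R * (1 - ups) * ln 2)); last by ring.
lra.
Unshelve. all: by end_near. Qed.

End asymptotics.

Section borel_cantelli.
Context {dT : measure_display} {T : measurableType dT} {R : realType}
  (mu : {measure set T -> \bar R}).

(** With a telescoping majorant, the union of all [A n] with [n >= N] has measure at most [u N], and
    no infinite series has to be summed. *)
Lemma borel_cantelli_telescope (A : nat -> set T) (u : nat -> R) N0 :
  (forall n, measurable (A n)) -> (forall n, (0 <= u n)%R) ->
  (forall n, (N0 <= n)%N -> mu (A n) <= (u n - u n.+1)%:E) ->
  (forall e : R, (0 < e)%R -> exists2 n, (N0 <= n)%N & (u n < e)%R) ->
  mu.-negligible [set w | forall N, exists2 n, (N <= n)%N & A n w].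
Proof.
move=> mA u0 Au ucv.
pose B N m := \bigcup_(n in [set n | (N <= n < N + m)%N]) A n.
have mB N m : measurable (B N m).
  by rewrite /B bigcup_mkcond; apply: bigcupT_measurable => n; case: ifPn.
have BS N m : B N m.+1 = B N m `|` A (N + m)%N.
  apply/seteqP; split => w.
    move=> [n /= /andP[Nn]]; rewrite addnS ltnS leq_eqVlt => /predU1P[->|nm] An.
      by right.
    by left; exists n => //=; rewrite Nn.
  move=> [[n /= /andP[Nn nm] An]|Am].
    by exists n => //=; rewrite Nn addnS ltnS ltnW.
  by exists (N + m)%N => //=; rewrite leq_addr addnS leqnn.
have Bu N m : (N0 <= N)%N -> mu (B N m) <= (u N - u (N + m)%N)%:E.
  move=> N0N; elim: m => [|m IH].
    rewrite addn0 subrr (_ : B N 0%N = set0) ?measure0//.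
    by apply/seteqP; split=> // w [n /= /andP[Nn]]; rewrite addn0 ltnNge Nn.
  rewrite BS; apply: le_trans (measureU2 _ (mB N m) (mA _)) _.
  apply: le_trans (leeD IH (Au (N + m)%N (leq_trans N0N (leq_addr _ _)))) _.
  by rewrite -EFinD lee_fin addnS; lra.
pose U N := \bigcup_(n in [set n | (N <= n)%N]) A n.
have mU N : measurable (U N).
  by rewrite /U bigcup_mkcond; apply: bigcupT_measurable => n; case: ifPn.
have UB N : U N = \bigcup_m B N m.
  apply/seteqP; split => w.
    move=> [n /= Nn An]; exists (n - N).+1 => //; exists n => //=.
    by rewrite Nn/= addnS ltnS subnKC// leqnn.
  by move=> [m _ [n /= /andP[Nn _] An]]; exists n.
have Uu N : (N0 <= N)%N -> mu (U N) <= (u N)%:E.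
  move=> N0N.
  have cv : mu (B N m) @[m --> \oo] --> mu (U N).
    rewrite UB; apply: nondecreasing_cvg_mu => //.
      by rewrite -UB.
    apply/nondecreasing_seqP => m; apply/subsetPset; rewrite BS; exact: subsetUl.
  rewrite -(cvg_lim _ cv)//; apply: lime_le; first by apply/cvg_ex; eexists; exact: cv.
  apply: nearW => m; apply: le_trans (Bu N m N0N) _.
  by rewrite lee_fin lerBlDr lerDl.
exists (\bigcap_N U N); split; first exact: bigcapT_measurable.
  apply/eqP; rewrite eq_le measure_ge0 andbT; apply/lee_addgt0Pr => e e0.
  rewrite add0e; have [n N0n un] := ucv e e0.
  apply: (@le_trans _ _ (mu (U n))).
    by apply: le_measure; rewrite ?inE//; [exact: bigcapT_measurable|exact: bigcap_inf].
  by apply: le_trans (Uu n N0n) _; rewrite lee_fin ltW.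
by move=> w H N _; have [n Nn An] := H N; exists n.
Qed.

End borel_cantelli.

Section sup_dist.
Context {R : realType} {dM : measure_display} {M : measurableType dM}
  {d : M -> M -> R} {dO : measure_display} {Omega : measurableType dO}
  {X : R -> Omega -> option M}.
Hypothesis (Hs : standing_space d).

Lemma sup_dist_ge x y r s t w : (0 < s <= t)%R -> ~ cball d y r (X s w) ->
  (r - d x y)%:E <= sup_dist d X x t w.
Proof.
move=> st nc; apply: (@le_trans _ _ (dist_p d x (X s w))).
  case: (X s w) nc => [z|] /=; last by rewrite leey.
  move=> /negP; rewrite -ltNge lee_fin => rz.
  by have := d_tri Hs y x z; rewrite (d_sym Hs y x); lra.
by apply: ereal_sup_ubound; exists s.
Qed.

Lemma sup_dist_le x y r t w :
  (forall s, (0 < s <= t)%R -> cball d y r (X s w)) ->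
  sup_dist d X x t w <= (d x y + r)%:E.
Proof.
move=> H; apply: ge_ereal_sup => _ [s /H + <-].
case: (X s w) => //= z yz; rewrite lee_fin.
by have := d_tri Hs x y z; lra.
Qed.

End sup_dist.

(** * Consequences of (B1)-(B4) in terms of [phi] *)

Section scale.
Context {R : realType} {dM : measure_display} {M : measurableType dM}
  {d : M -> M -> R} {dO : measure_display} {Omega : measurableType dO}
  {P : option M -> probability Omega R} {X : R -> Omega -> option M}
  {filt : R -> set (set Omega)}
  {J : M -> {measure set M -> \bar R}} {kappa : M -> \bar R}
  {o : M} {Rinf ups ell C1 C2 C3 C4 C5 C6 C7 : R} {phi : R -> R} {K : R}.
Hypotheses (Hs : standing_space d) (Hp : standard_data d P X filt)
  (Hl : levy_system d P X J kappa)
  (Hb : conditions_B d P X J kappa o Rinf ups ell C1 C2 C3 C4 C5 C6 C7)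
  (phi_gt0 : forall r, (0 < r)%R -> (0 < phi r)%R)
  (phi_nd : forall r s, (0 < r <= s)%R -> (phi r <= phi s)%R)
  (K1 : (1 <= K)%R)
  (phiK : forall x r, large_r d o Rinf ups x r ->
     (K^-1)%:E * Etau d P X x r <= (phi r)%:E /\
     (phi r)%:E <= K%:E * Etau d P X x r).

Let K0 : (0 < K)%R. Proof. exact: lt_le_trans K1. Qed.
Let Rinf1 : (1 <= Rinf)%R. Proof. by case: Hb => -[]. Qed.
Let C4_gt0 : (0 < C4)%R. Proof. by case: Hb => _ []. Qed.
Let C3_gt0 : (0 < C3)%R. Proof. by case: Hb => _ []. Qed.
Let C2_gt0 : (0 < C2)%R. Proof. by case: Hb => _ []. Qed.

Lemma large_r_gt0 x r : large_r d o Rinf ups x r -> (0 < r)%R.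
Proof.
by apply: le_lt_trans; rewrite mulr_ge0 ?powR_ge0// (le_trans _ Rinf1).
Qed.

Lemma large_r_base r : (Rinf < r)%R -> large_r d o Rinf ups o r.
Proof. by rewrite /large_r (d_refl Hs) add0r powR1 mulr1. Qed.

(** The mean exit time is finite and positive because it is squeezed between multiples of the real
    number [phi r > 0]. *)
Lemma mean_exit_time x r : large_r d o Rinf ups x r ->
  exists e : R, [/\ Etau d P X x r = e%:E, (0 < e)%R, (e <= K * phi r)%R &
    (phi r <= K * e)%R].
Proof.
move=> xr; have [h1 h2] := phiK xr; have r0 := large_r_gt0 xr.
have Ki : (0 < K^-1)%R by rewrite invr_gt0.
case E : (Etau d P X x r) h1 h2 => [e| |]; last 2 first.
- by rewrite gt0_muley ?lte_fin.
- by rewrite gt0_muleNy ?lte_fin// => _; rewrite gt0_muleNy ?lte_fin.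
rewrite -!EFinM !lee_fin => h1 h2; exists e; split=> //.
  by have := lt_le_trans (phi_gt0 r0) h2; rewrite pmulr_rgt0.
by rewrite -ler_pdivrMl.
Qed.

Lemma P_start x A : measurable A ->
  P (Some x) A = P (Some x) (A `&` [set w | X 0%R w = Some x]).
Proof.
move=> mA; have m0 := measurable_start Hs Hp x.
apply/eqP; rewrite eq_le; apply/andP; split; last first.
  by apply: le_measure; rewrite ?inE//; (exact: measurableI || exact: subIsetl).
have mN : measurable (~` [set w | X 0%R w = Some x]) by exact: measurableC.
apply: (@le_trans _ _ (P (Some x) ((A `&` [set w | X 0%R w = Some x]) `|`
    ~` [set w | X 0%R w = Some x]))).
  apply: le_measure; rewrite ?inE//; first by apply: measurableU => //; exact: measurableI.
  move=> w Aw; have [h|h] := pselect (X 0%R w = Some x); [by left|by right].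
rewrite measureU0//; first exact: measurableI.
exact: start_null Hs Hp x.
Qed.

Lemma measurable_stay x r a b : (0 <= a <= b)%R -> measurable (stay d X x r a b).
Proof. by move=> ab; apply: (filt_measurable Hp (t := b)); exact: (filt_stay Hs Hp). Qed.

(** The strict inequality on [t] puts [[0, t]] strictly before [n] mean exit times. Exit times
    ignore time [0], where one uses that the path almost surely starts at [x]. *)
Lemma P_stay_ge x r (n : nat) t : large_r d o Rinf ups x r -> (1 <= n)%N ->
  (0 <= t)%R -> (K * t < n%:R * phi r)%R ->
  (C4 * expR (- C5 * n%:R))%:E <= P (Some x) (stay d X x r 0 t).
Proof.
move=> xr n1 t0 tn; have [e [Ee e0 e1 e2]] := mean_exit_time xr.
have [_ _ _ [_ _ _ /(_ x r n xr n1)[h _]]] := Hb.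
apply: le_trans h _; rewrite Ee -EFinM.
have mA := measurable_exit_ge Hs Hp x r (n%:R * e)%R.
rewrite P_start//; apply: le_measure; rewrite ?inE.
- by apply: measurableI => //; exact: measurable_start Hs Hp x.
- by apply: measurable_stay; rewrite lexx.
move=> w [/exit_geP H X0] s /andP[]; rewrite le_eqVlt => /predU1P[<- _|s0 st].
  by rewrite X0 /= (d_refl Hs); apply/ltW/(large_r_gt0 xr).
have : in_ball (d := d) x r (X s w).
  apply: H; rewrite s0/=; apply: le_lt_trans st _.
  rewrite -(ltr_pM2l K0); apply: lt_le_trans tn _.
  by rewrite mulrCA ler_wpM2l.
by case: (X s w) => //= z; exact: ltW.
Qed.

Lemma P_stay_le x r r' (n : nat) t : large_r d o Rinf ups x r -> (1 <= n)%N ->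
  (r' < r)%R -> (n%:R * (K * phi r) <= t)%R ->
  P (Some x) (stay d X x r' 0 t) <= (C6 * expR (- C7 * n%:R))%:E.
Proof.
move=> xr n1 r'r tn; have [e [Ee e0 e1 e2]] := mean_exit_time xr.
have [_ _ _ [_ _ _ /(_ x r n xr n1)[_ h]]] := Hb.
apply: le_trans h; rewrite Ee -EFinM.
have mA := measurable_exit_ge Hs Hp x r (n%:R * e)%R.
have net : (n%:R * e <= t)%R by apply: le_trans tn; rewrite ler_wpM2l.
apply: le_measure; rewrite ?inE//.
  by apply: measurable_stay; rewrite lexx (le_trans _ net)// mulr_ge0// ltW.
move=> w H; apply/exit_geP => s /andP[s0 sn]; apply: (cball_in_ball r'r).
by apply: H; rewrite ltW//= (le_trans (ltW sn)).
Qed.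

Definition c_surv : R := (C4 * expR (- C5))%R.

Lemma c_surv_gt0 : (0 < c_surv)%R.
Proof. by rewrite mulr_gt0// expR_gt0. Qed.

Lemma P_stay_ge1 x r t : large_r d o Rinf ups x r -> (0 <= t)%R ->
  (K * t < phi r)%R -> c_surv%:E <= P (Some x) (stay d X x r 0 t).
Proof.
move=> xr t0 tr; have := @P_stay_ge x r 1 t xr isT t0.
by rewrite mulr1 mul1r; apply.
Qed.

Lemma c_surv_le1 : (c_surv <= 1)%R.
Proof.
have oR : large_r d o Rinf ups o (Rinf + 1) by apply: large_r_base; lra.
rewrite -lee_fin; apply: le_trans (@P_stay_ge1 o (Rinf + 1)%R 0%R oR (lexx _) _) _.
  by rewrite mulr0; apply: phi_gt0; exact: large_r_gt0 oR.
by apply: probability_le1; apply: measurable_stay; rewrite lexx.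
Qed.

Definition dbl : R := (K * (C2 * K))%R.

Lemma dbl_gt0 : (0 < dbl)%R.
Proof. by rewrite !mulr_gt0. Qed.

Lemma phi_double s : (Rinf < s)%R -> (phi (2 * s) <= dbl * phi s)%R.
Proof.
move=> sR; have R1 := Rinf1; have s2R : (Rinf < 2 * s)%R by lra.
have [e [Ee e0 e1 e2]] := mean_exit_time (large_r_base sR).
have [e' [Ee' e'0 e'1 e'2]] := mean_exit_time (large_r_base s2R).
have [_ _ _ [_ /(_ _ s2R)[_ h] _ _]] := Hb.
move: h; rewrite (_ : 2 * s / 2 = s)%R; last by field.
rewrite Ee Ee' -EFinM lee_fin => h.
apply: (le_trans e'2); rewrite /dbl -mulrA ler_wpM2l ?(ltW K0)//.
by apply: (le_trans h); rewrite -mulrA ler_wpM2l ?(ltW C2_gt0).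
Qed.

Lemma phi_double_iter n s : (Rinf < s)%R -> (phi (2 ^+ n * s) <= dbl ^+ n * phi s)%R.
Proof.
move=> sR; elim: n => [|n IH]; first by rewrite !expr0 !mul1r.
have sn : (Rinf < 2 ^+ n * s)%R.
  apply: (lt_le_trans sR); rewrite ler_peMl ?exprn_ege1 ?ler1n//.
  by rewrite (le_trans _ (ltW sR))// (le_trans _ Rinf1).
rewrite exprS -mulrA; apply: le_trans (phi_double sn) _.
by rewrite exprS -mulrA ler_wpM2l// ltW// dbl_gt0.
Qed.

(** By the first half of (B2), multiplying the radius by [ell] at least doubles the mean exit
    time. *)
Lemma phi_growth (A : R) : exists2 lam : R, (1 <= lam)%R &
  forall s, (Rinf < s)%R -> (A * phi s <= phi (lam * s))%R.
Proof.
have ell1 : (1 < ell)%R by case: Hb => -[].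
have ell0 : (0 < ell)%R by apply: lt_trans ell1.
pose e r := fine (Etau d P X o r).
have eP s : (Rinf < s)%R -> [/\ Etau d P X o s = (e s)%:E, (0 < e s)%R,
    (e s <= K * phi s)%R & (phi s <= K * e s)%R].
  by move=> /large_r_base/mean_exit_time[e' [Ee]]; rewrite /e Ee.
have lexp j s : (Rinf < s)%R -> (Rinf < ell ^+ j * s)%R.
  move=> sR; apply: (lt_le_trans sR); rewrite ler_peMl ?exprn_ege1 ?(ltW ell1)//.
  by rewrite (le_trans _ (ltW sR))// (le_trans _ Rinf1).
have grow j s : (Rinf < s)%R -> (2 ^+ j * e s <= e (ell ^+ j * s))%R.
  move=> sR; elim: j => [|j IH]; first by rewrite !expr0 !mul1r.
  have [Ej _ _ _] := eP _ (lexp j s sR).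
  have [Ej' _ _ _] := eP _ (lexp j.+1 s sR).
  have [_ _ _ [_ /(_ _ (lexp j.+1 s sR))[h _] _ _]] := Hb.
  move: h; rewrite Ej' (_ : ell ^+ j.+1 * s / ell = ell ^+ j * s)%R; last first.
    by rewrite exprS; field; rewrite gt_eqF.
  rewrite Ej -EFinM lee_fin; apply: le_trans.
  by rewrite exprS -mulrA ler_wpM2l.
have A0 : (0 <= `|A| * K ^+ 2)%R by rewrite mulr_ge0// exprn_ge0// ltW.
(* One factor [K] is lost in passing from [phi] to mean exit times and one on the way back, hence
   [K ^+ 2]. *)
pose j := Num.truncn (`|A| * K ^+ 2).
have jA : (`|A| * K ^+ 2 <= 2 ^+ j)%R.
  have /Num.Theory.truncn_itv/andP[_ h] := A0.
  by apply: le_trans (pow2_ge j); exact: ltW.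
exists (ell ^+ j)%R; first by rewrite exprn_ege1// ltW.
move=> s sR; have s0 : (0 < s)%R by apply: lt_trans sR; apply: lt_le_trans Rinf1.
have [_ e0 _ e2] := eP s sR; have [_ _ e3 _] := eP _ (lexp j s sR).
apply: (@le_trans _ _ (`|A| * phi s)%R).
  by rewrite ler_wpM2r ?ler_norm// ltW// phi_gt0.
rewrite -(ler_pM2l K0); apply: le_trans e3; apply: le_trans (grow j s sR).
apply: (@le_trans _ _ (`|A| * K ^+ 2 * e s)%R); last by rewrite ler_wpM2r// ltW.
rewrite (_ : `|A| * K ^+ 2 * e s = K * (`|A| * (K * e s)))%R; last by rewrite expr2; ring.
by rewrite ler_wpM2l ?(ltW K0)// ler_wpM2l.
Qed.

Lemma phi_unbounded V : exists2 r, (Rinf < r)%R & (V < phi r)%R.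
Proof.
have R1 : (Rinf < Rinf + 1)%R by lra.
have p0 : (0 < phi (Rinf + 1))%R by apply: phi_gt0; apply: lt_trans R1; apply: lt_le_trans Rinf1.
have [lam lam1 H] := phi_growth ((`|V| + 1) / phi (Rinf + 1))%R.
exists (lam * (Rinf + 1))%R.
  apply: (lt_le_trans R1); rewrite ler_peMl//.
  by apply: ltW; apply: lt_trans R1; apply: lt_le_trans Rinf1.
apply: lt_le_trans (H _ R1); rewrite divfK ?gt_eqF//.
by rewrite (le_lt_trans (ler_norm _))// ltrDl.
Qed.

(** A path inside a ball is alive. Since [phi] is unbounded, for any [z] and [t] some ball is so
    large that (B4) with [n = 1] covers [[0, t]], and the constant depends on neither. *)
Lemma survival z t : (0 <= t)%R -> c_surv%:E <= P (Some z) (alive X t).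
Proof.
move=> t0; have [r0 r0R Vr0] := phi_unbounded (K * t)%R.
pose r := (Num.max r0 (Rinf * (d z o + 1) `^ ups + 1))%R.
have zr : large_r d o Rinf ups z r.
  by rewrite /large_r /r lt_max; apply/orP; right; rewrite ltrDl.
have tr : (K * t < phi r)%R.
  apply: (lt_le_trans Vr0); apply: phi_nd; rewrite /r le_max lexx andbT.
  by apply: lt_trans r0R; apply: lt_le_trans Rinf1.
apply: le_trans (P_stay_ge1 zr t0 tr) _; apply: le_measure; rewrite ?inE.
- by apply: measurable_stay; rewrite lexx.
- exact: filt_measurable Hp _ _ (filt_alive Hp t0).
move=> w /(_ t); rewrite t0 lexx => /(_ isT).
by rewrite /alive /=; case: (X t w).
Qed.

Lemma J_out_le z b : large_r d o Rinf ups z b ->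
  J_out d J kappa z b <= (C3 * K / phi b)%:E.
Proof.
move=> zb; have [e [Ee e0 e1 e2]] := mean_exit_time zb.
have [_ _ _ [_ _ /(_ _ _ zb) + _]] := Hb; rewrite Ee.
move=> /le_trans; apply; rewrite inver gt_eqF// -EFinM lee_fin -mulrA.
rewrite ler_wpM2l ?(ltW C3_gt0)// ler_pdivlMr; last by apply: phi_gt0; exact: large_r_gt0 zb.
by rewrite mulrC ler_pdivrMr.
Qed.

Lemma P_exit_le y b t m : (0 < b)%R -> (0 < t)%R -> (K * t < phi b)%R ->
  (forall z, (d y z <= 2 * m%:R * b)%R -> large_r d o Rinf ups z b) ->
  P (Some y) (~` stay d X y (2 * m%:R * b) 0 t) <=
    ((1 - c_surv) ^+ m + m%:R * (t * (C3 * K / phi b)))%:E.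
Proof.
move=> b0 t0 tb H; apply: (stay_tail Hs Hp Hl) => //.
- by rewrite divr_ge0 ?mulr_ge0 ?ltW// phi_gt0.
- exact: c_surv_gt0.
- exact: c_surv_le1.
- exact: survival.
- by move=> z /H; exact: J_out_le.
- by move=> z /H zb; apply: P_stay_ge1 => //; exact: ltW.
Qed.

Lemma phi_inv_ge r v : (0 < r)%R -> (phi r <= v)%R -> r%:E <= phi_inv phi v.
Proof. by move=> r0 rv; apply: ereal_sup_ubound; exists r. Qed.

Lemma phi_inv_le r v : (0 < r)%R -> (v < phi r)%R -> phi_inv phi v <= r%:E.
Proof.
move=> r0 vr; apply: ge_ereal_sup => _ [s [s0 sv] <-]; rewrite lee_fin leNgt.
apply/negP => rs; have : (phi r <= phi s)%R by apply: phi_nd; rewrite r0 ltW.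
by rewrite leNgt (le_lt_trans sv).
Qed.

(** [phi] may jump at [g], so nothing is claimed about [phi g] itself. The assumption on [v] places
    [g] beyond [Rinf], where growth and doubling are available. *)
Lemma phi_inv_fin v : (phi (Rinf + 1) <= v)%R -> exists g : R,
  [/\ phi_inv phi v = g%:E, (Rinf + 1 <= g)%R,
      forall r, (0 < r < g)%R -> (phi r <= v)%R &
      forall r, (g < r)%R -> (v < phi r)%R].
Proof.
move=> Rv; have R0 : (0 < Rinf + 1)%R by have R1 := Rinf1; lra.
have h1 := phi_inv_ge R0 Rv.
have [r0 r0R Vr0] := phi_unbounded v.
have r00 : (0 < r0)%R by apply: lt_trans r0R; apply: lt_le_trans Rinf1.
have h2 := phi_inv_le r00 Vr0.
case E : (phi_inv phi v) h1 h2 => [g| |] h1 h2; last 2 first.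
- by move: h2; rewrite leye_eq.
- by move: h1; rewrite leeNy_eq.
move: h1 h2.
rewrite !lee_fin => h1 h2; exists g; split=> // r.
  move=> /andP[r1 rg].
  have : r%:E < phi_inv phi v by rewrite E lte_fin.
  move=> /ereal_sup_gt[_ [s [s0 sv] <-]]; rewrite lte_fin => rs.
  by apply: le_trans sv; apply: phi_nd; rewrite r1 ltW.
move=> gr; rewrite ltNge; apply/negP => rv.
have : (r <= g)%R.
  rewrite -lee_fin -E; apply: phi_inv_ge => //.
  by apply: lt_trans gr; exact: lt_le_trans h1.
by rewrite leNgt gr.
Qed.

(** * The lower bound *)

Let C5_gt0 : (0 < C5)%R. Proof. by case: Hb => _ []. Qed.
Let C6_gt0 : (0 < C6)%R. Proof. by case: Hb => _ _ []. Qed.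
Let C7_gt0 : (0 < C7)%R. Proof. by case: Hb => _ _ []. Qed.

(** (B4) is used with [n] the integer part of [2 L / C7], so that [C7 n >= 2 L - C7]. The dilation
    [lam] makes [phi] at [g / (2 lam)] so small that [n] mean exit times fit into [[0, t]]. The
    inner radius [g / (4 lam)] puts a closed ball inside the open one. *)
Lemma P_stay_loglog_le y (lam L g t : R) : (0 < lam)%R ->
  (forall s, (Rinf < s)%R -> (2 * K * (2 / C7) * phi s <= phi (lam * s))%R) ->
  (0 < L)%R -> (1 <= 2 / C7 * L)%R -> (0 < g)%R -> (phi (g / 2) <= 2 * t / L)%R ->
  (Rinf < g / (2 * lam))%R -> large_r d o Rinf ups y (g / (2 * lam)) ->
  P (Some y) (stay d X y (g / (4 * lam)) 0 t) <=
    (C6 * (expR C7 * expR (- (2 * L))))%:E.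
Proof.
move=> lam0 Hlam L0 qL g0 pg rR yr.
have pr : (0 < phi (g / (2 * lam)))%R by apply: phi_gt0; exact: large_r_gt0 yr.
set r := (g / (2 * lam))%R in rR yr pr *; pose q := (2 / C7)%R.
pose n := Num.truncn (q * L).
have n1 : (1 <= n)%N by rewrite /n Num.Theory.truncn_gt0.
have /Num.Theory.truncn_itv/andP[n2 n3] : (0 <= q * L)%R by apply: le_trans qL.
apply: le_trans (P_stay_le yr n1 (r' := (g / (4 * lam))%R) _ _) _.
- by rewrite /r ltr_pM2l// ltf_pV2 ?posrE ?mulr_gt0// ltr_pM2r// ltr_nat.
- have := Hlam _ rR; rewrite (_ : lam * r = g / 2)%R; last first.
    by rewrite /r; field; rewrite gt_eqF.
  move=> /le_trans/(_ pg) h.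
  apply: (@le_trans _ _ (q * L * (K * phi r))%R).
    by rewrite ler_wpM2r// mulr_ge0 ?(ltW K0)// ltW.
  rewrite -(@ler_pM2l _ 2)//; move: h; rewrite ler_pdivlMr// -/q.
  by rewrite (_ : 2 * K * q * phi r * L = 2 * (q * L * (K * phi r)))%R//; ring.
rewrite lee_fin ler_wpM2l ?(ltW C6_gt0)// -expRD ler_expR.
have : (C7 * (q * L) <= C7 * n.+1%:R)%R by rewrite ler_pM2l// ltW.
rewrite (_ : C7 * (q * L) = 2 * L)%R; last by rewrite /q; field; rewrite gt_eqF.
by rewrite -[n.+1%:R]natr1 mulrDr mulr1 mulNr; move: (C7 * _)%R => z; lra.
Qed.

Lemma liminf_lower : exists2 b : R, (0 < b)%R & forall x y : M,
  (P (Some y)).-negligible [set w | ~ (exists T : R, forall t, (T < t)%R ->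
     b%:E <= sup_dist d X x t w / phi_inv phi (t / ln (ln t))%R)].
Proof.
pose q : R := (2 / C7)%R.
have q0 : (0 < q)%R by rewrite divr_gt0.
have [lam lam1 Hlam] := phi_growth (2 * K * q).
have lam0 : (0 < lam)%R by apply: lt_le_trans lam1.
(* Half of [rho k = g k / (4 lam)]: the other half absorbs [d x y], as distances are measured from
   [x] and the balls are centred at [y]. *)
exists (1 / (8 * lam))%R; first by rewrite divr_gt0// mulr_gt0.
move=> x y.
pose L k : R := ln (ln (2 ^+ k)).
(* For [2^k <= t < 2^(k+1)] one has [t / ln (ln t) <= v k], so [g k] dominates [phi_inv] on the
   whole dyadic block, while the supremum up to [t] is at least the one up to [2^k]. *)
pose v k : R := (2 ^+ k.+1 / L k)%R.
pose g k : R := fine (phi_inv phi (v k)).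
pose V : R := (8 * lam * (Rinf + Rinf * (d y o + 1) `^ ups + d x y + 1))%R.
have V0 : (0 < V)%R.
  have R1 := Rinf1.
  rewrite mulr_gt0 ?mulr_gt0//.
  have h1 : (0 <= Rinf * (d y o + 1) `^ ups)%R by rewrite mulr_ge0 ?powR_ge0//; lra.
  by have := d_ge0 Hs x y; lra.
have l2 := @ln2_gt0 R.
have [k0 _ Hk] : \forall k \near \oo, [/\ (1 <= k)%N, (1 <= L k)%R, (1 <= q * L k)%R,
    (phi (Rinf + 1) <= k%:R * ln 2 / 2)%R & (phi V <= k%:R * ln 2 / 2)%R].
  near=> k; split.
  - by near: k; exact: nbhs_infty_ge.
  - by near: k; exact: near_loglog_pow2.
  - by rewrite mulrC -ler_pdivrMr//; near: k; exact: near_loglog_pow2.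
  - rewrite ler_pdivlMr// -ler_pdivrMr//; near: k; exact: near_ge_nat.
  - rewrite ler_pdivlMr// -ler_pdivrMr//; near: k; exact: near_ge_nat.
have lnE k : ln (2 ^+ k : R) = (k%:R * ln 2)%R by rewrite lnXn// mulr_natl.
have ratio k t : (k0 <= k)%N -> (2 ^+ k <= t)%R ->
    (L k <= ln (ln t))%R /\ (k%:R * ln 2 / 2 <= t / ln (ln t))%R.
  move=> kk kt; have [k1 Lk _ _ _] := Hk k kk.
  have t0 : (0 < t)%R by apply: lt_le_trans kt; rewrite exprn_gt0.
  have ltk : (ln (2 ^+ k) <= ln t)%R by rewrite ler_ln// posrE exprn_gt0.
  have lk0 : (0 < ln (2 ^+ k : R))%R by rewrite lnE mulr_gt0// ltr0n.
  have Lt : (L k <= ln (ln t))%R by rewrite ler_ln// posrE (lt_le_trans lk0).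
  split=> //; apply: le_trans (ratio_loglog_ge t0 _); last first.
    by apply: lt_le_trans Lt; apply: lt_le_trans Lk.
  by rewrite ler_pM2r ?invr_gt0// -lnE.
have gP k : (k0 <= k)%N -> [/\ phi_inv phi (v k) = (g k)%:E, (V <= g k)%R &
    (phi (g k / 2) <= v k)%R].
  move=> kk; have [k1 Lk _ pR pV] := Hk k kk.
  have [_ r1] := ratio k _ kk (lexx _).
  have vk : (2 ^+ k / L k <= v k)%R.
    rewrite /v ler_pM2r ?invr_gt0 ?(lt_le_trans ltr01)//.
    by rewrite exprS ler_peMl ?exprn_ge0// ler1n.
  have [g' [Eg g1 g2 _]] := phi_inv_fin (le_trans pR (le_trans r1 vk)).
  have gE : g k = g' by rewrite /g Eg.
  have Vg : (V <= g')%R.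
    by rewrite -lee_fin -Eg; apply: phi_inv_ge => //; apply: le_trans pV (le_trans r1 vk).
  rewrite gE; split=> //; apply: g2.
  by have R1 := Rinf1; apply/andP; split; lra.
pose rho k : R := (g k / (4 * lam))%R.
pose E k := stay d X y (rho k) 0 (2 ^+ k).
have p2 k : (0 <= 2 ^+ k :> R)%R by rewrite exprn_ge0.
have mE k : measurable (E k) by apply: measurable_stay; rewrite lexx p2.
pose cst : R := (2 * (C6 * expR C7 / ln 2 ^+ 2))%R.
have cst0 : (0 <= cst)%R.
  by rewrite mulr_ge0// divr_ge0 ?exprn_ge0 ?(ltW l2)// mulr_ge0 ?expR_ge0// ltW.
have PE k : (k0 <= k)%N -> P (Some y) (E k) <= (cst / k%:R - cst / k.+1%:R)%:E.
  move=> kk; have [k1 Lk qL _ _] := Hk k kk; have [_ Vg pg] := gP k kk.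
  pose r := (g k / (2 * lam))%R.
  have rV : (4 * (Rinf + Rinf * (d y o + 1) `^ ups + d x y + 1) <= r)%R.
    rewrite /r ler_pdivlMr ?mulr_gt0//; apply: le_trans Vg; rewrite /V.
    by rewrite le_eqVlt; apply/orP; left; apply/eqP; ring.
  have h1 : (0 <= Rinf * (d y o + 1) `^ ups)%R.
    by have R1 := Rinf1; rewrite mulr_ge0 ?powR_ge0//; lra.
  have dxy := d_ge0 Hs x y.
  have R1 := Rinf1.
  have yr : large_r d o Rinf ups y r by rewrite /large_r; lra.
  have rR : (Rinf < r)%R by lra.
  have L0 : (0 < L k)%R by apply: lt_le_trans Lk.
  have gk0 : (0 < g k)%R by apply: lt_le_trans Vg.
  have pg' : (phi (g k / 2) <= 2 * 2 ^+ k / L k)%R by rewrite -exprS.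
  apply: le_trans (P_stay_loglog_le lam0 Hlam L0 qL gk0 pg' rR yr) _.
  by rewrite lee_fin; apply: loglog_pow2_telescope => //; exact: ltW.
have nE : (P (Some y)).-negligible [set w | forall N, exists2 n, (N <= n)%N & E n w].
  apply: (@borel_cantelli_telescope _ _ _ _ E (fun k => cst / k%:R)%R k0) => //.
  - by move=> n; exact: divr_ge0.
  - by move=> e e0; exact: harmonic_lt_eps.
have n0 : (P (Some y)).-negligible (~` [set w | X 0%R w = Some y]).
  exists (~` [set w | X 0%R w = Some y]); split => //.
  - by apply: measurableC; exact: measurable_start Hs Hp y.
  - exact: start_null Hs Hp y.
apply: negligibleS (negligibleU nE n0) => w nT.
apply: contrapT => /not_orP[/existsNP[N1 nN1] /contrapT X0]; apply: nT.
exists (2 ^+ maxn k0 N1)%R => t tT.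
have [k kN /andP[kt tk]] := pow2_between (ltW tT).
have kk : (k0 <= k)%N by apply: leq_trans kN; exact: leq_maxl.
have [k1 Lk _ pR _] := Hk k kk; have [Eg Vg _] := gP k kk.
have [Lt rt] := ratio k t kk kt.
have nEk : ~ E k w.
  by move=> Ek; apply: nN1; exists k => //; apply: leq_trans kN; exact: leq_maxr.
have [s /not_implyP[/andP[s0 st] ns]] : exists s, ~ ((0 <= s <= 2 ^+ k)%R -> cball d y (rho k) (X s w)).
  exact/existsNP.
have lam4 : (0 < 4 * lam)%R by rewrite mulr_gt0.
have rho0 : (0 < rho k)%R by rewrite /rho divr_gt0//; apply: lt_le_trans Vg.
(* [sup_dist] only sees positive times, so an exit at time [0] has to be excluded, by [X_0 = y]. *)
have s_gt0 : (0 < s)%R.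
  rewrite lt_neqAle s0 andbT; apply/eqP => s00; apply: ns.
  by rewrite -s00 X0 /= (d_refl Hs) ltW.
have [f [Ef f1 _ _]] := phi_inv_fin (le_trans pR rt).
have f0 : (0 < f)%R by have R1 := Rinf1; lra.
have fg : (f <= g k)%R.
  rewrite -lee_fin -Ef -Eg; apply: le_ereal_sup => _ [u [u0 uv] <-]; exists u => //.
  split=> //; apply: (le_trans uv); rewrite /v.
  have t0 : (0 < t)%R by apply: lt_le_trans kt; rewrite exprn_gt0.
  have L0 : (0 < L k)%R by apply: lt_le_trans Lk.
  apply: ler_pM; rewrite ?(ltW t0) ?(ltW tk)//.
    by rewrite invr_ge0; apply/ltW/(lt_le_trans L0).
  by rewrite lef_pV2// posrE// (lt_le_trans L0).
rewrite Ef inver gt_eqF// lee_pdivlMr//.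
apply: le_trans (sup_dist_ge Hs x (r := rho k) (s := s) (y := y) _ ns); last first.
  by rewrite s_gt0 (le_trans st).
rewrite -EFinM lee_fin.
have h1 : (1 / (8 * lam) * f <= 1 / (8 * lam) * g k)%R.
  by rewrite ler_wpM2l// divr_ge0// mulr_ge0// ltW.
have h2 : (1 / (8 * lam) * g k = rho k / 2)%R by rewrite /rho; field; rewrite gt_eqF.
have h3 : (2 * d x y <= rho k)%R.
  rewrite /rho ler_pdivlMr//; apply: le_trans Vg; rewrite /V.
  have R1 := Rinf1.
  have h4 : (0 <= Rinf * (d y o + 1) `^ ups)%R by rewrite mulr_ge0 ?powR_ge0//; lra.
  rewrite (_ : 2 * d x y * (4 * lam) = 8 * lam * d x y)%R; last by ring.
  by rewrite ler_pM2l ?mulr_gt0//; lra.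
by lra.
Unshelve. all: by end_near. Qed.

(** * The upper bound *)

Lemma one_minus_harmonic (c : R) n : (0 < c)%R ->
  (1 - c / n.+1%:R <= expR (- (c * (ln n.+2%:R - ln n.+1%:R))))%R.
Proof.
move=> c0.
have h : (ln n.+2%:R - ln n.+1%:R <= n.+1%:R^-1 :> R)%R.
  rewrite -ln_div ?posrE ?ltr0n//.
  rewrite (_ : n.+2%:R / n.+1%:R = 1 + n.+1%:R^-1)%R; last first.
    by rewrite -[in LHS]natr1 mulrDl divff ?mul1r// pnatr_eq0.
  by apply: le_ln1Dx; rewrite (lt_trans (_ : _ < 0)%R)// ?ltrN10// invr_gt0.
apply: (@le_trans _ _ (expR (- (c / n.+1%:R)))); first exact: expR_ge1Dx.
by rewrite ler_expR lerN2 ler_pM2l.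
Qed.

(** A conditional form of the second Borel-Cantelli lemma. Each factor [1 - c / (n+1)] is at most
    the exponential of [- c (ln (n+2) - ln (n+1))]; the exponents telescope and the product over [m]
    steps is at most [((N+1) / (N+m+1))^c], which tends to [0]. *)
Lemma P_avoid_le (y : M) (G : nat -> set Omega) (tt : nat -> R) (c : R) N0 :
  (forall n, (0 <= tt n)%R) -> (forall n, (tt n <= tt n.+1)%R) -> (0 < c)%R ->
  (forall n, filt (tt n.+1) (G n)) ->
  (forall n A, (N0 <= n)%N -> filt (tt n) A ->
     P (Some y) (A `&` G n) <= (1 - c / n.+1%:R)%:E * P (Some y) A) ->
  forall N, (N0 <= N)%N ->
  P (Some y) (\bigcap_(n in [set n | (N <= n)%N]) G n) = 0.
Proof.
move=> tt0 ttS c0 fG step N N0N.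
pose B m := \bigcap_(n in [set n | (N <= n < N + m)%N]) G n.
have B0 : B 0%N = setT.
  by apply/seteqP; split=> // w _ n /= /andP[Nn]; rewrite addn0 ltnNge Nn.
have BS m : B m.+1 = B m `&` G (N + m)%N.
  apply/seteqP; split => w.
    move=> Hw; split; last by apply: Hw => /=; rewrite leq_addr addnS leqnn.
    by move=> n /= /andP[Nn nm]; apply: Hw; rewrite /= Nn addnS ltnS ltnW.
  move=> [Hw Hm] n /= /andP[Nn]; rewrite addnS ltnS leq_eqVlt => /predU1P[->//|nm].
  by apply: Hw; rewrite /= Nn.
have fB m : filt (tt (N + m)%N) (B m).
  elim: m => [|m IH]; first by rewrite B0; exact: filtT Hp _.
  rewrite BS addnS; apply: (filtI Hp) => //.
  by apply: (filt_mono Hp) IH; rewrite tt0 ttS.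
have mB m : measurable (B m) := filt_measurable Hp (fB m).
have bnd m : P (Some y) (B m) <=
    (expR (- (c * (ln (N + m).+1%:R - ln N.+1%:R))))%:E.
  elim: m => [|m IH].
    by rewrite addn0 subrr mulr0 oppr0 expR0; exact: probability_le1.
  rewrite BS; apply: le_trans (step _ _ (leq_trans N0N (leq_addr _ _)) (fB m)) _.
  apply: (@le_trans _ _ ((expR (- (c * (ln (N + m).+2%:R - ln (N + m).+1%:R))))%:E *
      P (Some y) (B m))).
    by apply: lee_wpmul2r => //; rewrite lee_fin one_minus_harmonic.
  apply: (@le_trans _ _ ((expR (- (c * (ln (N + m).+2%:R - ln (N + m).+1%:R))))%:E *
      (expR (- (c * (ln (N + m).+1%:R - ln N.+1%:R))))%:E)).
    by apply: lee_wpmul2l => //; rewrite lee_fin expR_ge0.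
  rewrite -EFinM -expRD lee_fin ler_expR addnS.
  by rewrite le_eqVlt; apply/orP; left; apply/eqP; ring.
apply/eqP; rewrite eq_le measure_ge0 andbT; apply/lee_addgt0Pr => e e0.
rewrite add0e.
have [m0 _ Hm] : \forall m \near \oo, (expR (ln N.+1%:R - ln e / c) <= m%:R :> R)%R.
  exact: near_ge_nat.
apply: (@le_trans _ _ (P (Some y) (B m0))).
  apply: le_measure; rewrite ?inE//.
    rewrite bigcap_mkcond; apply: bigcapT_measurable => n; case: ifPn => // _.
    exact: filt_measurable Hp _ _ (fG n).
  by move=> w Hw n /= /andP[Nn _]; exact: Hw.
apply: le_trans (bnd m0) _; rewrite lee_fin -[leRHS](@lnK _ e) ?posrE// ler_expR.
have h1 : (ln N.+1%:R - ln e / c <= ln (N + m0).+1%:R)%R.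
  rewrite -[leLHS]expRK ler_ln ?posrE ?expR_gt0//.
  apply: le_trans (Hm m0 (leqnn _)) _; rewrite ler_nat.
  by rewrite -addnS; apply: leq_trans (leq_addl N m0.+1).
have : (c * (ln N.+1%:R - ln e / c) <= c * ln (N + m0).+1%:R)%R by rewrite ler_pM2l.
rewrite mulrBr mulrCA divff ?gt_eqF// mulr1; lra.
Qed.

(** [P_exit_le] with [n.+1] steps of size [b = r / 2^(n+1)], which fit because [n + 1 <= 2^n]. In
    [C3 * K + K] the first term bounds the jumps; the second gives [K * tower n < phi b], so that
    (B4) with [n = 1] applies at scale [b]. *)
Lemma P_exit_tower_le (A r : R) y n : (0 < A)%R -> (0 < r)%R -> (1 <= n)%N ->
  (forall z, (d y z <= r)%R -> large_r d o Rinf ups z (r / 2 ^+ n.+1)) ->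
  ((phi (r / 2 ^+ n.+1))^-1 <=
    dbl ^+ n.+1 * (3 * ln n.+1%:R) / tower n.+1 / A)%R ->
  (n.+1%:R * (tower n * ((C3 * K + K) / A *
     (dbl ^+ n.+1 * (3 * ln n.+1%:R) / tower n.+1))) <= expR (- n%:R))%R ->
  P (Some y) (~` stay d X y r 0 (tower n)) <=
    ((1 - c_surv) ^+ n.+1 + expR (- n%:R))%:E.
Proof.
move=> A0 r0 n1 large phib hstep.
have tw0 : (0 < tower n :> R)%R by exact: expR_gt0.
set b := (r / 2 ^+ n.+1)%R in large phib.
have b0 : (0 < b)%R by rewrite divr_gt0// exprn_gt0.
have pb0 := phi_gt0 b0.
have CK : (0 < C3 * K + K)%R by rewrite addr_gt0// mulr_gt0.
have nb : (2 * n.+1%:R * b <= r)%R.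
  rewrite /b mulrCA ger_pMr// ler_pdivrMr ?exprn_gt0// mul1r exprS ler_pM2l//.
  exact: pow2_ge.
have tphi : (n.+1%:R * (tower n * (C3 * K + K) / phi b) <= expR (- n%:R))%R.
  apply: le_trans hstep; rewrite ler_pM2l ?ltr0n// -mulrA ler_pM2l//.
  apply: (@le_trans _ _ ((C3 * K + K) *
      (dbl ^+ n.+1 * (3 * ln n.+1%:R) / tower n.+1 / A))%R).
    by rewrite ler_pM2l.
  rewrite le_eqVlt; apply/orP; left; apply/eqP.
  by field; rewrite !gt_eqF ?expR_gt0.
have tK : (K * tower n < phi b)%R.
  rewrite -[ltRHS]mul1r -ltr_pdivrMr//.
  apply: (@lt_le_trans _ _ (n.+1%:R * (tower n * (C3 * K + K) / phi b))%R).
    apply: (@lt_le_trans _ _ (tower n * (C3 * K + K) / phi b)%R).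
      rewrite ltr_pM2r ?invr_gt0// mulrC ltr_pM2l// ltrDr.
      by rewrite mulr_gt0.
    rewrite ler_peMl ?ler1n// divr_ge0 ?(ltW pb0)// mulr_ge0//; exact: ltW.
  by apply: le_trans tphi _; rewrite -expR0 ler_expR oppr_le0.
have lg z : (d y z <= 2 * n.+1%:R * b)%R -> large_r d o Rinf ups z b.
  by move=> yz; apply: large; exact: le_trans nb.
have h := P_exit_le b0 tw0 tK lg.
apply: (@le_trans _ _ (P (Some y) (~` stay d X y (2 * n.+1%:R * b) 0 (tower n)))).
  apply: le_measure; rewrite ?inE.
  - by apply/measurableC/measurable_stay; rewrite lexx ltW.
  - by apply/measurableC/measurable_stay; rewrite lexx ltW.
  - by apply: subsetC => w Hw s st; apply: (cballS nb); exact: Hw.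
apply: le_trans h _; rewrite lee_fin lerD2l; apply: le_trans tphi.
rewrite ler_pM2l ?ltr0n// -[leRHS]mulrA ler_pM2l// ler_pM2r ?invr_gt0//.
by rewrite lerDl ltW.
Qed.

(** (B4) is used with order [t.+1], where [t] is the integer part of [ln N / C5]: the exponential
    loses at most [1 / N], and rounding up turns [C4] into [c_surv]. The factor [3] in the
    hypothesis on [phi r] cancels the one in [tower_ratio]. *)
Lemma P_stay_tower_ge (r T : R) y z N : (2 <= N)%N -> large_r d o Rinf ups z r ->
  (d y z <= r)%R -> (3 * K * C5 * tower_ratio N <= phi r)%R ->
  (0 <= T <= tower N)%R ->
  (c_surv / N%:R)%:E <= P (Some z) (stay d X y (2 * r) 0 T).
Proof.
move=> N2 zr yz hphi /andP[T0 TN].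
have lN := @ln_nat_gt0 R N N2; have tN : (0 < tower N :> R)%R by exact: expR_gt0.
pose t := Num.truncn (ln N%:R / C5).
have lNC : (0 < ln N%:R / C5)%R by rewrite divr_gt0.
have /Num.Theory.truncn_itv/andP[m1 m2] := ltW lNC.
have hm : (K * tower N < t.+1%:R * phi r)%R.
  apply: (@lt_le_trans _ _ (t.+1%:R * (3 * K * C5 * tower_ratio N))%R).
    rewrite (_ : t.+1%:R * _ = t.+1%:R / (ln N%:R / C5) * (K * tower N))%R; last first.
      by rewrite /tower_ratio; field; rewrite !gt_eqF.
    by rewrite ltr_pMl ?mulr_gt0// ltr_pdivlMr// mul1r.
  by rewrite ler_pM2l ?ltr0n.
have tN0 := ltW tN.
apply: le_trans (le_trans _ (P_stay_ge zr (ltn0Sn t) tN0 hm)) _.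
  have eN : N%:R = expR (ln N%:R) :> R by rewrite lnK// posrE ltr0n ltnW.
  rewrite lee_fin /c_surv -mulrA ler_pM2l// [X in (_ / X)%R]eN -expRB ler_expR.
  have : (C5 * t%:R <= C5 * (ln N%:R / C5))%R by rewrite ler_pM2l.
  rewrite (_ : C5 * (ln N%:R / C5) = ln N%:R)%R; last by field; rewrite gt_eqF.
  by rewrite -[t.+1%:R]natr1 mulNr mulrDr mulr1; move: (C5 * t%:R)%R => zz; lra.
apply: le_measure; rewrite ?inE.
- by apply: measurable_stay; rewrite lexx.
- by apply: measurable_stay; rewrite lexx.
have zr2 : (d y z + r <= 2 * r)%R by rewrite mulr2n mulrDl mul1r lerD2r.
move=> w Hw s /andP[s0 st]; apply: (cballS zr2).
by apply: (cball_tri Hs); apply: Hw; rewrite s0 (le_trans st).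
Qed.

Lemma tower_radius (A : R) : (0 < A)%R -> exists2 lam : R, (0 < lam)%R &
  forall x y : M, exists (r g : nat -> R) (N0 : nat), forall N, (N0 <= N)%N ->
  [/\ (2 <= N)%N, phi_inv phi (tower_ratio N) = (g N)%:E, (0 < g N)%R,
      (r N = 2 * lam * g N)%R & (d x y <= r N)%R] /\
  [/\ (0 < r N)%R, (A * tower_ratio N <= phi (r N))%R,
      (forall z, (d y z <= r N)%R -> large_r d o Rinf ups z (r N / 2 ^+ N)) &
      ((phi (r N / 2 ^+ N))^-1 <= dbl ^+ N * (3 * ln N%:R) / tower N / A)%R].
Proof.
move=> A0; have [lam lam1 Hlam] := phi_growth A.
have lam0 : (0 < lam)%R by apply: lt_le_trans lam1.
exists lam => // x y.
have R1 := Rinf1; have D0 := dbl_gt0.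
have [s0 s0R s01] : exists2 s0, (Rinf < s0)%R & s0 = (Rinf + 1)%R.
  by exists (Rinf + 1)%R; [lra|].
have s00 : (0 < s0)%R by lra.
have [u0 u1] : (0 <= ups)%R /\ (0 < ups < 1)%R.
  by case: Hb => -[_ /andP[u0 u1]] *; rewrite ltW// u0.
have [N0 _ HN] : \forall N \near \oo, [/\ (2 <= N)%N, (d x y <= N%:R)%R,
    (phi s0 <= tower_ratio N)%R, (dbl ^+ (N ^ 2) * phi s0 <= tower_ratio N)%R &
    (forall u, 2 ^+ (N ^ 2) <= u -> Rinf * (d y o + u + 1) `^ ups < u / 2 ^+ N)%R].
  near=> N; split.
  - by near: N; exact: nbhs_infty_ge.
  - by near: N; exact: near_ge_nat.
  - by near: N; exact: near_tower_ratio_ge.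
  - by near: N; apply: near_tower_ratio_pow => //; exact/ltW/phi_gt0.
  - by near: N; exact: near_large_radius.
(* The factor [2] moves strictly beyond [g], where [phi] exceeds [tower_ratio N]; dilating by [lam]
   then multiplies [phi] by [A]. *)
exists (fun N => 2 * lam * fine (phi_inv phi (tower_ratio N)))%R.
exists (fun N => fine (phi_inv phi (tower_ratio N))), N0 => N NN.
have [N2 dN h1 h2 Hr] := HN N NN.
rewrite s01 in h1; have [g [Eg g1 _ g3]] := phi_inv_fin h1; rewrite -s01 in h1 g1.
rewrite Eg /=; set r := (2 * lam * g)%R.
have g0 : (0 < g)%R by apply: lt_le_trans g1.
(* By doubling, [phi] at [2^(N^2) s0] is at most [dbl^(N^2) phi s0], hence at most
   [tower_ratio N]. *)
have hg : (2 ^+ (N ^ 2) <= g)%R.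
  rewrite -lee_fin -Eg; apply: phi_inv_ge; first exact: exprn_gt0.
  apply: le_trans h2; apply: le_trans (phi_double_iter (N ^ 2) s0R).
  by apply: phi_nd; rewrite exprn_gt0//= ler_peMr ?exprn_ge0//; lra.
have gr : (g <= r)%R.
  by rewrite /r ler_peMl ?(ltW g0)//; lra.
have r0 : (0 < r)%R by apply: lt_le_trans gr.
have hphi : (A * tower_ratio N <= phi r)%R.
  have gR : (Rinf < 2 * g)%R by lra.
  have := Hlam _ gR; rewrite /r (_ : 2 * lam * g = lam * (2 * g))%R; last by ring.
  by apply: le_trans; rewrite ler_pM2l//; apply/ltW/g3; lra.
have large z : (d y z <= r)%R -> large_r d o Rinf ups z (r / 2 ^+ N).
  move=> yz; apply: le_lt_trans (Hr _ (le_trans hg gr)).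
  rewrite ler_wpM2l//; first lra.
  apply: ge0_ler_powR; rewrite ?nnegrE//.
  - by rewrite addr_ge0// (d_ge0 Hs).
  - by have := d_ge0 Hs y o; lra.
  - by have := d_tri Hs z y o; rewrite (d_sym Hs z y); lra.
have bR : (Rinf < r / 2 ^+ N)%R.
  have := large y; rewrite (d_refl Hs) => /(_ (ltW r0)).
  apply: le_lt_trans; rewrite ler_peMr//; first lra.
  have e1 : (1 `^ ups = 1 :> R)%R by rewrite powR1.
  rewrite -[leLHS]e1; apply: ge0_ler_powR; rewrite ?nnegrE//.
  - by rewrite addr_ge0// (d_ge0 Hs).
  - by rewrite lerDr (d_ge0 Hs).
split; split=> //.
  apply: le_trans (le_trans dN _) (le_trans hg gr).
  rewrite -natrX ler_nat; apply: leq_trans (ltnW (@ltn_expl 2 N isT)) _.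
  by rewrite leq_exp2l// -mulnn leq_pmulr// (leq_trans _ N2).
have lN := @ln_nat_gt0 R N N2; have tN := expR_gt0 (N%:R ^+ 3 : R).
have pb : (0 < phi (r / 2 ^+ N))%R by apply: phi_gt0; lra.
have := phi_double_iter N bR.
rewrite mulrC divfK ?expf_neq0// => /(le_trans hphi).
rewrite /tower_ratio => h3.
rewrite -[leRHS]invrK lef_pV2 ?posrE//; last first.
  by rewrite invr_gt0 !divr_gt0// mulr_gt0 ?exprn_gt0// mulr_gt0.
rewrite (_ : _^-1 = A * (tower N / (3 * ln N%:R)) / dbl ^+ N)%R; last first.
  by field; rewrite !gt_eqF ?exprn_gt0.
by rewrite ler_pdivrMr ?exprn_gt0// [leRHS]mulrC.
Unshelve. all: by end_near. Qed.

Lemma liminf_upper : exists2 b : R, (0 < b)%R & forall x y : M,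
  (P (Some y)).-negligible [set w | ~ (forall T : R, exists2 t, (T < t)%R &
     sup_dist d X x t w / phi_inv phi (t / ln (ln t))%R <= b%:E)].
Proof.
have A0 : (0 < 3 * K * C5)%R by rewrite !mulr_gt0.
have [lam lam0 radius] := tower_radius A0.
(* Seen from [x] the path stays within [d x y + 2 r <= 3 r], and [r = 2 lam g]. *)
exists (6 * lam)%R; first by rewrite mulr_gt0.
move=> x y; have [r [g [N0 HN]]] := radius x y.
have c0 := c_surv_gt0; have c1 := c_surv_le1.
have c01 : (0 < c_surv <= 1)%R by rewrite c0.
have tw0 n : (0 <= tower n :> R)%R by exact: expR_ge0.
have tS n : (tower n <= tower n.+1 :> R)%R.
  by rewrite ler_expR ler_pXn2r ?nnegrE// ler_nat.
have [N1 _ HN1] : \forall n \near \oo, (1 <= n)%N /\ (n.+1%:R * (tower n *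
    ((C3 * K + K) / (3 * K * C5) * (dbl ^+ n.+1 * (3 * ln n.+1%:R) / tower n.+1))) <=
    expR (- n%:R) :> R)%R.
  near=> n; split; first by near: n; exact: nbhs_infty_ge.
  near: n; apply: near_tower_step; first exact: dbl_gt0.
  by apply: divr_ge0; apply: ltW => //; rewrite addr_gt0// mulr_gt0.
pose H n := stay d X y (r n.+1) 0 (tower n).
pose S n := stay d X y (2 * r n.+1) (tower n) (tower n.+1).
have mH n : measurable (H n) by apply: measurable_stay; rewrite lexx tw0.
have nH : (P (Some y)).-negligible [set w | forall N, exists2 n, (N <= n)%N & (~` H n) w].
  apply: (@borel_cantelli_telescope _ _ _ _ (fun n => ~` H n) (tele c_surv) (maxn N0 N1)).
  - by move=> n; exact: measurableC.
  - by move=> n; exact: tele_ge0.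
  - move=> n; rewrite geq_max => /andP[nN0 nN1].
    have [n1 hstep] := HN1 n nN1; have [_ [r0 _ large phib]] := HN n.+1 (leqW nN0).
    by rewrite tele_diff//; exact: P_exit_tower_le hstep.
  - by move=> e e0; exact: tele_lt_eps.
have fHS n : filt (tower n.+1) (H n `\` S n).
  apply: (filtD Hp); last by apply: (filt_stay Hs Hp); rewrite tw0 tS.
  apply: (filt_mono Hp) (filt_stay Hs Hp _ _ _); first by rewrite tw0 tS.
  by rewrite lexx tw0.
(* The avoided event is [H n] without [S n], not the complement of [S n]: the lower bound for
   staying is only known for paths still in the small ball at time [tower n]. *)
have avoid n A' : (N0 <= n)%N -> filt (tower n) A' ->
    P (Some y) (A' `&` (H n `\` S n)) <= (1 - c_surv / n.+1%:R)%:E * P (Some y) A'.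
  move=> nN0 fA'; have [[N2 _ _ _ _] [r0 hphi large _]] := HN n.+1 (leqW nN0).
  have p0 : (0 <= c_surv / n.+1%:R)%R by rewrite divr_ge0// ltW.
  have p1 : (c_surv / n.+1%:R <= 1)%R.
    by rewrite ler_pdivrMr ?ltr0n// mul1r (le_trans c1)// ler1n.
  have fAH : filt (tower n) (A' `&` H n).
    by apply: (filtI Hp) => //; apply: (filt_stay Hs Hp); rewrite lexx tw0.
  have mA' := filt_measurable Hp fA'; have mAH := filt_measurable Hp fAH.
  have mS : measurable (S n) by apply: measurable_stay; rewrite tw0 tS.
  have tn : (0 <= tower n.+1 - tower n :> R)%R by rewrite subr_ge0.
  have AD w : (A' `&` H n) w -> (Some @` [set z | (d y z <= r n.+1)%R]) (X (tower n) w).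
    move=> [_ /(_ (tower n))]; rewrite tw0 lexx => /(_ isT).
    by case: (X _ w) => // z yz; exists z.
  have survive z : (d y z <= r n.+1)%R -> (c_surv / n.+1%:R)%:E <=
      P (Some z) (stay d X y (2 * r n.+1) 0 (tower n.+1 - tower n)).
    move=> yz; apply: P_stay_tower_ge => //; last by rewrite tn lerBlDr lerDl tw0.
    apply: large_rP (large z yz) _.
    by rewrite ler_pdivrMr ?exprn_gt0// ler_peMr ?exprn_ege1 ?ler1n// ltW.
  have := @stay_markov _ _ _ _ _ _ _ _ _ Hs Hp y (2 * r n.+1)%R _ _ _ (Some y)
     _ _ (tw0 n) tn fAH p0 AD survive.
  rewrite subrKC => h.
  have fin B' : measurable B' -> P (Some y) B' \is a fin_num by move=> ?; exact: fin_num_measure.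
  rewrite setDE setIA -setDE measureD//; last by rewrite -ge0_fin_numE// fin.
  apply: (@le_trans _ _ ((1 - c_surv / n.+1%:R)%:E * P (Some y) (A' `&` H n))).
    by rewrite EFinB muleBl// ?fin// mul1e; apply: leeB.
  apply: lee_wpmul2l; first by rewrite lee_fin subr_ge0.
  by apply: le_measure; rewrite ?inE//; exact: subIsetl.
have nB : (P (Some y)).-negligible
    (\bigcup_N (\bigcap_(n in [set n | (maxn N0 N <= n)%N]) (H n `\` S n))).
  apply: negligible_bigcup => N.
  exists (\bigcap_(n in [set n | (maxn N0 N <= n)%N]) (H n `\` S n)); split => //.
    rewrite bigcap_mkcond; apply: bigcapT_measurable => n; case: ifPn => // _.
    exact: filt_measurable Hp _ _ (fHS n).
  exact: (@P_avoid_le y (fun n => H n `\` S n) tower c_surv N0 tw0 tS c0 fHS avoid _ (leq_maxl _ _)).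
(* Almost surely [H n] holds for all large [n], and [H n] without [S n] does not; hence [S n] occurs
   together with [H n] for arbitrarily large [n]. *)
apply: negligibleS (negligibleU nH nB) => w nT.
apply: contrapT => /not_orP[/existsNP[N2 nN2] nB']; apply: nT => T.
have Hw n : (N2 <= n)%N -> H n w.
  by move=> nn; apply: contrapT => nHn; apply: nN2; exists n.
have [T1 _ HT1] : \forall n \near \oo, (T + 1 <= n%:R :> R)%R by exact: near_ge_nat.
have [n nn Sn] : exists2 n, (maxn N0 (maxn N2 T1) <= n)%N & S n w.
  apply: contrapT => nS; apply: nB'; exists (maxn N2 T1) => // n /= nn.
  split; last by move=> Sn; apply: nS; exists n.
  by apply: Hw; apply: leq_trans nn; rewrite !leq_max leqnn orbT.
move: nn; rewrite !geq_max => /and3P[nN0 nN2' nT1].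
have [[N2' Eg g0 rE dr] [r0 _ _ _]] := HN n.+1 (leqW nN0).
have ntow : (n%:R <= tower n.+1 :> R)%R.
  apply: le_trans (expR_ge_self _).
  apply: (@le_trans _ _ n.+1%:R); first by rewrite ler_nat.
  by rewrite exprS ler_peMr// exprn_ege1// ler1n.
exists (tower n.+1).
  by apply: lt_le_trans ntow; apply: lt_le_trans (HT1 n nT1); rewrite ltrDl.
rewrite loglog_tower// -/(tower_ratio n.+1) Eg inver gt_eqF// lee_pdivrMr//.
apply: le_trans (sup_dist_le Hs x (y := y) (r := (2 * r n.+1)%R) _) _.
  move=> s /andP[s0 st]; have [sn|ns] := leP s (tower n).
    have r2 : (r n.+1 <= 2 * r n.+1)%R by rewrite ler_peMl ?ler1n// ltW.
    by apply: (cballS r2); apply: (Hw n nN2'); rewrite ltW.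
  by apply: Sn; rewrite ltW.
rewrite -EFinM lee_fin; apply: (@le_trans _ _ (3 * r n.+1)%R).
  by rewrite (_ : 3 * r n.+1 = r n.+1 + 2 * r n.+1)%R ?lerD2r//; ring.
by rewrite rE le_eqVlt; apply/orP; left; apply/eqP; ring.
Unshelve. all: by end_near. Qed.

End scale.

Lemma liminf_infty_ge {R : realType} (g : R -> \bar R) (b : \bar R) :
  (exists T : R, forall t, (T < t)%R -> b <= g t) -> b <= liminf_infty g.
Proof.
move=> [T H]; apply: (@le_trans _ _ (ereal_inf (g @` [set t : R | (T < t)%R]))).
  by apply: le_ereal_inf_tmp => _ [t /H + <-].
by apply: ereal_sup_ubound; exists T.
Qed.

Lemma liminf_infty_le {R : realType} (g : R -> \bar R) (b : \bar R) :
  (forall T : R, exists2 t, (T < t)%R & g t <= b) -> liminf_infty g <= b.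
Proof.
move=> H; apply: ge_ereal_sup => _ [T _ <-].
have [t Tt gt] := H T; apply: le_trans gt.
by apply: ereal_inf_lbound; exists t.
Qed.

Theorem mainTheorem3 (R : realType)
  (dM : measure_display) (M : measurableType dM) (d : M -> M -> R)
  (dO : measure_display) (Omega : measurableType dO)
  (P : option M -> probability Omega R) (X : R -> Omega -> option M)
  (J : M -> {measure set M -> \bar R}) (kappa : M -> \bar R)
  (o : M) (Rinf ups ell C1 C2 C3 C4 C5 C6 C7 : R) (phi : R -> R) :
  standing_space d ->
  standard_process d P X ->
  levy_system d P X J kappa ->
  conditions_B d P X J kappa o Rinf ups ell C1 C2 C3 C4 C5 C6 C7 ->
  admissible d P X o Rinf ups phi ->
  exists b1 b2 : R, (0 < b1)%R /\ (b1 <= b2)%R /\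
    forall x y : M,
      {ae P (Some y), forall w,
        b1%:E <= liminf_infty (fun t : R =>
                   sup_dist d X x t w / phi_inv phi (t / ln (ln t))) /\
        liminf_infty (fun t : R =>
                   sup_dist d X x t w / phi_inv phi (t / ln (ln t))) <= b2%:E}.
Proof.
move=> Hs Hstd Hl Hb [phi0 phi_nd [K K1 phiK]].
have [filt Hp] := standard_processP Hstd.
have [b1 b10 low] := liminf_lower Hs Hp Hb phi0 phi_nd K1 phiK.
have [b2 _ up] := liminf_upper Hs Hp Hl Hb phi0 phi_nd K1 phiK.
exists b1, (Num.max b1 b2); split=> //; split; first by rewrite le_max lexx.
move=> x y; apply: negligibleS (negligibleU (low x y) (up x y)) => w nw.
apply: contrapT => /not_orP[/contrapT h1 /contrapT h2]; apply: nw; split.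
  exact: liminf_infty_ge.
apply: le_trans (liminf_infty_le h2) _.
by rewrite lee_fin le_max lexx orbT.
Qed.
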